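(* Let $\mathfrak s$ be a semisimple Lie algebra over $\mathbb K\in\{\mathbb R,\mathbb C\}$, $\mathfrak g=\mathfrak s\oplus\mathbb K$, $\pi_1$ the Lie–Poisson bivector on $\mathfrak g^*$, and let $\pi_2$ be a centrally linearizable quadratic Poisson bivector on $\mathfrak g^*$ written in the form $$\pi_2=[\widetilde X,\pi_1]=\pi-\pi_1(q)\wedge\frac{\partial}{\partial x_0}+x_0\pi_1,\qquad \widetilde X=X+q\frac{\partial}{\partial x_0}-x_0E,\quad \pi=[X,\pi_1],$$ with $X$ a quadratic vector field and $q$ a homogeneous quadratic polynomial on $\mathfrak s^*$. Then for any Casimir function $f$ of $\pi_1$ (i.e. $\pi_1(f)=0$) there exists a Magri–Lenard chain $f_0:=f,f_1,f_2,\dots$. Taking $f=x_0$ one gets a Magri–Lenard chain $$x_0,\ \widetilde Xx_0=q,\ f_2,\ \dots,$$ and in particular the quadratic polynomial $q$ belongs to the canonical involutive family of functions related to the Poisson pencil $\{\lambda_1\pi_1+\lambda_2\pi_2\}$.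
   Context: Multivector fields on a vector space are linear, quadratic, etc. if their coefficients are homogeneous polynomials of degree $1,2,\dots$. $[\cdot,\cdot]$ is the Schouten bracket, normalized by $[X,f]=Xf$, $[X,Y]$ the Lie bracket for vector fields, $[P,Q]=-(-1)^{(p-1)(q-1)}[Q,P]$, $[P,Q\wedge R]=[P,Q]\wedge R+(-1)^{(p-1)q}Q\wedge[P,R]$ for $P,Q$ of degrees $p,q$. For a bivector $\eta$ and a function $f$, $\eta(f):=[\eta,f]$ (contraction of $\eta$ with $df$ over the second index). $\eta$ is Poisson if $[\eta,\eta]=0$. The Lie–Poisson bivector satisfies $\{x,y\}_{\pi_1}=[x,y]$ for $x,y\in\mathfrak g$. Functions are analytic. A quadratic Poisson bivector $\pi_2$ on $\mathfrak g^*=\mathfrak s^*\oplus\mathbb K^*$ is centrally linearizable (CL) if there is $a\in\mathbb K^*\subset\mathfrak g^*$ ($\mathbb K^*$ the dual line), $a\ne0$, with $\pi_2(a)=0$ and $[T_a,\pi_2]=\pi_1$, where $T_a$ is the constant vector field with value $a$. For such $a$: $x_1,\dots,x_n$ are linear coordinates on $\mathfrak s^*$ (extended by zero on $\mathbb K^*$), $x_0$ is the linear coordinate with $x_0(a)=1$, $x_0|_{\mathfrak s^*}=0$, and $E=\sum_{i=1}^nx_i\frac{\partial}{\partial x_i}$. Objects on $\mathfrak s^*$ are treated as objects on $\mathfrak g^*$ not depending on $x_0$ and without $\partial/\partial x_0$ component. Every CL quadratic Poisson bivector can be written in the form displayed in the claim. Two Poisson bivectors with vanishing Schouten bracket generate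 a Poisson pencil $\{\lambda_1\pi_1+\lambda_2\pi_2\}$. A Magri–Lenard chain is an infinite sequence of functions $f_0,f_1,\dots$ with $\pi_1(f_0)=0$ and $\pi_1(f_{i+1})+\pi_2(f_i)=0$ for all $i\ge0$. The canonical involutive family of functions related to the pencil is the family of functions functionally generated by all members of all Magri–Lenard chains starting from all Casimir functions of $\pi_1$ for which such chains exist. *)

(* Defs.v *)
From HB Require Import structures.
From mathcomp Require Import all_boot all_order all_algebra.
From mathcomp Require Import all_classical all_reals all_analysis.
From mathcomp Require Export complex.
(* Its notations clash with those of MathComp-Analysis. *)
From mathcomp Require Import -(notations) mpoly.

Set Implicit Arguments.
Unset Strict Implicit.
Unset Printing Implicit Defensive.

Import Order.TTheory GRing.Theory Num.Theory.
Import numFieldNormedType.Exports.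

Local Open Scope classical_set_scope.
Local Open Scope ring_scope.

Section LieAlgebras.
Variables (K : fieldType) (g : vectType K).
Implicit Types (br : g -> g -> g) (I : {vspace g}).

Record is_lie_bracket br : Prop := IsLieBracket {
  lie_linearl : forall c x y z, br (c *: x + y) z = c *: br x z + br y z;
  lie_linearr : forall c x y z, br z (c *: x + y) = c *: br z x + br z y;
  lie_alternating : forall x, br x x = 0;
  lie_jacobi : forall x y z, br x (br y z) + br y (br z x) + br z (br x y) = 0
}.

Definition is_lie_ideal br I : Prop :=
  forall x y, y \in I -> br x y \in I.

Definition lie_derived br I : {vspace g} :=
  <<[seq br x y | x <- vbasis I, y <- vbasis I]>>%VS.

Definition is_lie_solvable br I : Prop :=
  exists k, iter k (lie_derived br) I = 0%VS.

Definition is_semisimple br : Prop :=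
  forall I, is_lie_ideal br I -> is_lie_solvable br I -> I = 0%VS.

End LieAlgebras.

(* Multivector fields on K^n, given by their components in the coordinates
   x_i(p) = p 0 i: a vector field is sum_i Y^i d_i, a bivector field is
   sum_(i < j) P^(ij) d_i /\ d_j = 1/2 sum_(i, j) P^(ij) d_i /\ d_j with P^(ij)
   antisymmetric, so that {x_i, x_j}_P = P^(ij). *)
Section MultivectorFields.
Variables (K : numFieldType) (n : nat).

Definition scalar_fun := 'rV[K]_n -> K.
Definition vector_field := 'rV[K]_n -> 'rV[K]_n.
Definition bivector_field := 'rV[K]_n -> 'M[K]_n.
Definition trivector_field := 'rV[K]_n -> 'I_n -> 'I_n -> 'I_n -> K.

Implicit Types (f : scalar_fun) (Y Z : vector_field) (P Q : bivector_field).

Definition is_bivector P : Prop := forall p, (P p)^T = - P p.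

Definition partial (i : 'I_n) f : scalar_fun :=
  fun p => 'D_(delta_mx 0 i) f p.

Definition wedge Y Z : bivector_field :=
  fun p => \matrix_(i, j) (Y p 0 i * Z p 0 j - Y p 0 j * Z p 0 i).

(* The Schouten brackets [Y, f], [P, f], [Y, P] and [P, Q], in components.
   They follow from the normalization [Y, f] = Y f, [Y, Z] = Lie bracket and
   the graded antisymmetry and Leibniz rules, which give
   [Y /\ Z, f] = (Z f) Y - (Y f) Z,
   [Y, Z /\ T] = [Y, Z] /\ T + Z /\ [Y, T] and
   [P, Y /\ Z] = - [Y, P] /\ Z + Y /\ [Z, P]. *)
Definition schouten_vf Y f : scalar_fun :=
  fun p => \sum_i Y p 0 i * partial i f p.

Definition schouten_bf P f : vector_field :=
  fun p => \row_i \sum_j P p i j * partial j f p.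

Definition schouten_vb Y P : bivector_field :=
  fun p => \matrix_(i, j) \sum_l
    (Y p 0 l * partial l (fun z => P z i j) p
     - P p l j * partial l (fun z => Y z 0 i) p
     - P p i l * partial l (fun z => Y z 0 j) p).

Definition schouten_bb P Q : trivector_field :=
  fun p i j k =>
    let t i j k := \sum_l
      (P p i l * partial l (fun z => Q z j k) p
       + Q p i l * partial l (fun z => P z j k) p) in
    t i j k + t j k i + t k i j.

Definition schouten_commute P Q : Prop :=
  forall p i j k, schouten_bb P Q p i j k = 0.

Definition is_poisson P : Prop := is_bivector P /\ schouten_commute P P.

Definition is_poisson_pencil P Q : Prop :=
  [/\ is_poisson P, is_poisson Q & schouten_commute P Q].

Definition homog_poly_fun (d : nat) f : Prop :=
  exists2 F : mpoly n K,
    F \is ishomog1 d mdeg & forall p, f p = meval (p 0) F.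

Definition quadratic_vf Y : Prop :=
  forall i, homog_poly_fun 2 (fun p => Y p 0 i).

Definition quadratic_bf P : Prop :=
  is_bivector P /\ forall i j, homog_poly_fun 2 (fun p => P p i j).

End MultivectorFields.

(* Analytic over K (real analytic if K is the field of reals, holomorphic if it
   is the field of complex numbers): near each point of U, f is the sum of an
   absolutely convergent power series.  The partial sums are taken over the
   multi-indices alpha with all alpha_i < m. *)
Section Analytic.
Variables (K : numFieldType) (n : nat).
Implicit Types (f : scalar_fun K n) (c : {ffun 'I_n -> nat} -> K).

Definition pseries_term c (v : 'rV[K]_n) m (alpha : {ffun 'I_n -> 'I_m}) : K :=
  c [ffun i => alpha i : nat] * \prod_i v 0 i ^+ alpha i.

Definition analytic_at (p : 'rV[K]_n) f : Prop :=
  exists c, exists2 r : K, 0 < r &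
    forall v : 'rV[K]_n, (forall i, `|v 0 i| < r) ->
      (exists M : K, forall m, \sum_alpha `|@pseries_term c v m alpha| <= M) /\
      (fun m => \sum_alpha @pseries_term c v m alpha) @ \oo --> f (p + v).

Definition analytic_on (U : set 'rV[K]_n) f : Prop :=
  forall p, U p -> analytic_at p f.

End Analytic.

Section Chains.
Variables (K : numFieldType) (n : nat).
Implicit Types U : set 'rV[K]_n.

Definition is_casimir U (P1 : bivector_field K n)
    (f : scalar_fun K n) : Prop :=
  analytic_on U f /\ forall p, U p -> schouten_bf P1 f p = 0.

Definition magri_lenard_chain U (P1 P2 : bivector_field K n)
    (f : nat -> scalar_fun K n) : Prop :=
  [/\ forall i, analytic_on U (f i),
      is_casimir U P1 (f 0%N) &
      forall i p, U p -> schouten_bf P1 (f i.+1) p + schouten_bf P2 (f i) p = 0].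

Definition chain_member U (P1 P2 : bivector_field K n)
    (h : scalar_fun K n) : Prop :=
  exists f i, magri_lenard_chain U P1 P2 f /\ h = f i.

Definition canonical_family U (P1 P2 : bivector_field K n)
    (h : scalar_fun K n) : Prop :=
  exists (k : nat) (f : 'I_k -> scalar_fun K n)
         (W : set 'rV[K]_k) (F : scalar_fun K k),
    [/\ forall j, chain_member U P1 P2 (f j), open W, analytic_on W F &
        forall p, U p -> W (\row_j f j p) /\ h p = F (\row_j f j p)].

End Chains.

(* The dual of a Lie algebra g with basis y_0, ..., y_(n-1) is identified with
   K^n: the point p stands for the linear form with y_k |-> p 0 k.  Hence
   {y_i, y_j} (p) is the value of p at [y_i, y_j]. *)
Definition lie_poisson (K : numFieldType) (g : vectType K) (br : g -> g -> g)
    (n : nat) (y : n.-tuple g) : bivector_field K n :=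
  fun p => \matrix_(i, j) \sum_k coord y k (br (tnth y i) (tnth y j)) * p 0 k.

(* g = s (+) K, with the basis (0, 1), (b_0, 0), ..., (b_(n-1), 0) built from a
   basis b of s.  So the dual of g is K^(1 + n): the first coordinate is that on
   the dual line, the others are those on the dual of s. *)
Section CentralExtension.
Variables (K : numFieldType) (s : vectType K) (br : s -> s -> s).
Variables (n : nat) (b : n.-tuple s).

Definition gbracket (u v : s * K^o) : s * K^o := (br u.1 v.1, 0).

Definition gbasis : (1 + n).-tuple (s * K^o)%type :=
  [tuple of (0, 1) :: [seq (x, 0) | x <- b]].

Definition lie_poisson_g : bivector_field K (1 + n) :=
  lie_poisson gbracket gbasis.

End CentralExtension.

Section CentrallyLinearizable.
Variables (K : numFieldType) (n : nat).
Implicit Types (a : 'rV[K]_(1 + n)) (X : vector_field K n) (q : scalar_fun K n).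

Definition lift_fun q : scalar_fun K (1 + n) := fun p => q (rsubmx p).

Definition lift_vf X : vector_field K (1 + n) :=
  fun p => row_mx 0 (X (rsubmx p)).

Definition const_vf a : vector_field K (1 + n) := fun=> a.

Definition cl_vector (P1 P2 : bivector_field K (1 + n)) a : Prop :=
  [/\ rsubmx a = 0, a != 0, P2 a = 0 &
      forall p, schouten_vb (const_vf a) P2 p = P1 p].

(* For a on the dual line, x0 a is the linear coordinate with value 1 at a and 0
   on the dual of s; the corresponding d/dx_0 is const_vf a. *)
Definition x0 a : scalar_fun K (1 + n) :=
  fun p => lsubmx p 0 0 / lsubmx a 0 0.

Definition euler_vf : vector_field K (1 + n) := lift_vf id.

Definition tilde_vf a X q : vector_field K (1 + n) :=
  fun p => lift_vf X p + lift_fun q p *: const_vf a p - x0 a p *: euler_vf p.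

End CentrallyLinearizable.

(* Main.v *)
(* The pencil pi_t = pi1 + t pi2 is a formally trivial deformation of pi1: there
   are polynomial vector fields Z_0 = X~, Z_1, ... such that Z_t = sum_k t^k Z_k
   satisfies [Z_t, pi_t] = pi2, that is [Z_0, pi1] = pi2 and
   [Z_(k+1), pi1] = - [Z_k, pi2].  By the Jacobi identity for the Schouten bracket
   each right-hand side is a pi1-cocycle; it is a coboundary because its components
   form a 2-cocycle and a 1-cocycle of s with values in the finite-dimensional
   modules of polynomials of bounded degree, and these are trivial by Whitehead's
   lemmas.  If f is a Casimir function of pi1, the solution of d/dt f_t = Z_t f_t
   with f_0 = f satisfies pi_t(f_t) = 0, since d/dt pi_t(f_t) is the Lie derivative
   of the vector field pi_t(f_t) along Z_t.  The Taylor coefficients of f_t in t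
   form the chain; they are given by differential operators applied to f, so they
   are analytic wherever f is, whatever the topology of the domain U.

   Whitehead's lemmas are deduced from Cartan's criterion by means of Casimir
   elements.  Since K is R or C, the criterion can be proved over C with the complex
   conjugate of the semisimple part of an endomorphism. *)
Require Import Defs.
From HB Require Import structures.
From mathcomp Require Import all_boot all_order all_algebra.
From mathcomp Require Import all_classical all_reals all_analysis.
From mathcomp Require Import ring lra zify.
From mathcomp Require Import -(notations) mpoly.

Set Implicit Arguments.
Unset Strict Implicit.
Unset Printing Implicit Defensive.

Import Order.TTheory GRing.Theory Num.Theory.
Import numFieldNormedType.Exports.

Local Open Scope classical_set_scope.
Local Open Scope complex_scope.
Local Open Scope ring_scope.

(** * Cartan's criterion *)

(** Solving [pi1(f_(i+1)) = - pi2(f_i)] step by step would be a cohomological problem with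
    coefficients in the analytic functions on [U], an infinite-dimensional module to which
    Whitehead's lemmas do not apply. Deforming the bivector first moves the problem to polynomial
    coefficients: the Hamiltonian vector fields of linear functions preserve the degree because pi1
    is linear, so each cocycle lives in a finite-dimensional module. Two lemmas are needed because g
    is not semisimple: the coordinate on the dual line is a Casimir function, so the components that
    involve it only see the action of s.

    The choice Z_0 = X~ fixes the beginning of the chain as f, X~ f, which is x_0, q for f = x_0.

    In Cartan's criterion only traces and nilpotency are transported to C, along an embedding [iota]
    of K; ideals and representations stay over K, where semisimplicity is assumed. *)

Section Commutators.
Variables (F : fieldType) (d : nat).
Implicit Types (A W : 'M[F]_d.+1) (p : {poly F}).

Definition mxad A W := A * W - W * A.

Fact mxad_is_linear A : linear (mxad A).
Proof.
move=> c u v; rewrite /mxad mulrDr mulrDl -scalerAr -scalerAl scalerBr opprD.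
by rewrite addrACA.
Qed.
HB.instance Definition _ A := GRing.isLinear.Build F _ _ _ (mxad A) (mxad_is_linear A).

(** The value at [W] of the polynomial [p] in the operator [ad A]. Iterates spare a matrix of that
    operator on the space of matrices. *)
Definition mxad_poly A p W := \sum_(k < size p) p`_k *: iter k (mxad A) W.

Lemma mxad_polyE A p W m : (size p <= m)%N ->
  mxad_poly A p W = \sum_(k < m) p`_k *: iter k (mxad A) W.
Proof.
move=> lepm; rewrite /mxad_poly (big_ord_widen m (fun k => p`_k *: iter k (mxad A) W)) //.
rewrite big_mkcond; apply: eq_bigr => k _; case: ltnP => // lepk.
by rewrite nth_default // scale0r.
Qed.

Lemma mxad_polyD A p q W : mxad_poly A (p + q) W = mxad_poly A p W + mxad_poly A q W.
Proof.
rewrite !(@mxad_polyE _ _ _ (maxn (size p) (size q))) ?leq_maxl ?leq_maxr ?size_polyD //.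
by rewrite -big_split; apply: eq_bigr => k _; rewrite coefD scalerDl.
Qed.

Lemma mxad_polyC A c W : mxad_poly A c%:P W = c *: W.
Proof. by rewrite (@mxad_polyE _ _ _ 1) ?size_polyC ?leq_b1 // big_ord1 coefC. Qed.

Lemma mxad_polyMX A p W : mxad_poly A (p * 'X) W = mxad_poly A p (mxad A W).
Proof.
have le1 : (size (p * 'X)%R <= (size p).+1)%N.
  by apply: leq_trans (size_polyMleq _ _) _; rewrite size_polyX addn2.
rewrite (mxad_polyE _ _ le1) big_ord_recl coefMX scale0r add0r.
by apply: eq_bigr => k _; rewrite coefMX /= -iterSr.
Qed.

Lemma mxad_poly_linear A p : linear (mxad_poly A p).
Proof.
move=> c u v; rewrite /mxad_poly scaler_sumr -big_split; apply: eq_bigr => k _ /=.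
rewrite scalerA mulrC -scalerA -scalerDr; congr (_ *: _).
by elim: (nat_of_ord k) => //= m ->; rewrite linearP.
Qed.

Lemma mxad_polyZ A c p W : mxad_poly A (c *: p) W = c *: mxad_poly A p W.
Proof.
rewrite (@mxad_polyE _ _ _ (size p)) ?size_scale_leq // scaler_sumr.
by apply: eq_bigr => k _; rewrite coefZ scalerA.
Qed.

Lemma mxad_polyMXsubC A p a W :
  mxad_poly A (p * ('X - a%:P)) W = mxad_poly A p (mxad A W - a *: W).
Proof.
have lin0 := mxad_poly_linear A p.
have -> : p * ('X - a%:P) = p * 'X + - a *: p.
  by rewrite mulrBr [p * a%:P]mulrC mul_polyC scaleNr.
rewrite mxad_polyD mxad_polyMX mxad_polyZ addrC.
by rewrite -(mxad_poly_linear A p) scaleNr addrC.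
Qed.

(* By the binomial formula, [ad A - (l - m)] is the difference of the commuting
   operators of left multiplication by [A - l] and right multiplication by
   [A - m]. *)
Lemma mxad_poly_annihilate A p l m k W :
    (forall i j, (i + j = k)%N -> (A - l%:M) ^+ i * W * (A - m%:M) ^+ j = 0) ->
  mxad_poly A (p * ('X - (l - m)%:P) ^+ k) W = 0.
Proof.
elim: k W => [|k IHk] W Wk.
  have := Wk 0%N 0%N erefl; rewrite !expr0 mul1r mulr1 => ->.
  have := mxad_poly_linear A (p * 1) (-1) 0 0.
  by rewrite scaler0 add0r scaleN1r addNr.
rewrite exprSr mulrA mxad_polyMXsubC; apply: IHk => i j ijk.
have -> : mxad A W - (l - m) *: W = (A - l%:M) * W - W * (A - m%:M).
  rewrite /mxad mulrBl mulrBr [_%:M * W]mul_scalar_mx [W * _%:M]mul_mx_scalar scalerBl.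
  by rewrite !opprB addrACA [RHS]addrACA [- _ + _]addrC.
rewrite mulrBr mulrBl.
have -> : (A - l%:M) ^+ i * ((A - l%:M) * W) = (A - l%:M) ^+ i.+1 * W.
  by rewrite exprSr !mulrA.
rewrite Wk ?addSn ?ijk // sub0r.
have -> : (A - l%:M) ^+ i * (W * (A - m%:M)) * (A - m%:M) ^+ j =
   (A - l%:M) ^+ i * W * (A - m%:M) ^+ j.+1 by rewrite exprS !mulrA.
by rewrite Wk ?oppr0 // addnS ijk.
Qed.

End Commutators.

(** * Chinese remainders for powers of linear factors *)

Section CRT.
Variables (F : fieldType).

Lemma coprimep_XsubC_exp (x y : F) m n : x != y ->
  coprimep (('X - x%:P) ^+ m) (('X - y%:P) ^+ n).
Proof.
move=> neq; apply: coprimep_expl; apply: coprimep_expr.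
by rewrite coprimep_XsubC root_XsubC eq_sym.
Qed.

Lemma dvdp_prod_XsubC_exp (s : seq F) n (q : {poly F}) : uniq s ->
  (forall x, x \in s -> ('X - x%:P) ^+ n %| q) ->
  \prod_(x <- s) ('X - x%:P) ^+ n %| q.
Proof.
elim: s => [|a s IHs] /=; first by rewrite big_nil dvd1p.
case/andP=> a_s /IHs dvds dvdq; rewrite big_cons Gauss_dvdp ?dvdq ?mem_head //=.
  by apply: dvds => x xs; rewrite dvdq // inE xs orbT.
rewrite big_seq; apply: (big_ind (coprimep _)) => [|x y cx cy|x xs].
- exact: coprimep1.
- by rewrite coprimepMr cx.
- by apply: coprimep_XsubC_exp; apply: contraNneq a_s => ->.
Qed.

Lemma poly_crt (s : seq F) (n : nat) (c : F -> F) : uniq s ->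
  exists p : {poly F}, forall x, x \in s -> ('X - x%:P) ^+ n %| p - (c x)%:P.
Proof.
elim: s => [|a s IHs] /=; first by exists 0.
case/andP=> a_s /IHs[p pP].
pose m := \prod_(x <- s) ('X - x%:P) ^+ n.
have cop : coprimep (('X - a%:P) ^+ n) m.
  rewrite /m big_seq; apply: (big_ind (coprimep _)) => [|x y cx cy|x xs].
  - exact: coprimep1.
  - by rewrite coprimepMr cx.
  - by apply: coprimep_XsubC_exp; apply: contraNneq a_s => ->.
have /Bezout_eq1_coprimepP[[u v] /= uv] := cop.
(* The factor [v * m] is 1 modulo [('X - a%:P) ^+ n] and 0 modulo the other powers, so only the
   residue at [a] changes. *)
exists (p + v * m * ((c a)%:P - p)) => x; rewrite inE => /predU1P[->|xs].
  have -> : p + v * m * ((c a)%:P - p) - (c a)%:P =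
     (u * ('X - a%:P) ^+ n) * (p - (c a)%:P).
    have -> : v * m = 1 - u * ('X - a%:P) ^+ n by rewrite -uv addrC addKr.
    by ring.
  by rewrite -mulrA mulrC -mulrA dvdp_mulr // .
have -> : p + v * m * ((c a)%:P - p) - (c x)%:P =
  (p - (c x)%:P) + m * (v * ((c a)%:P - p)) by ring.
rewrite dvdp_add ?pP // dvdp_mulr // /m (big_rem x) //= dvdp_mulr //.
Qed.

End CRT.

(** * Nilpotency from traces *)

Section TraceNilpotent.
Variables (C : numClosedFieldType) (d : nat).
Implicit Types (A T Y Z : 'M[C]_d.+1) (p g : {poly C}).

Lemma trig_mulmx T T' : is_trig_mx T -> is_trig_mx T' ->
  is_trig_mx (T * T') /\ forall i, (T * T') i i = T i i * T' i i.
Proof.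
move=> /is_trig_mxP tT /is_trig_mxP tT'; split.
  apply/is_trig_mxP => i j ij; rewrite mxE big1 // => k _.
  have [ik|ki] := ltnP i k; first by rewrite tT // mul0r.
  by rewrite tT' ?mulr0 // (leq_ltn_trans ki).
move=> i; rewrite mxE (bigD1 i) //= big1 ?addr0 // => k; rewrite neq_ltn.
by case/orP => ik; rewrite ?(tT _ _ ik) ?(tT' _ _ ik) (mul0r, mulr0).
Qed.

Lemma trig_horner_mx T p : is_trig_mx T ->
  is_trig_mx (horner_mx T p) /\ forall i, horner_mx T p i i = p.[T i i].
Proof.
move=> tT; elim/poly_ind: p => [|p c [tp dp]].
  by rewrite rmorph0 mx0_is_trig; split=> // i; rewrite mxE horner0.
rewrite rmorphD rmorphM /= horner_mx_X horner_mx_C.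
have [tpT dpT] := trig_mulmx tp tT; split=> [|i]; last first.
  by rewrite mxE dpT dp mxE eqxx hornerMXaddC.
apply/is_trig_mxP => i j ij; rewrite mxE (is_trig_mxP tpT) // add0r mxE.
by rewrite -val_eqE ltn_eqF.
Qed.

Lemma trace_mul_commutator (B Y Z : 'M[C]_d.+1) :
  \tr (B * (Y * Z - Z * Y)) = \tr (mxad B Y * Z).
Proof.
rewrite /mxad mulrBr mulrBl !linearB /= mulrA; congr (_ - _).
by rewrite mulrA [LHS]mxtrace_mulC -!mulmxE mulmxA.
Qed.

(* The conjugate of the semisimple part of [A] is a polynomial in [A], and its
   adjoint action is a polynomial without constant term in that of [A]. *)
Lemma conj_semisimple_part A : exists (g p : {poly C}) (P T : 'M[C]_d.+1),
  [/\ P \in unitmx /\ is_trig_mx T, A = invmx P * T * P,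
      forall i, g.[T i i] = (T i i)^*,
      p`_0 = 0 &
      forall Y, mxad (horner_mx A g) Y = mxad_poly A p Y].
Proof.
have [P /unitarymx_unit Pu sPT] := Schur A isT.
pose T := conjmx P A.
have tT : is_trig_mx T by [].
have eT : T = P * A * invmx P by rewrite /T conjumx.
have eA : A = invmx P * T * P.
  by rewrite eT -!mulmxE -!mulmxA mulVmx // mulmx1 mulmxA mulVmx // mul1mx.
pose L := undup [seq T i i | i : 'I_d.+1].
have LP i : T i i \in L by rewrite mem_undup; apply/mapP; exists i; rewrite ?mem_enum.
pose D := undup [seq x - y | x <- L, y <- L].
(* No eigenvalue has multiplicity above [d.+1], so [g] in [A] is the scalar [x^*] on the generalized
   eigenspace of [x]. *)
have [g gP] := poly_crt d.+1 (fun x => x^*) (undup_uniq _ : uniq L).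
(* On the block of matrices attached to the eigenvalues [x] and [y], [ad A - (x - y)] is a
   difference of two commuting nilpotent operators, whence the doubled exponent. As 0 lies in [D],
   [p] has no constant term. *)
have [p pP] := poly_crt (d.+1 + d.+1) (fun x => x^*) (undup_uniq _ : uniq D).
have evE n (q : {poly C}) x c : (0 < n)%N -> ('X - x%:P) ^+ n %| q - c%:P -> q.[x] = c.
  move=> n0 /dvdpP[r er]; apply/eqP; rewrite -subr_eq0; apply/eqP.
  rewrite -[X in _ - X](hornerC c x) -hornerN -hornerD er hornerM horner_exp.
  by rewrite !hornerE subrr expr0n eqn0Ngt n0 mulr0.
exists g, p, P, T; split => //.
- by move=> i; apply: (evE d.+1) => //; apply: gP.
- rewrite -horner_coef0; apply: (evE (d.+1 + d.+1)%N) => //.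
  have := pP 0; rewrite conjC0; apply.
  rewrite mem_undup -(subrr (T ord0 ord0)).
  by apply/allpairsP; exists (T ord0 ord0, T ord0 ord0); rewrite !LP.
have annih q : (forall x, x \in L -> ('X - x%:P) ^+ d.+1 %| q) -> horner_mx A q = 0.
  move=> Lq; have : char_poly T %| q.
    apply: dvdp_trans (dvdp_prod_XsubC_exp (undup_uniq _) Lq).
    rewrite char_poly_trig //.
    have -> : \prod_i ('X - (T i i)%:P) = \prod_(x <- [seq T i i | i : 'I_d.+1]) ('X - x%:P).
      by rewrite big_map big_enum.
    rewrite -/L -big_undup_iterop_count.
    rewrite (eq_bigr (fun x => ('X - x%:P) ^+ count_mem x [seq T i i | i : 'I_d.+1])) => [|x _].
      rewrite /L; elim: (undup _) => [|x s IHs]; first by rewrite !big_nil.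
      rewrite !big_cons dvdp_mul // dvdp_exp2l //.
      by rewrite (leq_trans (count_size _ _)) // size_map -cardE card_ord.
    by [].
  case/dvdpP => r ->; rewrite rmorphM /= eA.
  suff -> : horner_mx (invmx P * T * P) (char_poly T) = 0 by rewrite mulr0.
  by rewrite horner_mx_uconjC // Cayley_Hamilton mulmx0 mul0mx.
(* The polynomials [e x] yield the spectral projections [E x] of [A]. *)
have /choice[e eP] : forall x, exists e : {poly C},
    forall y, y \in L -> ('X - y%:P) ^+ d.+1 %| e - ((y == x)%:R)%:P.
  by move=> x; apply: poly_crt (undup_uniq _).
pose E x := horner_mx A (e x).
have hXsubC x : horner_mx A ('X - x%:P) = A - x%:M.
  by rewrite rmorphB /= horner_mx_X horner_mx_C.
have sumE : \sum_(x <- L) E x = 1.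
  rewrite -(rmorph_sum (horner_mx A)) -(rmorph1 (horner_mx A)).
  apply/eqP; rewrite -subr_eq0 -rmorphB; apply/eqP/annih => y yL.
  have -> : \sum_(x <- L) e x - 1 = \sum_(x <- L) (e x - ((y == x)%:R)%:P).
    rewrite sumrB; congr (_ - _).
    rewrite (bigD1_seq y) ?undup_uniq //= eqxx big1 ?addr0 // => x.
    by rewrite eq_sym => /negPf ->.
  rewrite big_seq; apply: (big_ind (fun q => ('X - y%:P) ^+ d.+1 %| q)) => [|? ?|x xL].
  - exact: dvdp0.
  - exact: dvdp_add.
  - exact: eP.
have expE x k : x \in L -> (d.+1 <= k)%N -> (A - x%:M) ^+ k * E x = 0.
  move=> xL /subnK <-; rewrite exprD -mulrA /E -[X in X ^+ d.+1 * _]hXsubC -rmorphXn -(rmorphM (horner_mx A)) /=.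
  rewrite annih ?mulr0 // => y yL; have [->|neq] := eqVneq y x; first exact: dvdp_mulr.
  by apply: dvdp_mull; have := eP x y yL; rewrite (negPf neq) subr0.
have gE x : x \in L -> horner_mx A g * E x = x^* *: E x.
  move=> xL; apply/eqP; rewrite -subr_eq0 -[_ *: E x]mul_scalar_mx.
  rewrite /E -(horner_mx_C A) -[_ *m _]/(_ * _) -mulrBl -rmorphB -rmorphM /=.
  apply/eqP/annih => y yL; have [->|neq] := eqVneq y x; first by rewrite dvdp_mulr ?gP.
  by apply: dvdp_mull; have := eP x y yL; rewrite (negPf neq) subr0.
have commE x q : E x * horner_mx A q = horner_mx A q * E x by apply: comm_horner_mx2.
move=> Y; have -> : Y = \sum_(x <- L) \sum_(y <- L) E x * Y * E y.
  rewrite -[LHS]mul1r -[LHS]mulr1 -{1}sumE -sumE !mulr_suml; apply: eq_bigr => x _.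
  by rewrite mulr_sumr.
have lin0 := mxad_poly_linear A p.
pose f := GRing.isLinear.Build _ _ _ _ (mxad_poly A p) lin0.
pose F : {linear _ -> _} := HB.pack (mxad_poly A p) f.
rewrite -[RHS]/(F _) !linear_sum !big_seq; apply: eq_bigr => x xL.
rewrite !linear_sum !big_seq; apply: eq_bigr => y yL; rewrite /F /=.
have /dvdpP[r er] : ('X - (x - y)%:P) ^+ (d.+1 + d.+1) %| p - ((x - y)^*)%:P.
  by apply: pP; rewrite mem_undup; apply/allpairsP; exists (x, y).
have -> : p = r * ('X - (x - y)%:P) ^+ (d.+1 + d.+1) + ((x - y)^*)%:P.
  by rewrite -er subrK.
rewrite mxad_polyD mxad_polyC mxad_poly_annihilate ?add0r => [|i j ij].
  rewrite /mxad !mulrA gE // -!mulrA commE gE // -!scalerAl -!scalerAr.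
  by rewrite -scalerBl rmorphB.
(* One of the two exponents is at least [d.+1], and the power on that side annihilates the
   projection next to it. *)
have [dj|] := leqP d.+1 j; last first.
  move=> lt; rewrite !mulrA expE ?mul0r //.
  by rewrite -(leq_add2r j) ij leq_add2l ltnW.
by rewrite -!mulrA -[A - y%:M]hXsubC -rmorphXn commE rmorphXn /= hXsubC expE ?mulr0.
Qed.

(** With [g] and [p] from [conj_semisimple_part], the trace of [g(A) A] is the sum of the squared
    moduli of the eigenvalues of [A]. Moving the commutators across the trace turns it into traces
    of [p(ad A)(Y i) * Z i], which vanish because [p] has no constant term. *)
Lemma nilpotent_of_trace A (I : finType) (Y Z : I -> 'M[C]_d.+1) :
    A = \sum_i (Y i * Z i - Z i * Y i) ->
    (forall i k, \tr (iter k.+1 (mxad A) (Y i) * Z i) = 0) ->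
  A ^+ d.+1 = 0.
Proof.
move=> eA tr0; have [g [p [P [T [[Pu tT] eT gT p0 gp]]]]] := conj_semisimple_part A.
have trgA : \tr (horner_mx A g * A) = 0.
  rewrite {2}eA mulr_sumr raddf_sum big1 //= => i _.
  rewrite trace_mul_commutator gp /mxad_poly mulr_suml raddf_sum big1 //= => k _.
  case: (nat_of_ord k) => [|m]; first by rewrite p0 scale0r mul0r mxtrace0.
  by rewrite -scalerAl mxtraceZ tr0 mulr0.
have [_ dg] := trig_horner_mx g tT; have [tg _] := trig_horner_mx g tT.
have [_ dgT] := trig_mulmx tg tT.
have T0 i : T i i = 0.
  move: trgA; rewrite {1}eT horner_mx_uconjC // {1}eT.
  rewrite -!mulmxE !mulmxA mulmxK // -!mulmxA mxtrace_mulC -!mulmxA mulmxV // mulmx1.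
  rewrite mulmxE /mxtrace (eq_bigr (fun i => `|T i i| ^+ 2)) => [|j _]; last first.
    by rewrite dgT dg gT normCKC.
  move=> /eqP; rewrite psumr_eq0 => [|j _]; last exact: exprn_ge0.
  by move=> /allP/(_ i (mem_index_enum _)); rewrite sqrf_eq0 normr_eq0 => /eqP.
have cT : char_poly T = 'X^(d.+1).
  rewrite char_poly_trig // (eq_bigr (fun=> 'X)) => [|i _]; last by rewrite T0 subr0.
  by rewrite prodr_const card_ord.
have := Cayley_Hamilton T; rewrite cT rmorphXn /= horner_mx_X => TN.
have : horner_mx A 'X^(d.+1) = invmx P *m horner_mx T 'X^(d.+1) *m P.
  by rewrite {1}eT horner_mx_uconjC.
by rewrite !rmorphXn /= !horner_mx_X TN mulmx0 mul0mx.
Qed.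

End TraceNilpotent.

(** * Engel's theorem *)

Section Engel.
Variables (F : fieldType) (d : nat).
Implicit Types (H : {vspace 'M[F]_d.+1}) (x y : 'M[F]_d.+1).

Lemma mxad_nilpotent x : x ^+ d.+1 = 0 ->
  forall y, iter (d.+1 + d.+1) (mxad x) y = 0.
Proof.
move=> x0 y; have powE k : mxad_poly x ('X^k) y = iter k (mxad x) y.
  elim: k y => [|k IHk] y; first by rewrite expr0 -[1]/(1%:P) mxad_polyC scale1r.
  by rewrite exprSr mxad_polyMX IHk -iterSr.
rewrite -powE; have <- : 1 * ('X - (0 - 0)%:P) ^+ (d.+1 + d.+1) = 'X^(d.+1 + d.+1) :> {poly F}.
  by rewrite subrr subr0 mul1r.
apply: mxad_poly_annihilate => i j ij.
have -> : x - 0%:M = x by rewrite raddf0 subr0.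
have [di|dj] := leqP d.+1 i.
  by rewrite -(subnK di) exprD x0 mulr0 !mul0r.
have {}dj : (d.+1 <= j)%N by rewrite -(leq_add2l i) ij leq_add2r ltnW.
by rewrite -(subnK dj) exprD x0 !mulr0.
Qed.

Lemma mxad_mxad x y z : mxad (mxad x y) z = mxad x (mxad y z) - mxad y (mxad x z).
Proof.
have AC (T : zmodType) (a b c e f g : T) :
    a - b - (c - e) = a - f - (g - e) - (b - g - (f - c)).
  have -> : a - f - (g - e) = (a - f) + (e - g) by rewrite opprB.
  have -> : - (b - g - (f - c)) = (f - c) + (g - b) by rewrite opprB opprB.
  rewrite addrACA [a - f + _]addrA subrK [e - g + _]addrA subrK opprB.
  by rewrite [LHS]addrACA [RHS]addrACA [- b - c]addrC.
by rewrite /mxad !(mulrBl, mulrBr) !mulrA; apply: AC.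
Qed.


(** [rho] is defined on all matrices but is a representation by nilpotent operators only on [H];
    thus the subalgebras of [H] remain subspaces of one matrix algebra. *)
Record nilpotent_rep H (V : lmodType F) (rho : 'M[F]_d.+1 -> V -> V) : Prop := NilpotentRep {
  nrep_linearl : forall v, linear (rho^~ v);
  nrep_linearr : forall x, linear (rho x);
  nrep_bracket : forall x y v, x \in H -> y \in H ->
    rho (mxad x y) v = rho x (rho y v) - rho y (rho x v);
  nrep_nilpotent : forall x, x \in H -> exists N, forall v, iter N (rho x) v = 0 }.

(** Engel's theorem for [V'] modulo its part in [W], without quotient spaces. In this relative form
    it applies to the adjoint action on [H] modulo [H0]. *)
Definition engel H H0 : Prop :=
  forall (V : vectType F) (rho : 'M[F]_d.+1 -> V -> V), nilpotent_rep H rho ->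
  forall W V' : {vspace V}, ~~ (V' <= W)%VS ->
    (forall x v, x \in H0 -> v \in W -> rho x v \in W) ->
    (forall x v, x \in H0 -> v \in V' -> rho x v \in V') ->
  exists v, [/\ v \in V', v \notin W & forall x, x \in H0 -> rho x v \in W].

Variable H : {vspace 'M[F]_d.+1}.
Hypothesis (Hclosed : forall x y, x \in H -> y \in H -> mxad x y \in H).
Hypothesis (Hnil : forall x, x \in H -> x ^+ d.+1 = 0).

(** Engel for the action of [H0] on [H] modulo [H0] gives a [y] outside [H0] that normalizes it, so
    [H0 + <[y]>] is a subalgebra. The vectors killed by [H0] modulo [W] are stable under [y], which
    acts nilpotently: the last iterate outside [W] is killed modulo [W] by both. *)
Lemma engel_extend H0 : (H0 <= H)%VS -> ~~ (H <= H0)%VS ->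
    (forall x y, x \in H0 -> y \in H0 -> mxad x y \in H0) -> engel H H0 ->
  exists H1, [/\ (H0 <= H1)%VS, (H1 <= H)%VS, (\dim H0 < \dim H1)%N,
     forall x y, x \in H1 -> y \in H1 -> mxad x y \in H1 & engel H H1].
Proof.
move=> sH0 nsH H0closed E0.
have adrep : nilpotent_rep H (@mxad F d : 'M[F]_d.+1 -> 'M[F]_d.+1 -> 'M[F]_d.+1).
  split=> [v c x y|x|x y v _ _|x xH].
  - by rewrite /mxad mulrDl mulrDr -!scalerAl -!scalerAr scalerBr opprD addrACA.
  - exact: mxad_is_linear.
  - exact: mxad_mxad.
  - by exists (d.+1 + d.+1)%N => v; apply/mxad_nilpotent/Hnil.
have [y [yH yH0 H0y]] := E0 _ _ adrep H0 H nsH H0closed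
  (fun x v xH0 vH => Hclosed (subvP sH0 _ xH0) vH).
have yH1 : y \in (H0 + <[y]>)%VS := subvP (addvSr _ _) _ (memv_line _).
have sH1 : (H0 + <[y]> <= H)%VS by rewrite subv_add sH0 -memvE.
have mxadxx x : mxad x x = 0 by rewrite /mxad subrr.
have mxadC x z : mxad x z = - mxad z x by rewrite /mxad opprB.
have mxadDZl a x z w : mxad (x + a *: z) w = mxad x w + a *: mxad z w.
  by rewrite /mxad mulrDl mulrDr -scalerAl -scalerAr scalerBr opprD addrACA.
exists (H0 + <[y]>)%VS; split => //; first exact: addvSl.
- rewrite ltn_neqAle dimvS ?addvSl // andbT; apply: contraNneq yH0 => eqd.
  suff -> : H0 = (H0 + <[y]>)%VS by [].
  by apply/eqP; rewrite eqEdim addvSl eqd leqnn.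
- move=> x z /memv_addP[x0 x0H [_ /vlineP[a ->] ->]] /memv_addP[z0 z0H [_ /vlineP[b ->] ->]].
  apply: (subvP (addvSl _ _)).
  have -> : mxad (x0 + a *: y) (z0 + b *: y) = mxad x0 z0 + b *: mxad x0 y - a *: mxad z0 y.
    by rewrite linearD linearZ /= !mxadDZl mxadxx scaler0 addr0 addrAC [mxad z0 y]mxadC scalerN opprK.
  apply: rpredB; last by apply/rpredZ/H0y.
  by apply: rpredD; [apply: H0closed|apply/rpredZ/H0y].
move=> V rho rrep W V' nsV sW sV'; have sH01 := subvP (addvSl H0 <[y]>%VS).
have [v0 [v0V v0W H0v0]] := E0 V rho rrep W V' nsV
  (fun x v xH0 => sW x v (sH01 _ xH0)) (fun x v xH0 => sV' x v (sH01 _ xH0)).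
have iterV k : iter k (rho y) v0 \in V' by elim: k => //= k IHk; apply: sV'.
have iterH k x : x \in H0 -> rho x (iter k (rho y) v0) \in W.
  elim: k x => [|k IHk] x xH0; first exact: H0v0.
  have eqr := nrep_bracket rrep (iter k (rho y) v0) (subvP sH0 _ xH0) yH.
  rewrite iterS -[X in X \in W](subrK (rho y (rho x (iter k (rho y) v0)))) -eqr.
  by rewrite rpredD ?IHk ?H0y // sW ?IHk.
have [N N0] := nrep_nilpotent rrep yH.
have exN : exists k, iter k (rho y) v0 \in W by exists N; rewrite N0 mem0v.
case: (ex_minnP exN) => [[|k]]; first by rewrite /= (negPf v0W).
move=> kW kmin; exists (iter k (rho y) v0); split => //.
  by apply/negP => /kmin; rewrite ltnn.
move=> x /memv_addP[x0 x0H [_ /vlineP[a ->] ->]].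
rewrite addrC (nrep_linearl rrep) rpredD ?iterH ?rpredZ //.
Qed.

Lemma engel_subspace : engel H H.
Proof.
have E0 : engel H 0%VS.
  move=> V rho rrep W V' /subvPn[v vV vW] _ _; exists v; split => // x.
  rewrite memv0 => /eqP ->; have := nrep_linearl rrep v (-1) 0 0.
  by rewrite scaler0 addr0 scaleN1r addNr => ->; apply: mem0v.
suff : forall m H0, (\dim H - \dim H0 <= m)%N -> (H0 <= H)%VS ->
    (forall x y, x \in H0 -> y \in H0 -> mxad x y \in H0) -> engel H H0 -> engel H H.
  apply; first exact: leqnn; first exact: sub0v; last exact: E0.
  move=> x y /[!memv0] /eqP -> _.
  by rewrite /mxad mul0r mulr0 subrr.
clear E0; elim=> [|m IHm] H0 dimH0 sH0 cH0 E0.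
  suff {2}-> : H = H0 by [].
  by apply/esym/eqP; rewrite eqEdim sH0 -subn_eq0 -leqn0.
have [sHH0|nsH] := boolP (H <= H0)%VS.
  suff {2}<- : H0 = H by [].
  by apply/eqP; rewrite eqEsubv sH0.
have [H1 [s01 sH1 lt01 cH1 E1]] := engel_extend sH0 nsH cH0 E0.
apply: (IHm H1) => //; rewrite leq_subLR.
have : (\dim H <= \dim H0 + m.+1)%N by rewrite -leq_subLR.
by move/leq_trans; apply; rewrite addnS -addSn leq_add2r.
Qed.

End Engel.

(** * Representations and derived ideals *)

Section LieRep.
Variables (K : fieldType) (s : vectType K) (br : s -> s -> s).
Hypothesis hbr : is_lie_bracket br.
Implicit Types (I J : {vspace s}).

(* The action of [x] on row vectors is [v |-> v *m rho x]; it is a left action,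
   whence the order of the factors. *)
Definition is_rep d (rho : {linear s -> 'M[K]_d}) : Prop :=
  forall x y, rho (br x y) = rho y *m rho x - rho x *m rho y.

Fact br_is_linearl y : linear (br^~ y).
Proof. by move=> c x z; apply: lie_linearl. Qed.
Fact br_is_linearr x : linear (br x).
Proof. by move=> c y z; apply: lie_linearr. Qed.

Definition brl y : {linear s -> s} :=
  HB.pack (br^~ y) (GRing.isLinear.Build _ _ _ _ (br^~ y) (br_is_linearl y)).
Definition brr x : {linear s -> s} :=
  HB.pack (br x) (GRing.isLinear.Build _ _ _ _ (br x) (br_is_linearr x)).

Lemma brZl c x y : br (c *: x) y = c *: br x y.
Proof. by rewrite -[LHS]/(brl y (c *: x)) linearZ. Qed.
Lemma brZr c x y : br x (c *: y) = c *: br x y.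
Proof. by rewrite -[LHS]/(brr x (c *: y)) linearZ. Qed.
Lemma br_suml (T : Type) (r : seq T) (P : pred T) (f : T -> s) y :
  br (\sum_(i <- r | P i) f i) y = \sum_(i <- r | P i) br (f i) y.
Proof. exact: (linear_sum (brl y)). Qed.
Lemma br_sumr (T : Type) (r : seq T) (P : pred T) (f : T -> s) x :
  br x (\sum_(i <- r | P i) f i) = \sum_(i <- r | P i) br x (f i).
Proof. exact: (linear_sum (brr x)). Qed.

Lemma brC x y : br x y = - br y x.
Proof.
apply/eqP; rewrite -addr_eq0; apply/eqP.
have := lie_alternating hbr (x + y).
rewrite -[br _ _]/(brl (x + y) (x + y)) linearD /=.
rewrite -![br _ (x + y)]/(brr _ (x + y)) !linearD /= !(lie_alternating hbr).
by rewrite add0r addr0.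
Qed.

Lemma br_jacobi x y z : br (br x y) z = br x (br y z) - br y (br x z).
Proof.
have := lie_jacobi hbr x y z => /eqP; rewrite -addrA addr_eq0 => /eqP ->.
rewrite [br z (br x y)]brC opprD opprK [br z x]brC.
by rewrite -[br y (- _)]/(brr y (- br x z)) linearN /= opprK addrAC subrr add0r.
Qed.

Lemma mem_lie_derived I x y : x \in I -> y \in I -> br x y \in lie_derived br I.
Proof.
move=> /coord_vbasis -> /coord_vbasis ->.
rewrite br_suml rpred_sum // => i _; rewrite brZl rpredZ // br_sumr rpred_sum // => j _.
by rewrite brZr rpredZ // memv_span //= allpairs_f // mem_nth // size_tuple.
Qed.

Lemma lie_derivedP I x : x \in lie_derived br I -> exists m (y z : 'I_m -> s),
  [/\ forall i, y i \in I, forall i, z i \in I & x = \sum_i br (y i) (z i)].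
Proof.
set X := [seq br y z | y <- vbasis I, z <- vbasis I] => xX.
have /choice[f fP] (i : 'I_(size X)) : exists yz : s * s,
    [/\ yz.1 \in I, yz.2 \in I & X`_i = br yz.1 yz.2].
  have /allpairsP[[y z] /= [yI zI ->]] : X`_i \in X by apply: mem_nth.
  by exists (y, z); split => //; apply: vbasis_mem.
have /coord_span -> : x \in <<in_tuple X>>%VS by [].
exists (size X), (fun i => coord (in_tuple X) i x *: (f i).1), (fun i => (f i).2).
split=> [i|i|]; [|by have [] := fP i|].
  by have [fI _ _] := fP i; apply: rpredZ.
apply: eq_bigr => i _; have [_ _ ->] := fP i.
by rewrite brZl.
Qed.

Lemma lie_derived_sub I : (forall x y, x \in I -> y \in I -> br x y \in I) ->
  (lie_derived br I <= I)%VS.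
Proof.
move=> cI; apply/subvP => x /lie_derivedP[m [y [z [yI zI ->]]]].
by apply: rpred_sum => i _; apply: cI.
Qed.

Lemma lie_derived_ideal I : is_lie_ideal br I -> is_lie_ideal br (lie_derived br I).
Proof.
move=> idI x _ /lie_derivedP[m [y [z [yI zI ->]]]].
rewrite br_sumr rpred_sum //= => i _.
have -> : br x (br (y i) (z i)) = br (br x (y i)) (z i) + br (y i) (br x (z i)).
  by rewrite br_jacobi subrK.
by rewrite rpredD // mem_lie_derived // idI.
Qed.

(* The witness is the term at which the derived series of [I] becomes stationary;
   it is not zero because [I] is not solvable. *)
Lemma perfect_ideal I : is_semisimple br -> is_lie_ideal br I -> I <> 0%VS ->
  exists J, [/\ (J <= I)%VS, is_lie_ideal br J, J <> 0%VS & lie_derived br J = J].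
Proof.
move=> ss; have [m] := ubnP (\dim I); elim: m I => // m IHm I dI idI In0.
have sI : (lie_derived br I <= I)%VS by apply: lie_derived_sub => x y _ /idI.
have [eqI|neqI] := eqVneq (lie_derived br I) I; first by exists I.
have [||J [sJ idJ Jn0 eJ]] := IHm _ _ (lie_derived_ideal idI).
- rewrite -ltnS (leq_trans _ dI) // ltnS ltn_neqAle dimvS // andbT.
  by apply: contra neqI => ed; rewrite eqEdim sI (eqP ed) leqnn.
- move=> D0; apply: In0; apply: ss => //; exists 1%N; exact: D0.
- by exists J; split => //; apply: subv_trans sI.
Qed.

End LieRep.

Section Cartan.
Variables (K : fieldType) (C : numClosedFieldType) (iota : {rmorphism K -> C}).
Variables (s : vectType K) (br : s -> s -> s).
Hypothesis hbr : is_lie_bracket br.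

(** As [J] is its own derived ideal, [rho x] is a sum of commutators, and its iterated commutators
    with elements of [rho J] stay in [rho J], where the trace form vanishes. So [nilpotent_of_trace]
    applies after extension of scalars. *)
Lemma perfect_trace_nilpotent d (rho : {linear s -> 'M[K]_d.+1}) (J : {vspace s}) :
    is_rep br rho -> lie_derived br J = J ->
    {in J &, forall x y, \tr (rho x *m rho y) = 0} ->
  {in J, forall x, rho x ^+ d.+1 = 0}.
Proof.
move=> rrho eJ trJ x xJ.
have cJ y z : y \in J -> z \in J -> br y z \in J.
  by move=> yJ zJ; rewrite -eJ (mem_lie_derived hbr).
have : x \in lie_derived br J by rewrite eJ.
case/(lie_derivedP hbr)=> m [y [z [yJ zJ ex]]].
have inj : injective (@map_mx K C iota d.+1 d.+1) by move=> A B; apply: map_mx_inj.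
apply: inj; rewrite rmorphXn map_mx0 /=.
(* [z] comes before [y] because [rho] reverses products. *)
apply: (nilpotent_of_trace (I := 'I_m)
  (Y := fun i => map_mx iota (rho (z i))) (Z := fun i => map_mx iota (rho (y i)))).
  rewrite ex !linear_sum raddf_sum; apply: eq_bigr => i _.
  by rewrite rrho raddfB /= !map_mxM.
move=> i k; have [w wJ ew] : exists2 w, w \in J &
    iter k.+1 (mxad (map_mx iota (rho x))) (map_mx iota (rho (z i))) = map_mx iota (rho w).
  elim: (k.+1) => [|l [w wJ ew]]; first by exists (z i).
  exists (br w x); first exact: cJ.
  by rewrite iterS ew rrho raddfB /= !map_mxM.
by rewrite ew -mulmxE -map_mxM trace_map_mx trJ ?rmorph0.
Qed.

(** If the vectors killed by [rho J] did not fill the space, Engel's theorem would give a further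
    vector [v] sent among them by [rho J]. The brackets of elements of [J] would then kill [v], and
    they span [J]. *)
Lemma perfect_trace_trivial d (rho : {linear s -> 'M[K]_d}) (J : {vspace s}) :
    is_rep br rho -> lie_derived br J = J ->
    {in J &, forall x y, \tr (rho x *m rho y) = 0} ->
  {in J, forall x, rho x = 0}.
Proof.
case: d rho => [rho _ _ _ x _|d rho]; first by apply/matrixP => -[].
move=> rrho eJ trJ; have nJ := perfect_trace_nilpotent rrho eJ trJ.
pose H := (linfun rho @: J)%VS.
have HP x : x \in J -> rho x \in H.
  by move=> xJ; apply/memv_imgP; exists x; rewrite ?lfunE.
have Hcl x y : x \in H -> y \in H -> mxad x y \in H.
  case/memv_imgP=> {}x xJ -> /memv_imgP[{}y yJ ->]; rewrite !lfunE /=.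
  by have := rrho y x; rewrite /mxad !mulmxE => <-; rewrite HP // -eJ (mem_lie_derived hbr).
have Hnil x : x \in H -> x ^+ d.+1 = 0.
  by case/memv_imgP=> {}x xJ ->; rewrite lfunE nJ.
pose act (x : 'M[K]_d.+1) (v : 'cV[K]_d.+1) := x *m v.
have ract : nilpotent_rep H act.
  split=> [v c x y|x c v w|x y v _ _|x xH].
  - by rewrite /act mulmxDl scalemxAl.
  - by rewrite /act mulmxDr scalemxAr.
  - by rewrite /act /mxad mulmxBl -!mulmxE !mulmxA.
  exists d.+1 => v; have -> : forall k, iter k (act x) v = x ^+ k *m v.
    elim=> [|k IHk]; first by rewrite expr0 mul1mx.
    by rewrite iterS IHk exprS /act mulmxA.
  by rewrite Hnil // mul0mx.
pose W := (\bigcap_(i < \dim J) lker (linfun (mulmx (rho (vbasis J)`_i) : 'cV[K]_d.+1 -> 'cV[K]_d.+1)))%VS.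
have WP v : reflect (forall x, x \in J -> rho x *m v = 0) (v \in W).
  rewrite memvE; apply: (iffP subv_bigcapP) => [vW x /coord_vbasis ->|vJ i _].
    rewrite linear_sum mulmx_suml big1 // => i _; rewrite linearZ -scalemxAl.
    by have := vW i isT; rewrite -memvE memv_ker lfunE => /eqP /= ->; rewrite scaler0.
  rewrite -memvE memv_ker lfunE /= vJ // vbasis_mem // mem_nth // size_tuple.
  exact: ltn_ord.
have [Wfull|nW] := boolP (fullv <= W)%VS.
  move=> x xJ; apply/trmx_inj/row_matrixP => i; apply: trmx_inj.
  rewrite rowE trmx_mul trmxK trmx0 linear0 trmx0.
  by move/subvP: Wfull => /(_ (delta_mx 0 i)^T (memvf _))/WP ->.
have [||v [_ vW Jv]] := engel_subspace Hcl Hnil ract nW.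
- move=> _ v /memv_imgP[x xJ ->] /WP vW; rewrite lfunE /act.
  by rewrite vW ?mem0v.
- by move=> *; apply: memvf.
case/negP: vW; apply/WP => x; rewrite -eJ => /(lie_derivedP hbr)[m [y [z [yJ zJ ->]]]].
rewrite linear_sum mulmx_suml big1 // => i _; rewrite rrho mulmxBl -!mulmxA.
have /WP yv := Jv _ (HP _ (yJ i)); have /WP zv := Jv _ (HP _ (zJ i)).
by rewrite -[rho (y i) *m v]/(act _ _) -[rho (z i) *m v]/(act _ _) yv ?zv ?subr0.
Qed.

(** The conclusion is an ideal in the kernel of [rho] so as to serve twice: for the adjoint
    representation that ideal is abelian, and inside a complement of the kernel it must be 0. *)
Lemma cartan_criterion d (rho : {linear s -> 'M[K]_d}) (I : {vspace s}) :
    is_semisimple br -> is_rep br rho -> is_lie_ideal br I ->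
    {in I &, forall x y, \tr (rho x *m rho y) = 0} -> I <> 0%VS ->
  exists J, [/\ (J <= I)%VS, is_lie_ideal br J, J <> 0%VS & {in J, forall x, rho x = 0}].
Proof.
move=> ss rrho idI trI In0; have [J [sJ idJ Jn0 eJ]] := perfect_ideal hbr ss idI In0.
exists J; split => //; apply: perfect_trace_trivial => // x y xJ yJ.
by apply: trI; apply: (subvP sJ).
Qed.

End Cartan.

(** * Whitehead's lemmas *)

Section Semisimple.
Variables (K : numFieldType) (C : numClosedFieldType) (iota : {rmorphism K -> C}).
Variables (s : vectType K) (br : s -> s -> s).
Hypotheses (hbr : is_lie_bracket br) (hss : is_semisimple br).
Implicit Types (I J : {vspace s}).

Let e := vbasis {: s}.

Definition ad_mx x : 'M[K]_(\dim {:s}) := \matrix_(i, j) coord e j (br x e`_i).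

Fact ad_mx_is_linear : linear ad_mx.
Proof.
by move=> c x y; apply/matrixP => i j; rewrite !mxE (lie_linearl hbr) linearP.
Qed.
HB.instance Definition _ := GRing.isLinear.Build K s _ _ ad_mx ad_mx_is_linear.

Lemma coord_br x y j :
  coord e j (br x y) = \sum_i coord e i y * ad_mx x i j.
Proof.
rewrite {1}(coord_vbasis (memvf y)) (br_sumr hbr) linear_sum; apply: eq_bigr => i _.
by rewrite (brZr hbr) linearZ mxE.
Qed.

Lemma ad_rep : is_rep br ad_mx.
Proof.
move=> x y; apply/matrixP => i j; rewrite !mxE (br_jacobi hbr) linearB /= !coord_br.
by congr (_ - _); apply: eq_bigr => k _; rewrite !mxE.
Qed.

Lemma ad_mx_eq0 x : ad_mx x = 0 -> forall y, br x y = 0.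
Proof.
move=> x0 y; rewrite (coord_vbasis (memvf (br x y))) big1 // => j _.
by rewrite coord_br x0 big1 ?scale0r // => i _; rewrite mxE mulr0.
Qed.

Lemma abelian_ideal_eq0 I : is_lie_ideal br I -> {in I &, forall x y, br x y = 0} ->
  I = 0%VS.
Proof.
move=> idI abI; apply: hss => //; exists 1%N => /=; apply/eqP; rewrite -subv0.
apply/subvP => x /(lie_derivedP hbr)[m [y [z [yI zI ->]]]].
by rewrite big1 ?mem0v // => i _; apply: abI.
Qed.

Lemma ideal_cap I J : is_lie_ideal br I -> is_lie_ideal br J -> is_lie_ideal br (I :&: J)%VS.
Proof. by move=> idI idJ x y; rewrite !memv_cap => /andP[/idI-> /idJ->]. Qed.

(** * Invariant trace forms *)

Section TraceForm.
Variables (d : nat) (rho : {linear s -> 'M[K]_d}).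
Hypothesis rrho : is_rep br rho.

Definition trform x y := \tr (rho x *m rho y).

Lemma trformC x y : trform x y = trform y x.
Proof. exact: mxtrace_mulC. Qed.

Lemma trformZr c x y : trform x (c *: y) = c * trform x y.
Proof. by rewrite /trform linearZ -scalemxAr linearZ. Qed.
Lemma trformDr x y z : trform x (y + z) = trform x y + trform x z.
Proof. by rewrite /trform linearD mulmxDr linearD. Qed.
Lemma trformBr x y z : trform x (y - z) = trform x y - trform x z.
Proof. by rewrite /trform linearB mulmxBr linearB. Qed.
Lemma trform_sumr (I : finType) (f : I -> s) x : trform x (\sum_i f i) = \sum_i trform x (f i).
Proof. by rewrite /trform linear_sum mulmx_sumr linear_sum. Qed.
Lemma trformZl c x y : trform (c *: x) y = c * trform x y.
Proof. by rewrite !(trformC _ y) trformZr. Qed.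
Lemma trformBl x y z : trform (x - y) z = trform x z - trform y z.
Proof. by rewrite !(trformC _ z) trformBr. Qed.
Lemma trform_suml (I : finType) (f : I -> s) x : trform (\sum_i f i) x = \sum_i trform (f i) x.
Proof. by rewrite trformC trform_sumr; apply: eq_bigr => i _; apply: trformC. Qed.

Lemma trform_br x y z : trform (br z x) y = - trform x (br z y).
Proof.
apply/eqP; rewrite -addr_eq0; apply/eqP.
rewrite /trform !rrho mulmxBl mulmxBr !mulmxA !linearB /=.
rewrite addrC addrA subrK -[rho z *m rho x *m rho y]mulmxA.
by rewrite [\tr (rho z *m _)]mxtrace_mulC subrr.
Qed.

Definition trform_row I x := \row_(i < \dim I) trform (vbasis I)`_i x.

Fact trform_row_linear I : linear (trform_row I).
Proof. by move=> c y z; apply/rowP => i; rewrite !mxE trformDr trformZr. Qed.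
HB.instance Definition _ I := GRing.isLinear.Build K s _ _ (trform_row I) (trform_row_linear I).

Definition trperp I : {vspace s} := lker (linfun (trform_row I)).

Lemma trperpP I x : reflect (forall y, y \in I -> trform y x = 0) (x \in trperp I).
Proof.
rewrite memv_ker lfunE /=; apply: (iffP eqP).
  move=> fx y yI; rewrite (coord_vbasis yI) trform_suml big1 // => i _.
  by have /rowP/(_ i) := fx; rewrite !mxE trformZl => ->; rewrite mulr0.
move=> Ix; apply/rowP => i; rewrite !mxE Ix // vbasis_mem // mem_nth //.
by rewrite size_tuple.
Qed.

Lemma trperp_ideal I : is_lie_ideal br I -> is_lie_ideal br (trperp I).
Proof.
move=> idI x y /trperpP yI; apply/trperpP => z zI.
by apply/eqP; rewrite -oppr_eq0 -trform_br yI // idI.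
Qed.

Lemma dim_trperp I : (\dim {:s} <= \dim I + \dim (trperp I))%N.
Proof.
rewrite -(limg_ker_dim (linfun (trform_row I)) fullv).
rewrite capfv addnC leq_add2r (leq_trans (dimvS (subvf _))) //.
by rewrite dimvf /dim /= mul1n.
Qed.

Lemma cap_trperp I : is_lie_ideal br I -> (I :&: trperp I)%VS <> 0%VS ->
  exists J, [/\ (J <= I)%VS, J <> 0%VS, is_lie_ideal br J & {in J, forall x, rho x = 0}].
Proof.
move=> idI In0.
have [|x y|J [sJ idJ Jn0 Jrho]] := cartan_criterion iota hbr hss rrho _ _ In0.
- exact/ideal_cap/trperp_ideal.
- by rewrite !memv_cap => /andP[xI _] /andP[_ /trperpP]; apply.
by exists J; split => //; apply: subv_trans sJ (capvSl _ _).
Qed.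

End TraceForm.

(** The complement is the orthogonal for the Killing form. If it met [I], Cartan's criterion would
    give a nonzero ideal with zero adjoint action, that is, an abelian one. *)
Lemma ideal_complement I : is_lie_ideal br I ->
  exists I', [/\ is_lie_ideal br I', (I :&: I')%VS = 0%VS & (I + I')%VS = fullv].
Proof.
move=> idI; have cap0 : (I :&: trperp ad_mx I)%VS = 0%VS.
  apply: contrapT => /(cap_trperp ad_rep idI)[J [_ Jn0 idJ J0]]; apply: Jn0.
  by apply: abelian_ideal_eq0 => // x y xJ _; apply/ad_mx_eq0/J0.
exists (trperp ad_mx I); split => //; first exact: (trperp_ideal ad_rep).
by apply/eqP; rewrite eqEdim subvf /= dimv_disjoint_sum // dim_trperp.
Qed.

(** A complement of the derived ideal is abelian, since its brackets lie in both summands. *)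
Lemma semisimple_perfect : lie_derived br fullv = fullv.
Proof.
have idD : is_lie_ideal br (lie_derived br fullv).
  by apply: (lie_derived_ideal hbr) => x y _; apply: memvf.
have [I' [idI' cap0 addI']] := ideal_complement idD; rewrite -[RHS]addI'.
suff -> : I' = 0%VS by rewrite addv0.
apply: abelian_ideal_eq0 => // x y xI yI; apply/eqP; rewrite -memv0 -cap0 memv_cap.
by rewrite idI' // (mem_lie_derived hbr) ?memvf.
Qed.

(* The invariant element of [s (x) s] dual to the trace form on a complement of
   the kernel of [rho]. *)
Lemma casimir_tensor d (rho : {linear s -> 'M[K]_d}) : is_rep br rho ->
  exists m (u v : 'I_m -> s),
  [/\ \sum_i \tr (rho (u i) *m rho (v i)) = m%:R,
      m = 0%N -> forall x, rho x = 0 &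
      forall (V : lmodType K) (B : s -> s -> V),
        (forall y, linear (B^~ y)) -> (forall x, linear (B x)) ->
        forall x, \sum_i (B (br x (u i)) (v i) + B (u i) (br x (v i))) = 0].
Proof.
move=> rrho; pose I := lker (linfun rho).
have IP x : reflect (rho x = 0) (x \in I) by rewrite memv_ker lfunE; apply: eqP.
have idI : is_lie_ideal br I.
  by move=> x y /IP y0; apply/IP; rewrite rrho y0 mul0mx mulmx0 subrr.
have [J [idJ capIJ addIJ]] := ideal_complement idI.
(* The trace form is nondegenerate on [J]: otherwise Cartan's criterion gives a nonzero ideal in [J]
   and in the kernel [I]. *)
have nd : (J :&: trperp rho J)%VS = 0%VS.
  apply: contrapT => /(cap_trperp rrho idJ)[J' [sJ' J'n0 idJ' J'0]]; apply: J'n0.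
  apply/eqP; rewrite -subv0 -capIJ subv_cap sJ' andbT.
  by apply/subvP => x /J'0/IP.
pose beta := trform rho.
pose u (i : 'I_(\dim J)) := (vbasis J)`_i.
have uJ i : u i \in J by rewrite vbasis_mem // mem_nth // size_tuple.
have nd' w : w \in J -> (forall i, beta w (u i) = 0) -> w = 0.
  move=> wJ w0; apply/eqP; rewrite -memv0 -nd memv_cap wJ; apply/trperpP => y yJ.
  rewrite trformC (coord_vbasis yJ) trform_sumr big1 // => i _.
  by rewrite trformZr -/beta w0 mulr0.
pose G := \matrix_(i, j) beta (u i) (u j).
have Gu : G \in unitmx.
  rewrite -row_free_unit -kermx_eq0; apply/rowV0P => r /sub_kermxP rG.
  have /nd' r0 : \sum_i r 0 i *: u i \in J by apply: rpred_sum => i _; apply: rpredZ.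
  have {}r0 : \sum_i r 0 i *: u i = 0.
    apply: r0 => j; have /rowP/(_ j) := rG; rewrite !mxE => <-.
    by rewrite /beta trform_suml; apply: eq_bigr => i _; rewrite trformZl mxE.
  apply/rowP => i; rewrite mxE.
  by have /freeP/(_ (r 0) r0) := basis_free (vbasisP J).
(* The basis of [J] dual to [u] for the trace form. *)
pose v i := \sum_j invmx G i j *: u j.
have vJ i : v i \in J by apply: rpred_sum => j _; apply: rpredZ.
have vu i j : beta (v i) (u j) = (i == j)%:R.
  have /matrixP/(_ i j) := mulVmx Gu; rewrite !mxE => <-.
  by rewrite /beta trform_suml; apply: eq_bigr => k _; rewrite trformZl mxE.
have expv w : w \in J -> w = \sum_i beta w (u i) *: v i.
  move=> wJ; apply/eqP; rewrite -subr_eq0; apply/eqP/nd' => [|j].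
    by rewrite rpredB // rpred_sum // => i _; rewrite rpredZ.
  rewrite /beta trformBl trform_suml (bigD1 j) //= trformZl -/beta vu eqxx mulr1 big1 ?addr0 ?subrr //.
  by move=> i /negPf ij; rewrite /beta trformZl -/beta vu ij mulr0.
have expu w : w \in J -> w = \sum_i beta w (v i) *: u i.
  move=> wJ; apply/eqP; rewrite -subr_eq0; apply/eqP/nd' => [|j].
    by rewrite rpredB // rpred_sum // => i _; rewrite rpredZ.
  rewrite /beta trformBl trform_suml.
  have {1}-> : u j = \sum_i beta (u j) (u i) *: v i by apply: expv.
  rewrite trform_sumr -sumrB big1 // => i _.
  by rewrite trformZr trformZl /beta mulrC [trform _ (u j) _]trformC subrr.
exists (\dim J), u, v; split.
- rewrite (eq_bigr (fun=> 1)) ?sumr_const ?card_ord // => i _.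
  by rewrite -/(trform rho _ _) trformC -/beta vu eqxx.
- move=> J0 x; apply/IP; move: addIJ.
  by have /eqP := J0; rewrite dimv_eq0 => /eqP ->; rewrite addv0 => ->; apply: memvf.
- move=> V B Bl Br x.
  have Bls y (f : 'I_(\dim J) -> K) : B (\sum_i f i *: u i) y = \sum_i f i *: B (u i) y.
    pose F : {linear s -> V} := HB.pack (B^~ y) (GRing.isLinear.Build _ _ _ _ _ (Bl y)).
    by rewrite -[LHS]/(F _) linear_sum; apply: eq_bigr => i _; rewrite linearZ.
  have Brs y (f : 'I_(\dim J) -> K) : B y (\sum_i f i *: v i) = \sum_i f i *: B y (v i).
    pose F : {linear s -> V} := HB.pack (B y) (GRing.isLinear.Build _ _ _ _ _ (Br y)).
    by rewrite -[LHS]/(F _) linear_sum; apply: eq_bigr => i _; rewrite linearZ.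
  (* By invariance of the form, the matrices of [br x] in the two dual bases are opposite
     transposes, so the two double sums cancel. *)
  rewrite big_split /= (eq_bigr (fun i => \sum_k beta (br x (u i)) (v k) *: B (u k) (v i))).
    rewrite [X in _ + X](eq_bigr (fun i => \sum_k beta (br x (v i)) (u k) *: B (u i) (v k))).
      rewrite exchange_big -big_split big1 //= => k _; rewrite -big_split big1 //= => i _.
      by rewrite -scalerDl /beta [trform _ (br x (u i)) _]trform_br // [trform _ (u i) _]trformC addNr scale0r.
    by move=> i _; rewrite {1}(expv (br x (v i))) ?Brs // idJ.
  by move=> i _; rewrite {1}(expu (br x (u i))) ?Bls // idJ.
Qed.

End Semisimple.

Lemma trace_nilpotent (C : numClosedFieldType) d (A : 'M[C]_d.+1) k :
  A ^+ k.+1 = 0 -> \tr A = 0.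
Proof.
move=> Ak; have [P /unitarymx_unit Pu sPT] := Schur A isT.
pose T := conjmx P A; have tT : is_trig_mx T by [].
have eT : T = P *m A *m invmx P by rewrite /T conjumx.
have -> : \tr A = \tr T by rewrite eT mxtrace_mulC mulmxA mulVmx // mul1mx.
have TN : horner_mx T 'X^(k.+1) = 0.
  by rewrite eT horner_mx_uconj // rmorphXn /= horner_mx_X Ak mulmx0 mul0mx.
have [_ dT] := trig_horner_mx 'X^(k.+1) tT.
apply: big1 => i _; have := dT i; rewrite TN mxE hornerXn => /esym/eqP.
by rewrite expf_eq0 => /eqP.
Qed.

(** [E] is the projection to the part on which [A] is nilpotent. A Bezout relation between a power
    of ['X] and the factor of the characteristic polynomial prime to ['X] makes it a polynomial in
    [A], so it commutes with whatever commutes with [A]. *)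
Lemma fitting (K : fieldType) d (A : 'M[K]_d.+1) :
  exists (p : {poly K}) (E : 'M[K]_d.+1),
    E = 1 - A * horner_mx A p /\ E * A ^+ d.+1 = 0.
Proof.
have [m [q q0 eq]] := multiplicity_XsubC (char_poly A) 0.
rewrite subr0 in eq; have cA0 := monic_neq0 (char_poly_monic A).
rewrite cA0 /= in q0.
have lem : (m <= d.+1)%N.
  rewrite -ltnS -(size_char_poly A) eq size_Mmonic ?monicXn //; last first.
    by apply: contraNneq q0 => ->; rewrite root0.
  rewrite size_polyXn addnS /= -[X in (X < _)%N]add0n ltn_add2r lt0n size_poly_eq0.
  by apply: contraNneq q0 => ->; rewrite root0.
have : coprimep ('X ^+ d.+1) q.
  by apply: coprimep_expl; rewrite coprimep_sym -['X]subr0 -polyC0 coprimep_XsubC.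
case/Bezout_eq1_coprimepP=> -[a b] /= ab.
exists ('X^d * a), (horner_mx A (b * q)); split.
  have -> : A * horner_mx A ('X^d * a) = horner_mx A ('X^(d.+1) * a).
    by rewrite exprS -mulrA [RHS]rmorphM /= horner_mx_X.
  rewrite -(rmorph1 (horner_mx A)) -rmorphB /=.
  by rewrite -ab [a * _]mulrC addrAC subrr add0r.
have -> : A ^+ d.+1 = horner_mx A 'X^(d.+1) by rewrite rmorphXn /= horner_mx_X.
have -> : 'X^(d.+1) = 'X^(d.+1 - m) * 'X^m :> {poly K} by rewrite -exprD subnK.
rewrite -rmorphM /=; have -> : b * q * ('X^(d.+1 - m) * 'X^m) = b * 'X^(d.+1 - m) * char_poly A.
  by rewrite [in RHS]eq; ring.
by rewrite [LHS]rmorphM /= Cayley_Hamilton mulr0.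
Qed.

Section Whitehead.
Variables (K : numFieldType) (C : numClosedFieldType) (iota : {rmorphism K -> C}).
Variables (s : vectType K) (br : s -> s -> s).
Hypotheses (hbr : is_lie_bracket br) (hss : is_semisimple br).

(* Induction on the dimension: the part of a nontrivial representation on which
   the Casimir element [Om] acts nilpotently is a smaller representation. *)
Lemma rep_induction (P : forall d, {linear s -> 'M[K]_d} -> Prop) :
    (forall d (rho : {linear s -> 'M[K]_d}), (forall x, rho x = 0) -> P d rho) ->
    (forall d r (rho : {linear s -> 'M[K]_d}) (rho' : {linear s -> 'M[K]_r})
        m (u v : 'I_m -> s) (G E : 'M[K]_d) (B : 'M[K]_(r, d)),
      is_rep br rho -> is_rep br rho' -> P r rho' ->
      (forall (V : lmodType K) (b : s -> s -> V),
        (forall y, linear (b^~ y)) -> (forall x, linear (b x)) ->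
        forall x, \sum_i (b (br x (u i)) (v i) + b (u i) (br x (v i))) = 0) ->
      1%:M = (\sum_i rho (u i) *m rho (v i)) *m G + E ->
      (forall x, rho x *m G = G *m rho x) -> (forall x, rho x *m E = E *m rho x) ->
      row_free B -> (forall x, B *m rho x = rho' x *m B) -> (E <= B)%MS ->
      P d rho) ->
  forall d (rho : {linear s -> 'M[K]_d}), is_rep br rho -> P d rho.
Proof.
move=> Ptriv Pstep d; have [N] := ubnP d; elim: N d => // N IHN [|d] dN rho rrho.
  by apply: Ptriv => x; apply/matrixP => -[].
have [m [u [v [trOm m0 inv]]]] := casimir_tensor iota hbr hss rrho.
have [/m0/Ptriv //|mn0] := eqVneq m 0%N.
pose Om := \sum_i rho (u i) *m rho (v i).
have OmC x : rho x *m Om = Om *m rho x.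
  have bl y : linear (fun z => rho z *m rho y).
    by move=> c z z'; rewrite linearP mulmxDl scalemxAl.
  have br_ y : linear (fun z => rho y *m rho z).
    by move=> c z z'; rewrite linearP mulmxDr scalemxAr.
  apply/eqP; rewrite eq_sym -subr_eq0 -(inv _ (fun y z => rho y *m rho z) bl br_ x).
  rewrite /Om mulmx_sumr mulmx_suml -sumrB; apply/eqP/eq_bigr => i _.
  by rewrite !rrho mulmxBl mulmxBr !mulmxA [RHS]addrC addrA subrK.
have [p [E [eE EOm]]] := fitting Om.
have comm_horner x (q : {poly K}) : rho x *m horner_mx Om q = horner_mx Om q *m rho x.
  exact: (comm_mx_horner _ (OmC x)).
have EC x : rho x *m E = E *m rho x.
  by rewrite eE mulmxBr mulmxBl mulmx1 mul1mx -mulmxE mulmxA OmC -!mulmxA comm_horner.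
pose ker := kermx (Om ^+ d.+1); pose B := row_base ker.
have EB : (E <= B)%MS by rewrite eq_row_base; apply/sub_kermxP.
have Bfree : row_free B := row_base_free _.
have powC x : rho x *m Om ^+ d.+1 = Om ^+ d.+1 *m rho x.
  by have := comm_horner x 'X^(d.+1); rewrite rmorphXn /= horner_mx_X.
have Bst x : (B *m rho x <= B)%MS.
  rewrite eq_row_base (eqmxMr _ (eq_row_base _)); apply/sub_kermxP.
  by rewrite -mulmxA powC mulmxA mulmx_ker mul0mx.
have [rho' rhoB] : exists rho' : {linear s -> 'M[K]_(\rank ker)},
    forall x, B *m rho x = rho' x *m B.
  by exists (mulmxr (pinvmx B) \o mulmx B \o rho) => x /=; rewrite mulmxKpV.
clearbody B; have rrho' : is_rep br rho'.
  move=> x y; apply: (row_free_inj Bfree) => /=.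
  rewrite mulmxBl -!mulmxA. rewrite -!rhoB !mulmxA -!rhoB -!mulmxA.
  by rewrite rrho mulmxBr.
apply: (Pstep _ _ rho rho' m u v (horner_mx Om p) E B) => //.
  (* If [Om ^+ d.+1] were 0, the trace of [Om] would be 0; but this trace is [m], which is nonzero
     in characteristic 0. *)
  apply: IHN rrho'; apply: (@leq_trans d.+1); last by rewrite -ltnS.
  rewrite mxrank_ker ltn_subLR ?rank_leq_col // -[X in (X < _)%N]add0n ltn_add2r.
  rewrite lt0n mxrank_eq0; apply: contra mn0 => /eqP Om0.
  have OmC0 : map_mx iota Om ^+ d.+1 = 0 by rewrite -rmorphXn Om0 rmorph0.
  have := trace_nilpotent OmC0; rewrite trace_map_mx linear_sum trOm rmorph_nat.
  by move/eqP; rewrite pnatr_eq0.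
by rewrite eE addrC subrK.
Qed.

(** Contracting the cocycle with the Casimir element gives [w0] whose coboundary is [phi x *m Om].
    [G] inverts [Om] off its nilpotent part, and [phi x *m E] is a cocycle in the smaller
    representation. If the representation is trivial, [phi] kills the brackets, which span [s]. *)
Theorem whitehead1 d (rho : {linear s -> 'M[K]_d}) : is_rep br rho ->
  forall phi : s -> 'rV[K]_d, linear phi ->
    (forall x y, phi (br x y) = phi y *m rho x - phi x *m rho y) ->
  exists w, forall x, phi x = w *m rho x.
Proof.
move: d rho; apply: (rep_induction (P := fun d rho => forall phi : s -> 'rV[K]_d, linear phi ->
    (forall x y, phi (br x y) = phi y *m rho x - phi x *m rho y) ->
  exists w, forall x, phi x = w *m rho x)) => [d rho rho0 phi lphi phic|].
  exists 0 => x; rewrite mul0mx.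
  have /(lie_derivedP hbr)[m [y [z [_ _ ->]]]] : x \in lie_derived br fullv.
    by rewrite (semisimple_perfect iota hbr hss) memvf.
  pose F : {linear s -> 'rV[K]_d} := HB.pack phi (GRing.isLinear.Build _ _ _ _ _ lphi).
  rewrite -[LHS]/(F _) linear_sum big1 // => i _.
  by rewrite /= phic !rho0 !mulmx0 subrr.
move=> d r rho rho' m u v G E B rrho rrho' IH inv dec GC EC Bfree rhoB EB phi lphi phic.
pose w0 := \sum_i phi (u i) *m rho (v i).
have w0P x : w0 *m rho x = phi x *m \sum_i rho (u i) *m rho (v i).
  have bl y : linear (fun z => phi z *m rho y).
    by move=> c z z'; rewrite lphi mulmxDl scalemxAl.
  have br_ y : linear (fun z => phi y *m rho z).
    by move=> c z z'; rewrite linearP mulmxDr scalemxAr.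
  apply/eqP; rewrite -subr_eq0 -(inv _ (fun y z => phi y *m rho z) bl br_ x).
  rewrite /w0 mulmx_sumr mulmx_suml -sumrB; apply/eqP/eq_bigr => i _.
  rewrite phic rrho mulmxBl mulmxBr !mulmxA.
  by rewrite [RHS]addrC addrA subrK.
(* [E *m D] expresses the rows of [E] in the basis [B], which carries the cocycle over to [rho']. *)
have [D ED] : exists D, E *m D *m B = E by exists (pinvmx B); rewrite mulmxKpV.
have phiE x : phi x *m E *m D *m B = phi x *m E by rewrite -2!mulmxA [E *m _]mulmxA ED.
have [|x y|w' w'P] := IH (fun x => phi x *m E *m D).
- by move=> c x y; rewrite lphi !mulmxDl -!scalemxAl.
- apply: (row_free_inj Bfree) => /=; rewrite mulmxBl -!mulmxA -!rhoB !mulmxA !phiE.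
  by rewrite -!mulmxA -!EC !mulmxA -mulmxBl phic.
exists (w0 *m G + w' *m B) => x.
rewrite -[LHS]mulmx1 dec mulmxDr mulmxDl mulmxA -w0P -!mulmxA GC; congr (_ + _).
by rewrite rhoB mulmxA -w'P phiE.
Qed.

(** Contraction with the Casimir element works as in [whitehead1]. Trivial coefficients need another
    argument: each coordinate of [om] is a 1-cocycle with values in the coadjoint representation, so
    [whitehead1] makes it a coboundary. *)
Theorem whitehead2 d (rho : {linear s -> 'M[K]_d}) : is_rep br rho ->
  forall om : s -> s -> 'rV[K]_d,
    (forall y, linear (om^~ y)) -> (forall x, linear (om x)) ->
    (forall x y, om x y = - om y x) ->
    (forall x y z, om y z *m rho x - om x z *m rho y + om x y *m rho z
       - om (br x y) z + om (br x z) y - om (br y z) x = 0) ->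
  exists2 psi : s -> 'rV[K]_d, linear psi &
    forall x y, om x y = psi y *m rho x - psi x *m rho y - psi (br x y).
Proof.
move: d rho; apply: (rep_induction (P := fun d rho => forall om : s -> s -> 'rV[K]_d,
    (forall y, linear (om^~ y)) -> (forall x, linear (om x)) ->
    (forall x y, om x y = - om y x) ->
    (forall x y z, om y z *m rho x - om x z *m rho y + om x y *m rho z
       - om (br x y) z + om (br x z) y - om (br y z) x = 0) ->
  exists2 psi : s -> 'rV[K]_d, linear psi &
    forall x y, om x y = psi y *m rho x - psi x *m rho y - psi (br x y))).
  move=> d rho rho0 om oml omr omA omc.
  pose e := vbasis {:s}; pose N := \dim {:s}.
  pose coad x : 'M[K]_N := - (ad_mx br x)^T.
  have coadl : linear coad.
    by move=> c x y; rewrite /coad (ad_mx_is_linear hbr) linearD linearZ /= opprD scalerN.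
  pose co : {linear s -> 'M[K]_N} := HB.pack coad (GRing.isLinear.Build _ _ _ _ _ coadl).
  have rco : is_rep br co.
    move=> x y; rewrite /= /coad (ad_rep hbr) linearB /= !trmx_mul.
    by rewrite !(mulmxN, mulNmx) !opprK opprB.
  have /choice[w wP] (l : 'I_d) : exists w : 'rV[K]_N,
      forall x, \row_j om x e`_j 0 l = w *m co x.
    apply: (whitehead1 rco) => [c x y|x y]; apply/rowP => j.
      by rewrite !mxE oml !mxE.
    have ome z t : om z t 0 l = \sum_k coord e k t * om z e`_k 0 l.
      pose F : {linear s -> 'rV[K]_d} := HB.pack (om z) (GRing.isLinear.Build _ _ _ _ _ (omr z)).
      rewrite {1}(coord_vbasis (memvf t)) -[om z _]/(F _) linear_sum summxE.
      by apply: eq_bigr => k _; rewrite linearZ mxE.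
    have eqs z t : (\row_j om z e`_j 0 l *m co t) 0 j = - om z (br t e`_j) 0 l.
      rewrite ome mxE -sumrN; apply: eq_bigr => k _.
      by rewrite !mxE mulrN mulrC.
    have eqo : om (br x y) e`_j = om (br x e`_j) y - om (br y e`_j) x.
      have := omc x y e`_j; rewrite !rho0 !mulmx0 subrr addr0 add0r -addrA addrC => /eqP.
      by rewrite subr_eq0 => /eqP.
    rewrite mxE [RHS]mxE eqs [(- (_ *m _)) 0 j]mxE eqs opprK eqo.
    by rewrite (omA _ y) (omA _ x) opprK !mxE addrC.
  exists (fun x => \row_l \sum_k w l 0 k * coord e k x).
    move=> c x y; apply/rowP => l; rewrite !mxE mulr_sumr -big_split.
    by apply: eq_bigr => k _; rewrite linearP /= mulrDr mulrCA.
  move=> x y; rewrite !rho0 !mulmx0 subrr sub0r; apply/rowP => l.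
  pose F : {linear s -> 'rV[K]_d} := HB.pack (om x) (GRing.isLinear.Build _ _ _ _ _ (omr x)).
  rewrite {1}(coord_vbasis (memvf y)) -[om x _]/(F _) linear_sum summxE !mxE -sumrN.
  have -> : \sum_i F (coord e i y *: e`_i) 0 l = \sum_i coord e i y * (w l *m co x) 0 i.
    by apply: eq_bigr => i _; rewrite linearZ mxE -wP mxE.
  rewrite (eq_bigr (fun i => \sum_k - (w l 0 k * (coord e i y * ad_mx br x i k)))).
    rewrite exchange_big; apply: eq_bigr => k _ /=; rewrite (coord_br hbr) mulr_sumr -sumrN.
    by apply: eq_bigr => i _.
  move=> i _; rewrite mxE mulr_sumr; apply: eq_bigr => k _.
  by rewrite !mxE !mulrN mulrCA.
move=> d r rho rho' m u v G E B rrho rrho' IH inv dec GC EC Bfree rhoB EB om oml omr omA omc.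
(* The coboundary of [psi0] is [om x y *m Om]: the cocycle identity for [u i], [x], [y] is
   multiplied by [rho (v i)] and summed, and invariance is used once for [x] and once for [y]. *)
pose psi0 y := \sum_i om (u i) y *m rho (v i).
have omNl x z : om (- x) z = - om x z.
  pose F : {linear s -> 'rV[K]_d} := HB.pack (om^~ z) (GRing.isLinear.Build _ _ _ _ _ (oml z)).
  by rewrite -[LHS]/(F _) linearN.
have AC (P' Q R S T W A A' : 'rV[K]_d) : P' - Q + R - - S + - T - - W = 0 ->
    A - A' - W - P' = S + (A - Q) - (T + (A' - R)).
  move=> c0; rewrite -[RHS]subr0 -c0; apply/rowP => j; rewrite !mxE; ring.
have psi0P x y : psi0 y *m rho x - psi0 x *m rho y - psi0 (br x y) =
    om x y *m \sum_i rho (u i) *m rho (v i).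
  have bl y' z : linear (fun t => om t y' *m rho z).
    by move=> c t t'; rewrite oml mulmxDl scalemxAl.
  have br_ y' z : linear (fun t => om z y' *m rho t).
    by move=> c t t'; rewrite linearP mulmxDr scalemxAr.
  have H y' x' := inv _ (fun z t => om z y' *m rho t) (bl y') (br_ y') x'.
  apply/eqP; rewrite -subr_eq0 -[X in _ == X](subr0 0) -[X in _ == X - _](H y x).
  rewrite -[X in _ == _ - X](H x y) /psi0 !mulmx_suml mulmx_sumr -!sumrB.
  apply/eqP/eq_bigr => i _; rewrite !rrho.
  have ux : om (br (u i) x) y = - om (br x (u i)) y by rewrite (brC hbr) omNl.
  have uy : om (br (u i) y) x = - om (br y (u i)) x by rewrite (brC hbr) omNl.
  have := omc (u i) x y; rewrite ux uy [om (br x y) (u i)]omA.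
  move/(congr1 (mulmx^~ (rho (v i)))); rewrite mul0mx !(mulmxBl, mulmxDl, mulNmx, mulmxBr) !mulmxA.
  exact: AC.
have [D ED] : exists D, E *m D *m B = E by exists (pinvmx B); rewrite mulmxKpV.
have omE x y : om x y *m E *m D *m B = om x y *m E by rewrite -2!mulmxA [E *m _]mulmxA ED.
have [y|x|x y|x y z|psi' lpsi' psiP] := IH (fun x y => om x y *m E *m D).
- by move=> c x z; rewrite oml !mulmxDl -!scalemxAl.
- by move=> c y z; rewrite omr !mulmxDl -!scalemxAl.
- by rewrite omA !mulNmx.
- apply: (row_free_inj Bfree) => /=; rewrite !(mulmxBl, mulmxDl) -!mulmxA -!rhoB !mulmxA !omE.
  by rewrite -!mulmxA -!EC !mulmxA -!(mulmxBl, mulmxDl) omc !mul0mx.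
exists (fun x => psi0 x *m G + psi' x *m B) => [c x y|x y].
  rewrite lpsi' mulmxDl -scalemxAl scalerDr addrACA; congr (_ + _).
  rewrite scalemxAl -mulmxDl; congr (_ *m _); rewrite /psi0 scaler_sumr -big_split.
  by apply: eq_bigr => i _; rewrite omr mulmxDl scalemxAl.
rewrite -[LHS]mulmx1 dec mulmxDr mulmxA -psi0P -omE psiP.
rewrite !(mulmxBl, mulmxDl, mulNmx) -!mulmxA -!GC -!rhoB !mulmxA.
by apply/esym; rewrite !opprD -[LHS]addrA [X in _ + X = _]addrACA [LHS]addrACA !addrA.
Qed.

End Whitehead.

(** * Polynomial bivector fields *)

Section Jacobiator.
Variable (A : comNzRingType).
Implicit Types (B C : A -> A -> A) (D : A -> A).

Definition jac_term B C f g h := B f (C g h) + C f (B g h).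

(** [schouten_bb] on arbitrary functions instead of coordinates. For [B = C] it is twice the
    Jacobiator. *)
Definition jac B C f g h := jac_term B C f g h + jac_term B C g h f + jac_term B C h f g.

Lemma jacC B C f g h : jac B C f g h = jac C B f g h.
Proof. by rewrite /jac /jac_term; ring. Qed.

Lemma jac_cyc B C f g h : jac B C f g h = jac B C g h f.
Proof. by rewrite /jac; ring. Qed.

Lemma jac_add B C :
    (forall g, {morph B^~ g : f f' / f + f'}) -> (forall f, {morph B f : g g' / g + g'}) ->
    (forall g, {morph C^~ g : f f' / f + f'}) -> (forall f, {morph C f : g g' / g + g'}) ->
  forall g h, {morph (fun f => jac B C f g h) : f f' / f + f'}.
Proof.
move=> Bl Br Cl Cr g h f f'; rewrite /jac /jac_term.
by rewrite !(Bl, Br, Cl, Cr); ring.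
Qed.

Lemma jac_mul B C :
    (forall f g, B f g = - B g f) -> (forall f g, C f g = - C g f) ->
    (forall f, {morph B f : g g' / g + g'}) -> (forall f, {morph C f : g g' / g + g'}) ->
    (forall f g g', B f (g * g') = B f g * g' + g * B f g') ->
    (forall f g g', C f (g * g') = C f g * g' + g * C f g') ->
  forall g h f f', jac B C (f * f') g h = jac B C f g h * f' + f * jac B C f' g h.
Proof.
move=> BC CC Br Cr Bm Cm g h f f'.
(* With [x] on the right throughout, this is a sum of derivations and of commutators of
   derivations. *)
have jacE x : jac B C x g h = - B (C g h) x - C (B g h) x + B g (C h x) + C g (B h x)
    + B h (- C g x) + C h (- B g x).
  rewrite /jac /jac_term (BC x (C g h)) (CC x (B g h)) (CC x g) (BC x g); ring.
rewrite !jacE.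
have BN y x : B y (- x) = - B y x by apply/eqP; rewrite -addr_eq0 -Br addNr; apply/eqP/(addrI (B y 0)); rewrite -Br !addr0.
have CN y x : C y (- x) = - C y x by apply/eqP; rewrite -addr_eq0 -Cr addNr; apply/eqP/(addrI (C y 0)); rewrite -Cr !addr0.
by rewrite !BN !CN !Bm !Cm !Br !Cr !Bm !Cm; ring.
Qed.

(** The identity [[D, [B, C]] = [[D, B], C] + [B, [D, C]]], where [B'] and [C'] are the Lie
    derivatives of [B] and [C] along [D]. *)
Lemma jac_lie B C D B' C' :
    (forall f, {morph B f : g g' / g - g'}) -> (forall f, {morph C f : g g' / g - g'}) ->
    {morph D : f g / f + g} ->
    (forall f g, B' f g = D (B f g) - B (D f) g - B f (D g)) ->
    (forall f g, C' f g = D (C f g) - C (D f) g - C f (D g)) ->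
  forall f g h, jac B' C f g h + jac B C' f g h =
    D (jac B C f g h) - jac B C (D f) g h - jac B C f (D g) h - jac B C f g (D h).
Proof.
move=> BB CB DD BE CE f g h; rewrite /jac /jac_term !(BE, CE) !(BB, CB) !DD.
ring.
Qed.

Lemma jac_oppl B B' C :
    (forall f g, B' f g = - B f g) -> (forall f, {morph C f : g / - g}) ->
  forall f g h, jac B' C f g h = - jac B C f g h.
Proof. by move=> BN CN f g h; rewrite /jac /jac_term !BN !CN; ring. Qed.

End Jacobiator.

Section PolyBivectors.
Variables (K : numFieldType) (N : nat).
Local Notation A := (mpoly N K).
Local Notation Xv i := (mpolyX K (mnm1 i) : A).
Implicit Types (f g h : A) (Z : 'I_N -> A) (P Q : 'I_N -> 'I_N -> A).

Definition is_der (D : A -> A) : Prop :=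
  (forall c f g, D (c *: f + g) = c *: D f + D g) /\
  (forall f g, D (f * g) = D f * g + f * D g).

Lemma is_derD D : is_der D -> {morph D : f g / f + g}.
Proof. by case=> lD _ f g; rewrite -[f]scale1r lD !scale1r. Qed.

Lemma is_der0 D : is_der D -> D 0 = 0.
Proof. by move/is_derD => aD; apply: (addrI (D 0)); rewrite -aD !addr0. Qed.

Lemma is_derZ D c f : is_der D -> D (c *: f) = c *: D f.
Proof. by move=> dD; case: (dD) => lD _; rewrite -[c *: f]addr0 lD (is_der0 dD) addr0. Qed.

Lemma is_derB D : is_der D -> {morph D : f g / f - g}.
Proof. by move=> dD f g; rewrite (is_derD dD) -scaleN1r (is_derZ _ _ dD) scaleN1r. Qed.

Lemma is_derN D : is_der D -> {morph D : f / - f}.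
Proof. by move=> dD f; rewrite -[- f]sub0r (is_derB dD) (is_der0 dD) sub0r. Qed.

Lemma is_der_comb c D D' : is_der D -> is_der D' -> is_der (fun f => c * D f + D' f).
Proof.
move=> [lD mD] [lD' mD']; split=> [a f g|f g]; last by rewrite mD mD'; ring.
by rewrite lD lD' scalerDr mulrDr -!scalerAr addrACA.
Qed.

Lemma is_der_zero : is_der (fun=> 0).
Proof. by split=> [c f g|f g]; rewrite ?scaler0 ?mul0r ?mulr0 addr0. Qed.

Lemma is_der_sum (I : finType) (F : I -> A) (D : I -> A -> A) :
  (forall i, is_der (D i)) -> is_der (fun f => \sum_i F i * D i f).
Proof.
move=> dD; elim: (index_enum I) => [|i r IHr].
  by under [X in is_der X]funext => f do rewrite big_nil; apply: is_der_zero.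
under [X in is_der X]funext => f do rewrite big_cons.
exact: is_der_comb.
Qed.

Lemma is_der_mderiv (i : 'I_N) : is_der (mderiv i).
Proof. by split=> [c f g|f g]; rewrite ?mderivD ?mderivZ ?mderivM. Qed.

Lemma mderivXi (i j : 'I_N) : mderiv i (Xv j) = (i == j)%:R.
Proof.
rewrite mderivX mnm1E eq_sym; case: eqVneq => [->|_]; last by rewrite scale0r.
rewrite scale1r -mpolyX0; congr mpolyX.
by apply/mnmP => k; rewrite mnmBE mnm0E subnn.
Qed.

Lemma is_der_ext D D' : is_der D -> is_der D' -> (forall i, D (Xv i) = D' (Xv i)) ->
  forall f, D f = D' f.
Proof.
move=> dD dD' eX f.
have D1 E : is_der E -> E 1 = 0.
  case=> _ mE; apply: (addrI (E 1)); rewrite addr0.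
  by have := mE 1 1; rewrite mulr1 mul1r mulr1 => <-.
elim/mpolyind: f => [|c m f _ _ IHf]; first by rewrite !is_der0.
case: (dD) (dD') => lD mD [lD' mD']; rewrite lD lD' IHf; congr (_ *: _ + _).
rewrite mpolyXE_id; apply: (big_ind (fun f => D f = D' f)) => [|x y ex ey|i _].
- by rewrite !D1.
- by rewrite mD mD' ex ey.
elim: (m i) => [|k IHk]; first by rewrite expr0 !D1.
by rewrite exprS mD mD' IHk eX.
Qed.

Definition der Z f := \sum_i Z i * mderiv i f.

Lemma der_is_der Z : is_der (der Z).
Proof. by apply: is_der_sum => i; apply: is_der_mderiv. Qed.

Lemma derX Z i : der Z (Xv i) = Z i.
Proof.
rewrite /der (bigD1 i) //= mderivXi eqxx mulr1 big1 ?addr0 // => j /negPf ji.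
by rewrite mderivXi ji mulr0.
Qed.

Definition pbr P f g := \sum_i \sum_j P i j * (mderiv i f * mderiv j g).

Lemma pbr_derl P g : is_der (pbr P ^~ g).
Proof.
have -> : pbr P ^~ g = (fun f => \sum_i (\sum_j P i j * mderiv j g) * mderiv i f).
  apply: funext => f; apply: eq_bigr => i _; rewrite mulr_suml.
  by apply: eq_bigr => j _; ring.
by apply: is_der_sum => i; apply: is_der_mderiv.
Qed.

Lemma pbr_derr P f : is_der (pbr P f).
Proof.
have -> : pbr P f = (fun g => \sum_j (\sum_i P i j * mderiv i f) * mderiv j g).
  apply: funext => g; rewrite /pbr exchange_big; apply: eq_bigr => i _; rewrite mulr_suml.
  by apply: eq_bigr => j _; ring.
by apply: is_der_sum => i; apply: is_der_mderiv.
Qed.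

Lemma pbrl0 P g : pbr P 0 g = 0.
Proof. exact: is_der0 (pbr_derl P g). Qed.

Lemma pbrr0 P f : pbr P f 0 = 0.
Proof. exact: is_der0 (pbr_derr P f). Qed.

Lemma pbrXl P i g : pbr P (Xv i) g = \sum_j P i j * mderiv j g.
Proof.
rewrite /pbr (bigD1 i) //= [X in _ + X]big1 ?addr0 => [|k /negPf ki].
  by apply: eq_bigr => j _; rewrite mderivXi eqxx mul1r.
by apply: big1 => j _; rewrite mderivXi ki mul0r mulr0.
Qed.

Lemma pbrXr P f j : pbr P f (Xv j) = \sum_i P i j * mderiv i f.
Proof.
rewrite /pbr; apply: eq_bigr => i _; rewrite (bigD1 j) //= mderivXi eqxx mulr1.
by rewrite big1 ?addr0 // => k /negPf kj; rewrite mderivXi kj !mulr0.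
Qed.

Lemma pbrX P i j : pbr P (Xv i) (Xv j) = P i j.
Proof.
rewrite pbrXl (bigD1 j) //= mderivXi eqxx mulr1 big1 ?addr0 // => k /negPf kj.
by rewrite mderivXi kj mulr0.
Qed.

Definition antisym P := forall i j, P i j = - P j i.

Lemma pbrC P : antisym P -> forall f g, pbr P f g = - pbr P g f.
Proof.
move=> aP f g; rewrite /pbr exchange_big -sumrN; apply: eq_bigr => i _.
by rewrite -sumrN; apply: eq_bigr => j _; rewrite aP; ring.
Qed.

Definition plie Z P i j := der Z (P i j) - pbr P (Z i) (Xv j) - pbr P (Xv i) (Z j).

Lemma plie_antisym Z P : antisym P -> antisym (plie Z P).
Proof.
move=> aP i j; rewrite /plie aP (is_derN (der_is_der Z)) (pbrC aP (Z i)) (pbrC aP (Xv i)).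
by ring.
Qed.

(** [plie] prescribes the Lie derivative on coordinates only; both sides are derivations in each
    argument, hence agree everywhere. *)
Lemma pbr_plie Z P f g :
  pbr (plie Z P) f g = der Z (pbr P f g) - pbr P (der Z f) g - pbr P f (der Z g).
Proof.
have dZ := der_is_der Z.
pose E f g := der Z (pbr P f g) - pbr P (der Z f) g - pbr P f (der Z g).
have El g' : is_der (E^~ g').
  have dl h := pbr_derl P h; have [lZ mZ] := dZ.
  split=> [c f1 f2|f1 f2].
    have [l1 _] := dl g'; have [l2 _] := dl (der Z g').
    by rewrite /E l1 l2 !lZ l1 -!mul_mpolyC; ring.
  have [_ m1] := dl g'; have [_ m2] := dl (der Z g').
  by rewrite /E m1 m2 mZ (is_derD dZ) !mZ (is_derD (dl g')) !m1; ring.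
have Er f' : is_der (E f').
  have dr h := pbr_derr P h; have [lZ mZ] := dZ.
  split=> [c f1 f2|f1 f2].
    have [l1 _] := dr f'; have [l2 _] := dr (der Z f').
    by rewrite /E l1 l2 !lZ l1 -!mul_mpolyC; ring.
  have [_ m1] := dr f'; have [_ m2] := dr (der Z f').
  by rewrite /E m1 m2 mZ (is_derD dZ) !mZ (is_derD (dr f')) !m1; ring.
rewrite -/(E f g); apply: (is_der_ext (pbr_derl _ _) (El g)) => i.
apply: (is_der_ext (pbr_derr _ _) (Er _)) => j.
by rewrite pbrX /E pbrX !derX.
Qed.

Local Notation pjac P Q := (jac (pbr P) (pbr Q)).

Lemma pjac_der P Q g h : antisym P -> antisym Q -> is_der (fun f => pjac P Q f g h).
Proof.
move=> aP aQ.
have add P' f : {morph pbr P' f : g g' / g + g'} by apply/is_derD/pbr_derr.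
have addl P' f : {morph pbr P'^~ f : g g' / g + g'} by apply/is_derD/pbr_derl.
have mul P' f x y : pbr P' f (x * y) = pbr P' f x * y + x * pbr P' f y.
  by have [_ ->] := pbr_derr P' f.
have jm := jac_mul (pbrC aP) (pbrC aQ) (add P) (add Q) (mul P) (mul Q) g h.
split=> [c f f'|]; last exact: jm.
rewrite (jac_add (addl P) (add P) (addl Q) (add Q)) -!mul_mpolyC jm.
suff -> : jac (pbr P) (pbr Q) (mpolyC N c) g h = 0 by rewrite mul0r add0r.
have cl P' x : pbr P' (mpolyC N c) x = 0.
  by apply: big1 => i _; apply: big1 => j _; rewrite mderivC mul0r mulr0.
have cr P' x : pbr P' x (mpolyC N c) = 0.
  by apply: big1 => i _; apply: big1 => j _; rewrite mderivC !mulr0.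
by rewrite /jac /jac_term !cl !cr !(is_der0 (pbr_derr _ _)) !addr0.
Qed.

Lemma pjac_eq0 P Q : antisym P -> antisym Q ->
  (forall i j k, pjac P Q (Xv i) (Xv j) (Xv k) = 0) -> forall f g h, pjac P Q f g h = 0.
Proof.
move=> aP aQ PQ0 f g h.
apply: (is_der_ext (pjac_der g h aP aQ) is_der_zero) => i; rewrite jac_cyc.
apply: (is_der_ext (pjac_der h (Xv i) aP aQ) is_der_zero) => j; rewrite jac_cyc.
apply: (is_der_ext (pjac_der (Xv i) (Xv j) aP aQ) is_der_zero) => k.
by rewrite jac_cyc.
Qed.

(** This is [[P, Q] = 0] differentiated along [Z]. *)
Lemma pjac_plie0 Z P Q : (forall f g h, pjac P Q f g h = 0) ->
  forall f g h, pjac P (plie Z Q) f g h = - pjac (plie Z P) Q f g h.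
Proof.
move=> PQ0 f g h; apply/eqP; rewrite -addr_eq0 addrC; apply/eqP.
rewrite (jac_lie (D := der Z) (fun f => is_derB (pbr_derr P f)) (fun f => is_derB (pbr_derr Q f))
  (is_derD (der_is_der Z)) (pbr_plie Z P) (pbr_plie Z Q)) !PQ0.
by rewrite (is_der0 (der_is_der Z)) !subr0.
Qed.

End PolyBivectors.

Notation pjac P Q := (jac (pbr P) (pbr Q)).

Section BoundedDegree.
Variables (K : numFieldType) (N k : nat).
Local Notation A := (mpoly N K).
Local Notation d := #|{: bmultinom N k}|.

(** Coordinates in the monomials of degree less than [k]; [msize] exceeds the degree of a nonzero
    polynomial by one. *)
Definition vec_poly (f : A) : 'rV[K]_d := \row_i mcoeff (enum_val i : bmultinom N k) f.
Definition poly_vec (v : 'rV[K]_d) : A :=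
  \sum_i v 0 i *: mpolyX K (enum_val i : bmultinom N k).

Lemma vec_polyK f : (msize f <= k)%N -> poly_vec (vec_poly f) = f.
Proof.
move=> fk; rewrite [RHS](mpolywE fk) [RHS]big_enum_val; apply: eq_bigr => i _.
by rewrite mxE.
Qed.

Lemma poly_vecK v : vec_poly (poly_vec v) = v.
Proof.
apply/rowP => i; rewrite mxE /poly_vec raddf_sum (bigD1 i) //= mcoeffZ mcoeffX eqxx mulr1.
rewrite big1 ?addr0 // => j ji; rewrite mcoeffZ mcoeffX.
case: eqP => [/val_inj/enum_val_inj eji|_]; last by rewrite mulr0.
by rewrite eji eqxx in ji.
Qed.

Lemma poly_vec_linear : linear poly_vec.
Proof.
move=> c u v; rewrite scaler_sumr -big_split; apply: eq_bigr => i _.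
by rewrite !mxE scalerDl scalerA.
Qed.

Lemma vec_poly_linear : linear vec_poly.
Proof. by move=> c u v; apply/rowP => i; rewrite !mxE mcoeffD mcoeffZ. Qed.

HB.instance Definition _ := GRing.isLinear.Build K _ _ _ poly_vec poly_vec_linear.
HB.instance Definition _ := GRing.isLinear.Build K _ _ _ vec_poly vec_poly_linear.

Lemma msize_poly_vec v : (msize (poly_vec v) <= k)%N.
Proof.
apply: (leq_trans (msize_sum _ _ _)); apply/bigmax_leqP => i _.
apply: leq_trans (msizeZ_le _ _) _; rewrite msizeX; exact: bmdeg.
Qed.

End BoundedDegree.

Lemma msize_mderiv (K : numFieldType) N (i : 'I_N) (f : mpoly N K) :
  (msize (mderiv i f) <= (msize f).-1)%N.
Proof.
rewrite msizeE; apply/bigmax_leqP_seq => m mf _.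
have : mnm_add m (mnm1 i) \in msupp f.
  move: mf; rewrite !mcoeff_msupp mcoeff_deriv; apply: contra => /eqP ->.
  by rewrite mul0rn.
move/msize_mdeg_lt; rewrite mdegD mdeg1 addn1; case: (msize f) => //.
Qed.

Lemma addrr_eq0 (K : numFieldType) (V : lmodType K) (x : V) : x + x = 0 -> x = 0.
Proof.
by rewrite -mulr2n -scaler_nat => /eqP; rewrite scaler_eq0 pnatr_eq0 /= => /eqP.
Qed.

Section Blocks.
Variable n : nat.

Definition on_blocks (T : Type) (x : T) (y : 'I_n -> T) (i : 'I_(1 + n)) : T :=
  if fintype.split i is inr j then y j else x.

Lemma on_blocks0 T (x : T) y : on_blocks x y (lshift n ord0) = x.
Proof. by rewrite /on_blocks; case: split_ordP => // j /(congr1 val). Qed.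

Lemma on_blocksr T (x : T) y j : on_blocks x y (rshift 1 j) = y j.
Proof.
rewrite /on_blocks; case: split_ordP => [l /(congr1 val) /=|l /rshift_inj -> //].
by rewrite (ord1 l).
Qed.

End Blocks.

(** * Cohomology of the Lie-Poisson bivector *)

Section CentralExtension.
Variables (K : numFieldType) (C : numClosedFieldType) (iota : {rmorphism K -> C}).
Variables (s : vectType K) (br : s -> s -> s).
Hypotheses (hbr : is_lie_bracket br) (hss : is_semisimple br).
Variables (n : nat) (b : n.-tuple s).
Hypothesis hb : basis_of fullv b.
Local Notation A := (mpoly (1 + n) K).
Local Notation Xv i := (mpolyX K (mnm1 i) : A).
Local Notation i0 := (lshift n ord0 : 'I_(1 + n)).
Local Notation rs := (@rshift 1 n).

Definition lie_poly (i j : 'I_(1 + n)) : A := \sum_k coord (gbasis b) k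
  (gbracket br (tnth (gbasis b) i) (tnth (gbasis b) j)) *: Xv k.

(** The element [x] of s as a linear function on the dual of g, independent of x_0. *)
Definition hat (x : s) : A := \sum_j coord b j x *: Xv (rs j).

Lemma gbasis0 : tnth (gbasis b) i0 = (0, 1).
Proof. by rewrite (tnth_nth 0). Qed.

Lemma gbasisr i : tnth (gbasis b) (rs i) = (tnth b i, 0).
Proof. by rewrite !(tnth_nth 0) /= add0n (nth_map 0) // size_tuple. Qed.

Lemma hat_linear : linear hat.
Proof.
move=> c x y; rewrite scaler_sumr -big_split; apply: eq_bigr => j _.
by rewrite linearP scalerDl scalerA.
Qed.

HB.instance Definition _ := GRing.isLinear.Build K s A _ hat hat_linear.

Lemma hat_basis i : hat (tnth b i) = Xv (rs i).
Proof.
rewrite /hat (bigD1 i) //= (tnth_nth 0) coord_free ?(basis_free hb) // eqxx scale1r.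
rewrite big1 ?addr0 // => j /negPf ji.
by rewrite coord_free ?(basis_free hb) // eq_sym ji scale0r.
Qed.

Lemma hatE x : x = \sum_j coord b j x *: tnth b j.
Proof.
rewrite {1}(coord_basis hb (memvf x)); apply: eq_bigr => j _.
by rewrite (tnth_nth 0).
Qed.

Lemma gbasis_free : free (gbasis b).
Proof.
apply/freeP => c; rewrite big_split_ord big_ord1 /=.
move=> c0.
have cr j : c (rs j) = 0.
  have /freeP/(_ (fun j => c (rs j)))  := basis_free hb; apply.
  have /(congr1 fst) := c0; rewrite /= scaler0 add0r (raddf_sum fst) /= => e; rewrite -[RHS]e.
  apply: eq_bigr => i _; rewrite add0n (nth_map 0) ?size_tuple //.
move=> i; case: (split_ordP i) => j -> //; rewrite (ord1 j).
move: c0; rewrite big1 ?addr0 => [/(congr1 snd) /=|k _]; first by rewrite /GRing.scale /= mulr1.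
by rewrite cr scale0r.
Qed.

Lemma coord_gbasis v (i : 'I_(1 + n)) :
  coord (gbasis b) i (v, 0) = if fintype.split i is inr j then coord b j v else 0.
Proof.
pose c (i : 'I_(1 + n)) := if fintype.split i is inr j then coord b j v else 0.
have c0 : c i0 = 0 by rewrite /c; case: split_ordP => // j /(congr1 val) /=.
have cr j : c (rs j) = coord b j v.
  rewrite /c; case: split_ordP => [k /(congr1 val) /=|k /rshift_inj -> //].
  by rewrite (ord1 k).
suff -> : (v, 0) = \sum_i c i *: (gbasis b)`_i by rewrite coord_sum_free // gbasis_free.
rewrite big_split_ord big_ord1 c0 scale0r /= add0r.
transitivity (\sum_j coord b j v *: ((b`_j, 0) : s * K^o)).
  rewrite [RHS]surjective_pairing (raddf_sum fst) (raddf_sum snd) /=; congr pair.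
    exact: (coord_basis hb (memvf v)).
  by rewrite big1 // => j _; rewrite scaler0.
apply: eq_bigr => j _; rewrite cr; congr (_ *: _).
by rewrite /= add0n (nth_map 0) // size_tuple.
Qed.

Lemma lie_poly_hat u v : \sum_k coord (gbasis b) k (gbracket br u v) *: Xv k = hat (br u.1 v.1).
Proof.
rewrite big_split_ord big_ord1 /= !coord_gbasis.
case: split_ordP => [k _|k /(congr1 val) //]; rewrite scale0r add0r.
apply: eq_bigr => j _; rewrite coord_gbasis.
by case: split_ordP => [l /(congr1 val) /=|l /rshift_inj -> //]; rewrite (ord1 l).
Qed.

Lemma lie_poly0l j : lie_poly i0 j = 0.
Proof.
rewrite /lie_poly lie_poly_hat gbasis0 /=.
by rewrite -[X in br X _](scale0r 0) (brZl hbr) scale0r linear0.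
Qed.

Lemma lie_polyr i j : lie_poly (rs i) (rs j) = hat (br (tnth b i) (tnth b j)).
Proof. by rewrite /lie_poly lie_poly_hat !gbasisr. Qed.

Lemma lie_poly_antisym : antisym lie_poly.
Proof. by move=> i j; rewrite /lie_poly !lie_poly_hat (brC hbr) linearN. Qed.

Local Notation p1 := lie_poly.

Lemma pbr_hat x y : pbr p1 (hat x) (hat y) = hat (br x y).
Proof.
have expand D : is_der D -> D (hat x) = \sum_j coord b j x *: D (Xv (rs j)).
  move=> dD; rewrite /hat (big_morph D (is_derD dD) (is_der0 dD)).
  by apply: eq_bigr => j _; rewrite (is_derZ _ _ dD).
have expand' D : is_der D -> D (hat y) = \sum_j coord b j y *: D (Xv (rs j)).
  move=> dD; rewrite /hat (big_morph D (is_derD dD) (is_der0 dD)).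
  by apply: eq_bigr => j _; rewrite (is_derZ _ _ dD).
rewrite (expand _ (pbr_derl _ _)) {2}(hatE x) (br_suml hbr) linear_sum.
apply: eq_bigr => i _; rewrite (brZl hbr) linearZ; congr (_ *: _).
rewrite (expand' _ (pbr_derr _ _)) {2}(hatE y) (br_sumr hbr) linear_sum.
apply: eq_bigr => j _; rewrite (brZr hbr) linearZ; congr (_ *: _).
by rewrite pbrX lie_polyr.
Qed.

Lemma pbr_p1_0l g : pbr p1 (Xv i0) g = 0.
Proof. by rewrite pbrXl big1 // => j _; rewrite lie_poly0l mul0r. Qed.

Lemma pbr_p1_0r g : pbr p1 g (Xv i0) = 0.
Proof. by rewrite (pbrC lie_poly_antisym) pbr_p1_0l oppr0. Qed.

Lemma Xv_cases i : Xv i = Xv i0 \/ exists x, Xv i = hat x.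
Proof.
case: (split_ordP i) => j ->; first by left; rewrite (ord1 j).
by right; exists (tnth b j); rewrite hat_basis.
Qed.

Lemma pjac_lie_poly f g h : pjac p1 p1 f g h = 0.
Proof.
apply: (pjac_eq0 lie_poly_antisym lie_poly_antisym) => i j k.
have [->|[x ->]] := Xv_cases i; first by rewrite /jac /jac_term !(pbr_p1_0l, pbr_p1_0r, pbrl0, pbrr0, addr0).
have [->|[y ->]] := Xv_cases j; first by rewrite /jac /jac_term !(pbr_p1_0l, pbr_p1_0r, pbrl0, pbrr0, addr0).
have [->|[z ->]] := Xv_cases k; first by rewrite /jac /jac_term !(pbr_p1_0l, pbr_p1_0r, pbrl0, pbrr0, addr0).
have : hat (br x (br y z)) + hat (br y (br z x)) + hat (br z (br x y)) = 0.
  by rewrite -!linearD (lie_jacobi hbr) linear0.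
rewrite /jac /jac_term !pbr_hat; move: (hat _) (hat _) (hat _) => u v w uvw.
(* [jac] with equal brackets counts every term of the Jacobi identity twice. *)
by transitivity ((w + v + u) + (w + v + u)); [ring|rewrite uvw addr0].
Qed.

Section ActionOnPolynomials.
Variable k : nat.
Local Notation d := #|{: bmultinom (1 + n) k}|.

Definition act x f := pbr p1 (hat x) f.

Lemma act_br x y f : act (br x y) f = act x (act y f) - act y (act x f).
Proof.
have := pjac_lie_poly (hat x) (hat y) f; rewrite /jac /jac_term pbr_hat.
rewrite (pbrC lie_poly_antisym f (hat x)) (pbrC lie_poly_antisym f (hat (br x y))).
rewrite (is_derN (pbr_derr p1 (hat y))) -/(act x (act y f)) -/(act y (act x f)) -/(act (br x y) f) => H.
have : act x (act y f) - act y (act x f) - act (br x y) f = 0.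
  apply: addrr_eq0; rewrite -[RHS]H; move: (act _ _) (act _ _) (act _ _) => u v w; ring.
by move/eqP; rewrite subr_eq0 => /eqP.
Qed.

Lemma act_linear x : linear (act x).
Proof. by case: (pbr_derr p1 (hat x)). Qed.
HB.instance Definition _ x := GRing.isLinear.Build K A A _ (act x) (act_linear x).

Lemma act_linearl f : linear (act^~ f).
Proof. by case: (pbr_derl p1 f) => l _ c x y; rewrite /act linearP l. Qed.

Lemma msize_mul1 (u w : A) : (msize u <= 1)%N -> (msize (u * w) <= msize w)%N.
Proof. by move/msize1_polyC ->; rewrite mul_mpolyC msizeZ_le. Qed.

Lemma msize_pbr (P : 'I_(1 + n) -> 'I_(1 + n) -> A) f g m :
  (forall i j, msize (P i j * (mderiv i f * mderiv j g)) <= m)%N -> (msize (pbr P f g) <= m)%N.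
Proof.
move=> Pm; apply: (leq_trans (msize_sum _ _ _)); apply/bigmax_leqP => i _.
by apply: (leq_trans (msize_sum _ _ _)); apply/bigmax_leqP => j _.
Qed.

Lemma msizeXv i : msize (Xv i) = 2.
Proof. by rewrite msizeX mdeg1. Qed.

Lemma msize_hat x : (msize (hat x) <= 2)%N.
Proof.
apply: (leq_trans (msize_sum _ _ _)); apply/bigmax_leqP => i _.
by rewrite (leq_trans (msizeZ_le _ _)) // msizeXv.
Qed.

Lemma msize_mderiv1 i (f : A) : (msize f <= 2)%N -> (msize (mderiv i f) <= 1)%N.
Proof. by move=> f2; apply: leq_trans (msize_mderiv i f) _; case: (msize f) f2. Qed.

Lemma msize_pbr_linear (P : 'I_(1 + n) -> 'I_(1 + n) -> A) f g m :
  (msize f <= 2)%N -> (msize g <= 2)%N -> (forall i j, msize (P i j) <= m)%N ->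
  (msize (pbr P f g) <= m)%N.
Proof.
move=> f2 g2 Pm; apply: msize_pbr => i j; rewrite mulrC.
apply: leq_trans (msize_mul1 _ _) (Pm i j).
by apply: leq_trans (msize_mul1 _ _) (msize_mderiv1 j g2); apply: msize_mderiv1.
Qed.

(** Differentiating [f] lowers the degree by one and the linear coefficients of the bracket restore
    it. So the polynomials of bounded degree form a module over [s]. *)
Lemma msize_act x f : (msize f <= k)%N -> (msize (act x f) <= k)%N.
Proof.
move=> fk; have [->|f0] := eqVneq f 0; first by rewrite linear0 msize0.
apply: (@leq_trans (msize f)) => //; apply: msize_pbr => i j.
have w_le : (msize (mderiv i (hat x) * mderiv j f) <= (msize f).-1)%N.
  apply: leq_trans (msize_mul1 _ _) (msize_mderiv j f).
  exact/msize_mderiv1/msize_hat.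
have u_le : (msize (p1 i j) <= 2)%N by rewrite /lie_poly lie_poly_hat msize_hat.
have f_gt0 : (0 < msize f)%N by rewrite lt0n msize_poly_eq0.
have [->|nz1] := eqVneq (p1 i j) 0; first by rewrite mul0r msize0.
have [->|nz2] := eqVneq (mderiv i (hat x) * mderiv j f) 0; first by rewrite mulr0 msize0.
rewrite msizeM //; have arith e u w : (0 < e -> u <= 2 -> w <= e.-1 -> (u + w).-1 <= e)%N by lia.
exact: arith.
Qed.

Definition act_mx x : 'M[K]_d := \matrix_i vec_poly k (act x (mpolyX K (enum_val i : bmultinom (1 + n) k))).

Fact act_mx_linear : linear act_mx.
Proof.
move=> c x y; apply/row_matrixP => i; rewrite linearP /= !rowK.
by rewrite act_linearl vec_poly_linear.
Qed.
HB.instance Definition _ := GRing.isLinear.Build K s _ _ act_mx act_mx_linear.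

Lemma mul_act_mx v x : v *m act_mx x = vec_poly k (act x (poly_vec v)).
Proof.
rewrite mulmx_sum_row /poly_vec [act x _]linear_sum linear_sum; apply: eq_bigr => i _.
by rewrite rowK !linearZ.
Qed.

Lemma poly_vec_act v x : poly_vec (v *m act_mx x) = act x (poly_vec v).
Proof. by rewrite mul_act_mx vec_polyK // msize_act // msize_poly_vec. Qed.

Lemma act_mx_rep : is_rep br act_mx.
Proof.
move=> x y; apply/row_matrixP => i; rewrite !rowE mulmxBr !mulmxA.
apply: (can_inj (@poly_vecK K (1 + n) k)).
rewrite [RHS]linearB [X in X - _]poly_vec_act [X in _ - X]poly_vec_act !poly_vec_act; exact: act_br.
Qed.

End ActionOnPolynomials.

Lemma der_hat Z x : der Z (hat x) = \sum_j coord b j x *: Z (rs j).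
Proof.
have dZ := der_is_der Z.
rewrite /hat (big_morph _ (is_derD dZ) (is_der0 dZ)); apply: eq_bigr => j _.
by rewrite (is_derZ _ _ dZ) derX.
Qed.

Lemma bivector_exact R : antisym R -> (forall f g h, pjac p1 R f g h = 0) ->
  exists Z, forall i j, plie Z p1 i j = R i j.
Proof.
move=> aR cR; pose k := (\max_i \max_j msize (R i j))%N.
have Rk i j : (msize (R i j) <= k)%N.
  apply: leq_trans (leq_bigmax i); exact: (leq_bigmax (F := fun j => msize (R i j)) j).
pose V := 'rV[K]_#|{: bmultinom (1 + n) k}|.
have Rl g : linear (fun x => pbr R (hat x) g).
  by move=> c x y; rewrite linearP; case: (pbr_derl R g) => l _; apply: l.
have Rr g : linear (fun x => pbr R g (hat x)).
  by move=> c x y; rewrite linearP; case: (pbr_derr R g) => l _; apply: l.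
have Rhh x y : (msize (pbr R (hat x) (hat y)) <= k)%N.
  by apply: msize_pbr_linear Rk; apply: msize_hat.
have R0h x : (msize (pbr R (Xv i0) (hat x)) <= k)%N.
  by apply: msize_pbr_linear Rk; rewrite ?msizeXv ?msize_hat.
have vecB f g : vec_poly k (f - g) = vec_poly k f - vec_poly k g by rewrite linearB.
have vecD f g : vec_poly k (f + g) = vec_poly k f + vec_poly k g by rewrite linearD.
have vec0 : vec_poly k 0 = 0 :> V by rewrite linear0.
have actE x f : act x f = pbr p1 (hat x) f by [].
have actC x f : pbr p1 f (hat x) = - act x f by rewrite (pbrC lie_poly_antisym).
have actN x f : act x (- f) = - act x f by rewrite linearN.
have hatN x : hat (- x) = - hat x by rewrite linearN.
have RN x f : pbr R f (- x) = - pbr R f x by rewrite (is_derN (pbr_derr R f)).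
have [psi lpsi psiP] : exists2 psi : s -> A, linear psi & forall x y,
    pbr R (hat x) (hat y) = act x (psi y) - act y (psi x) - psi (br x y).
  pose om x y : V := vec_poly k (pbr R (hat x) (hat y)).
  have [] := whitehead2 iota hbr hss (act_mx_rep k) (om := om).
  - by move=> y c x z; rewrite /om Rl vec_poly_linear.
  - by move=> y c x z; rewrite /om Rr vec_poly_linear.
  - move=> x y; rewrite /om (pbrC aR); apply/rowP => i; by rewrite !mxE mcoeffN.
  - move=> x y z; have omE t u v : om u v *m act_mx k t = vec_poly k (act t (pbr R (hat u) (hat v))).
      by rewrite mul_act_mx /om vec_polyK.
    rewrite !omE /om -vecB -vecD -vecB -vecD -vecB.
    rewrite [X in vec_poly k X](_ : _ = 0) ?vec0 // -[RHS](cR (hat x) (hat y) (hat z)).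
    rewrite /jac /jac_term !pbr_hat -!actE (pbrC aR (hat z) (hat x)) (brC hbr z x).
    rewrite (pbrC aR (hat x) (hat (br y z))) (pbrC aR (hat z) (hat (br x y))).
    rewrite hatN RN actN (pbrC aR (hat y) (hat (br x z))).
    move: (act x _) (act y _) (act z _) => a1 a2 a3.
    move: (pbr _ _ _) (pbr _ _ _) (pbr _ _ _) => a4 a5 a6.
    by ring.
  move=> psi lpsi psiP; exists (fun x => poly_vec (psi x)).
    by move=> c x y; rewrite lpsi poly_vec_linear.
  move=> x y; rewrite -[LHS](vec_polyK (Rhh x y)) -/(om x y) psiP.
  by rewrite !linearB /= !poly_vec_act.
(* As [Xv i0] is central for [p1], the cocycle condition on [Xv i0], [hat x], [hat y] reduces to
   that of a 1-cocycle. *)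
have [w wP] : exists w : A, forall x, pbr R (Xv i0) (hat x) = act x w.
  have [] := whitehead1 iota hbr hss (act_mx_rep k) (phi := fun x => vec_poly k (pbr R (Xv i0) (hat x))).
  - by move=> c x z; rewrite Rr vec_poly_linear.
  - move=> x y; have phiE t u : vec_poly k (pbr R (Xv i0) (hat u)) *m act_mx k t =
        vec_poly k (act t (pbr R (Xv i0) (hat u))).
      by rewrite mul_act_mx vec_polyK.
    rewrite !phiE -vecB; congr vec_poly; apply/eqP; rewrite -subr_eq0; apply/eqP.
    rewrite -[RHS](cR (Xv i0) (hat x) (hat y)) /jac /jac_term !pbr_hat.
    rewrite !pbr_p1_0l !pbr_p1_0r !pbrr0 -!actE (pbrC aR (hat y) (Xv i0)) actN.
    by move: (act x _) (act y _) => a1 a2; move: (pbr _ _ _) => a3; ring.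
  move=> w wP; exists (poly_vec w) => x.
  by rewrite -poly_vec_act -wP vec_polyK.
(* The signs come from [plie]: on [hat x], [hat y] it is minus the coboundary of [Z], and on
   [Xv i0], [hat x] it is the action of [x] on [Z i0]. *)
pose Z := on_blocks w (fun j => - psi (tnth b j)).
have Z0 : Z i0 = w by apply: on_blocks0.
have Zr j : Z (rs j) = - psi (tnth b j) by apply: on_blocksr.
have Zhat x : der Z (hat x) = - psi x.
  pose F : {linear s -> A} := HB.pack psi (GRing.isLinear.Build _ _ _ _ _ lpsi).
  rewrite der_hat -[psi x]/(F x) {2}(hatE x) linear_sum -sumrN.
  by apply: eq_bigr => j _; rewrite Zr linearZ scalerN.
have aLZ := plie_antisym Z lie_poly_antisym.
have zero0 i : plie Z p1 i0 (rs i) = R i0 (rs i).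
  rewrite /plie lie_poly0l (is_der0 (der_is_der Z)) pbr_p1_0l subr0 sub0r Z0.
  by rewrite -hat_basis actC opprK -wP hat_basis pbrX.
exists Z => i j; case: (split_ordP i) => [i' ->|i' ->]; case: (split_ordP j) => [j' ->|j' ->].
- rewrite (ord1 i') (ord1 j'); transitivity (0 : A); last apply/esym; apply: addrr_eq0.
    by rewrite {1}aLZ addNr.
  by rewrite {1}aR addNr.
- by rewrite (ord1 i') zero0.
- by rewrite (ord1 j') aLZ zero0 -aR.
rewrite /plie lie_polyr Zhat !Zr -!hat_basis (is_derN (pbr_derl _ _)) (is_derN (pbr_derr _ _)).
rewrite actC !opprK -actE -pbrX -!hat_basis psiP.
by move: (act _ _) (act _ _) (psi _) => u v t; ring.
Qed.

Lemma pbrN (P : 'I_(1 + n) -> 'I_(1 + n) -> A) f g :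
  pbr (fun i j => - P i j) f g = - pbr P f g.
Proof.
rewrite /pbr -sumrN; apply: eq_bigr => i _; rewrite -sumrN; apply: eq_bigr => j _.
by rewrite mulNr.
Qed.

Lemma pjacN (P Q : 'I_(1 + n) -> 'I_(1 + n) -> A) f g h :
  pjac (fun i j => - P i j) Q f g h = - pjac P Q f g h.
Proof.
by apply: jac_oppl => [u v|u]; [apply: pbrN|apply/is_derN/pbr_derr].
Qed.

(** The cocycle condition propagates: if [[Z', p1] = - [Z, p2]], then [[p1, [Z', p2]] = - [[Z', p1],
    p2] = [[Z, p2], p2]], which vanishes because [[p2, p2] = 0]. *)
Lemma lie_sequence Z0 p2 : antisym p2 -> plie Z0 p1 = p2 ->
    (forall f g h, pjac p2 p2 f g h = 0) ->
  (forall f g h, pjac p1 p2 f g h = 0) /\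
  exists Z : nat -> 'I_(1 + n) -> A, Z 0 = Z0 /\
    forall k i j, plie (Z k.+1) p1 i j + plie (Z k) p2 i j = 0.
Proof.
move=> a2 e2 J22.
(* Differentiating [[p1, p1] = 0] along [Z0] gives twice [[p1, p2]]. *)
have J12 f g h : pjac p1 p2 f g h = 0.
  apply: addrr_eq0; have := pjac_plie0 Z0 pjac_lie_poly f g h; rewrite e2 jacC => /eqP.
  by rewrite -addr_eq0 jacC => /eqP.
split=> //; pose good Z := forall f g h, pjac p1 (plie Z p2) f g h = 0.
have /choice[F FP] (Z : 'I_(1 + n) -> A) : exists Z', good Z ->
    (forall i j, plie Z' p1 i j = - plie Z p2 i j) /\ good Z'.
  (* Where the cocycle condition fails the choice is arbitrary; the sequence from [Z0] never gets
     there. *)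
  have [gZ|ngZ] := pselect (good Z); last by exists Z.
  have aR : antisym (fun i j => - plie Z p2 i j).
    by move=> i j; rewrite (plie_antisym Z a2).
  have cR f g h : pjac p1 (fun i j => - plie Z p2 i j) f g h = 0.
    by rewrite jacC pjacN jacC gZ oppr0.
  have [Z' Z'P] := bivector_exact aR cR; exists Z' => _; split=> // f g h.
  rewrite (pjac_plie0 Z' J12); have -> : plie Z' p1 = (fun i j => - plie Z p2 i j).
    by apply: funext => i; apply: funext => j.
  rewrite pjacN opprK; apply: addrr_eq0.
  have := pjac_plie0 Z J22 f g h => /eqP.
  by rewrite -addr_eq0 jacC => /eqP.
pose Zs k := iter k F Z0.
have gs k : good (Zs k).
  elim: k => [|k IHk] /=; last by case: (FP _ IHk).
  by move=> f g h; rewrite /= (pjac_plie0 Z0 J12) e2 J22 oppr0.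
exists Zs; split=> // k i j; have [-> _] := FP _ (gs k).
by rewrite addNr.
Qed.

End CentralExtension.

(** * Analytic functions over R and C *)

(* Completeness, in the form in which it is used: a sequence whose variation is
   dominated by that of a bounded monotone sequence converges. *)
Definition bv_complete (K : numFieldType) : Prop :=
  forall (S a : nat -> K) (M : K),
    (forall m, `|S m.+1 - S m| <= a m.+1 - a m) -> (forall m, a m <= M) ->
  exists l : K, S @ \oo --> l.

Lemma bv_complete_real (R : realType) : bv_complete R.
Proof.
move=> S a M Sa aM.
have a0 m : 0 <= a m.+1 - a m by apply: le_trans (Sa m).
have cv (u : nat -> R) (B : R) : (forall m, 0 <= u m.+1 - u m) -> (forall m, u m <= B) -> cvgn u.
  move=> u0 uB; apply: nondecreasing_is_cvgn.
    by apply/nondecreasing_seqP => m; rewrite -subr_ge0.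
  by exists B => _ [m _ <-].
have ca : cvgn a by apply: (cv _ M).
(* A step of [S] is at least minus that of [a], so [S + a] is nondecreasing and [S] is a difference
   of two monotone sequences. *)
have cSa : cvgn (fun m => S m + a m).
  apply: (cv _ (S 0%N + M *+ 2 - a 0%N)) => [m|m].
    by have := Sa m; rewrite ler_norml => /andP[]; lra.
  have : S m <= S 0%N + (a m - a 0%N).
    elim: m => [|m IHm]; first lra.
    by have := Sa m; rewrite ler_norml => /andP[_]; lra.
  by have := aM m; rewrite mulr2n; lra.
have eS : (fun m => S m + a m) - a = S by apply/funext => m; rewrite fctE addrK.
by rewrite -eS; eexists; exact: (cvgB cSa ca).
Qed.

Lemma bv_complete_complex (R : realType) : bv_complete R[i].
Proof.
move=> S a M Sa aM.
have Re_le (z w : R[i]) : z <= w -> complex.Re z <= complex.Re w.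
  by case: z w => [x y] [x' y']; rewrite lecE => /andP[].
have ReB (z w : R[i]) : complex.Re (z - w) = complex.Re z - complex.Re w.
  by case: z w => [x y] [x' y'].
have ImB (z w : R[i]) : complex.Im (z - w) = complex.Im z - complex.Im w.
  by case: z w => [x y] [x' y'].
have Re_norm (z : R[i]) : `|complex.Re z| <= complex.Re `|z|.
  case: z => x y /=; rewrite -sqrtr_sqr ler_wsqrtr // lerDl sqr_ge0 //.
have Im_norm (z : R[i]) : `|complex.Im z| <= complex.Re `|z|.
  case: z => x y /=; rewrite -sqrtr_sqr ler_wsqrtr // lerDr sqr_ge0 //.
have aM' m : complex.Re (a m) <= complex.Re M by apply: Re_le.
have [|x Sx] := @bv_complete_real R (fun m => complex.Re (S m)) (fun m => complex.Re (a m)) (complex.Re M) _ aM'.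
  by move=> m; rewrite -!ReB (le_trans (Re_norm _)) // Re_le.
have [|y Sy] := @bv_complete_real R (fun m => complex.Im (S m)) (fun m => complex.Re (a m)) (complex.Re M) _ aM'.
  by move=> m; rewrite -ImB -ReB (le_trans (Im_norm _)) // Re_le.
exists (x +i* y); apply/cvgrPdist_lt => e e0.
have eRe : e = (complex.Re e)%:C by case: e e0 => u v; rewrite ltcE /= => /andP[/eqP -> _].
have e0' : 0 < complex.Re e by move: e0; rewrite eRe ltcR.
have e2 : 0 < complex.Re e / 2 by rewrite divr_gt0.
move/cvgrPdist_lt/(_ _ e2): Sx => Sx; move/cvgrPdist_lt/(_ _ e2): Sy => Sy.
near=> m; rewrite eRe.
have -> : x +i* y - S m = (x - complex.Re (S m))%:C + 'i%C * (y - complex.Im (S m))%:C.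
  by case: (S m) => u v; simpc.
apply: le_lt_trans (ler_normD _ _) _; rewrite normrM.
have n1 : `|'i%C : R[i]| = 1 by rewrite normc_def /= expr0n expr1n add0r sqrtr1.
have nC (t : R) : `|t%:C| = `|t|%:C :> R[i] by rewrite normc_def /= expr0n addr0 sqrtr_sqr.
rewrite n1 mul1r !nC -rmorphD /= ltcR [ltRHS](splitr (complex.Re e)) ltrD //.
- by near: m.
- by near: m.
Unshelve. all: by end_near.
Qed.

(** * Sums over boxes of multi-indices *)

Section Boxes.
Variable n : nat.
Local Notation mi := {ffun 'I_n -> nat}.
Implicit Types (a : mi) (i : 'I_n).

(** The index set of the partial sums in [analytic_at], moved into a type independent of [m] so that
    boxes of different sizes can be compared. *)
Definition box_seq m : seq mi :=
  [seq [ffun i => (al i : nat)] | al : {ffun 'I_n -> 'I_m}].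

Lemma box_seq_uniq m : uniq (box_seq m).
Proof.
rewrite map_inj_uniq ?enum_uniq // => x y /ffunP xy; apply/ffunP => i.
by apply: val_inj; have := xy i; rewrite !ffunE.
Qed.

Definition inbox m a := [forall i, a i < m]%N.

Definition below i m a := (a i < m)%N.

Lemma mem_box_seq m a : (a \in box_seq m) = inbox m a.
Proof.
apply/mapP/forallP => [[al _ ->] i|am]; first by rewrite ffunE.
exists [ffun i => Ordinal (am i)]; first by rewrite mem_enum.
by apply/ffunP => i; rewrite !ffunE.
Qed.

Definition mshift i a : mi := [ffun j => if j == i then (a j).+1 else a j].

Lemma mshift_inj i : injective (mshift i).
Proof.
move=> x y /ffunP xy; apply/ffunP => j; have := xy j; rewrite !ffunE.
by case: eqP => // _ [].
Qed.

Lemma mshift_comm i j a : mshift i (mshift j a) = mshift j (mshift i a).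
Proof. by apply/ffunP => k; rewrite !ffunE; do 2!case: eqP. Qed.

Section Sums.
Variable K : numFieldType.
Implicit Types u : mi -> K.

Definition bsum u m : K := \sum_(a <- box_seq m) u a.

Lemma bsum_widen m : perm_eq (box_seq m) [seq a <- box_seq m.+1 | inbox m a].
Proof.
apply: uniq_perm; rewrite ?filter_uniq ?box_seq_uniq // => a.
rewrite mem_filter !mem_box_seq andb_idr // => /forallP am.
by apply/forallP => i; rewrite ltnS ltnW.
Qed.

Lemma bsumS u m : bsum u m.+1 = bsum u m + \sum_(a <- box_seq m.+1 | ~~ inbox m a) u a.
Proof.
by rewrite /bsum (bigID (inbox m)) /= (perm_big _ (bsum_widen m)) big_filter.
Qed.

Lemma bsum_variation u m :
  `|bsum u m.+1 - bsum u m| <= bsum (fun a => `|u a|) m.+1 - bsum (fun a => `|u a|) m.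
Proof. by rewrite !bsumS ![_ + _ - _]addrAC !subrr !add0r ler_norm_sum. Qed.

Lemma bsum_mono u m : (forall a, 0 <= u a) -> bsum u m <= bsum u m.+1.
Proof. by move=> u0; rewrite bsumS lerDl sumr_ge0. Qed.

Lemma bsum_ge0 u m : (forall a, 0 <= u a) -> 0 <= bsum u m.
Proof. by move=> u0; rewrite sumr_ge0. Qed.

Lemma mshift_perm i m : perm_eq [seq a : mi <- box_seq m.+1 | 0 < a i]%N
  [seq mshift i a | a : mi <- box_seq m.+1 & below i m a].
Proof.
apply: uniq_perm; rewrite ?(map_inj_uniq (@mshift_inj i)) ?filter_uniq ?box_seq_uniq //.
move=> a; rewrite mem_filter mem_box_seq; apply/andP/mapP => [[a0 /forallP am]|[c]].
  exists [ffun j => if j == i then (a j).-1 else a j].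
    rewrite mem_filter mem_box_seq /below ffunE eqxx.
    have := am i; case: (a i) a0 => // k _; rewrite ltnS /= => -> /=; apply/forallP => j; rewrite ffunE.
    by case: eqP => // _; rewrite (leq_ltn_trans (leq_pred _)).
  by apply/ffunP => j; rewrite !ffunE; case: eqP => // ->; rewrite prednK.
rewrite mem_filter mem_box_seq /below => /andP[ci /forallP cm] ->; rewrite ffunE eqxx; split=> //.
by apply/forallP => j; rewrite ffunE; case: eqP => [->|_]; rewrite // ltnS.
Qed.

(* The sum of a shifted family over a box misses only a face of the box. *)
Lemma bsum_mshift u i m : (forall a, a i = 0%N -> u a = 0) ->
  bsum u m.+1 = bsum (fun a => u (mshift i a)) m.+1
     - \sum_(a <- box_seq m.+1 | ~~ below i m a) u (mshift i a).
Proof.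
move=> u0; rewrite /bsum (bigID (fun a : mi => 0 < a i)%N) /= [X in _ + X]big1 ?addr0; last first.
  by move=> a; rewrite -leqNgt leqn0 => /eqP; apply: u0.
rewrite -big_filter (perm_big _ (mshift_perm i m)) big_map big_filter.
by rewrite [X in _ = X - _](bigID (below i m)) /= addrK.
Qed.

Lemma bsum_face u i m : (forall a, 0 <= u a) ->
  \sum_(a <- box_seq m.+1 | ~~ below i m a) u a <= bsum u m.+1 - bsum u m.
Proof.
move=> u0; rewrite bsumS addrAC subrr add0r big_mkcond [leRHS]big_mkcond ler_sum // => a _.
rewrite /below; case: ltnP => //= am; first by case: ifP.
suff -> : inbox m a = false by [].
by apply/negbTE/forallP => /(_ i); rewrite ltnNge am.
Qed.

Lemma bsum_mshift_le u i m M : (forall a, 0 <= u a) -> (forall m, bsum u m <= M) ->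
  bsum (fun a => u (mshift i a)) m <= M.
Proof.
move=> u0 uM; apply: le_trans (uM m.+1); rewrite /bsum -(big_map (mshift i) xpredT).
set s := [seq mshift i a | a <- box_seq m].
have us : uniq s by rewrite map_inj_uniq ?box_seq_uniq //; apply: mshift_inj.
have ps : perm_eq s [seq a <- box_seq m.+1 | a \in s].
  apply: uniq_perm; rewrite ?filter_uniq ?box_seq_uniq // => a.
  rewrite mem_filter andb_idr // => /mapP[c]; rewrite !mem_box_seq => /forallP cm ->.
  by apply/forallP => j; rewrite ffunE; have cj := cm j; case: eqP => // _; exact: leq_trans cj (leqnSn m).
rewrite (perm_big _ ps) big_filter big_mkcond ler_sum // => a _.
by case: ifP.
Qed.

Hypothesis KC : bv_complete K.

Lemma bsum_cvg u M : (forall m, bsum (fun a => `|u a|) m <= M) ->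
  exists l : K, bsum u @ \oo --> l.
Proof. by move=> uM; apply: (KC (bsum_variation u) uM). Qed.

Lemma bsum_tail0 u M : (forall m, bsum (fun a => `|u a|) m <= M) ->
  (fun m => bsum (fun a => `|u a|) m.+1 - bsum (fun a => `|u a|) m) @ \oo --> (0 : K).
Proof.
move=> uM; have [|l cl] := KC (S := bsum (fun a => `|u a|)) _ uM.
  move=> m; rewrite ger0_norm // subr_ge0; apply: bsum_mono => a; exact: normr_ge0.
rewrite -(subrr l); apply: cvgB => //.
by move: cl; rewrite -cvg_shiftS.
Qed.

(** Shifting an index costs a face of the box. The face lies in the shell between two consecutive
    boxes, whose absolute sum tends to 0. *)
Lemma bsum_face0 u i M : (forall m, bsum (fun a => `|u a|) m <= M) ->
  (fun m => \sum_(a <- box_seq m.+1 | ~~ below i m a) u a) @ \oo --> (0 : K).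
Proof.
move=> uM; have /cvgrPdist_lt H := bsum_tail0 uM; apply/cvgrPdist_lt => e /H.
apply: filterS => m; rewrite !sub0r !normrN; apply: le_lt_trans.
apply: le_trans (ler_norm_sum _ _ _) _.
apply: le_trans (bsum_face i m (fun a => normr_ge0 (u a))) _.
by rewrite ger0_norm // subr_ge0; apply: bsum_mono => a; exact: normr_ge0.
Qed.

End Sums.
End Boxes.

Section PowerBounds.
Variable K : numFieldType.
Implicit Types x t s r : K.

(** Bernoulli's inequality for [r / s = 1 + h], with constant [h^-1]. *)
Lemma natmul_exp_bound s r : 0 < s -> s < r ->
  exists2 C : K, 0 <= C & forall k, k%:R * s ^+ k <= C * r ^+ k.
Proof.
move=> s0 sr; pose h := r / s - 1.
have h0 : 0 < h by rewrite subr_gt0 ltr_pdivlMr // mul1r.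
have eh : r = (1 + h) * s by rewrite /h addrC subrK divfK // gt_eqF.
exists h^-1 => [|k]; first by rewrite invr_ge0 ltW.
rewrite eh exprMn mulrA ler_wpM2r ?exprn_ge0 ?(ltW s0) // mulrC ler_pdivlMr //.
have : 1 + k%:R * h <= (1 + h) ^+ k.
  elim: k => [|k IHk]; first by rewrite mul0r addr0 expr0.
  rewrite exprS; apply: le_trans (ler_wpM2l _ IHk); last by rewrite addr_ge0 ?ler01 // ltW.
  have -> : (1 + h) * (1 + k%:R * h) = 1 + k.+1%:R * h + k%:R * h ^+ 2.
    by rewrite -natr1; ring.
  by rewrite lerDl mulr_ge0 ?ler0n // exprn_ge0 // ltW.
by apply: le_trans; rewrite lerDr ler01.
Qed.

Lemma natmul2_exp_bound s r : 0 < s -> s < r ->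
  exists2 C : K, 0 <= C & forall k, k%:R ^+ 2 * s ^+ k <= C * r ^+ k.
Proof.
move=> s0 sr; have [st tr] := midf_lt sr; set t := (s + r) / 2 in st tr.
have [C1 C1_0 H1] := natmul_exp_bound s0 st.
have [C2 C2_0 H2] := natmul_exp_bound (lt_trans s0 st) tr.
exists (C1 * C2) => [|k]; first exact: mulr_ge0.
rewrite expr2 -mulrA; apply: le_trans (ler_wpM2l (ler0n _ k) (H1 k)) _.
by rewrite mulrCA -mulrA ler_wpM2l.
Qed.

(** A bound for the second-order Taylor remainder; the factor [s ^+ 2] on the left avoids the
    exponent [k - 2]. *)
Lemma exp_remainder x t s k : `|x| + `|t| <= s ->
  s ^+ 2 * `|(x + t) ^+ k - x ^+ k - k%:R * t * x ^+ k.-1| <= `|t| ^+ 2 * (k%:R ^+ 2 * s ^+ k).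
Proof.
move=> xts; have s0 : 0 <= s by apply: le_trans xts; rewrite addr_ge0.
have xs : `|x| <= s by apply: le_trans xts; rewrite lerDl.
elim: k => [|k IHk].
  by rewrite !expr0 mul0r mul0r subrr subr0 normr0 mulr0 expr0n mul0r mulr0.
have -> : (x + t) ^+ k.+1 - x ^+ k.+1 - k.+1%:R * t * x ^+ k.+1.-1 =
   (x + t) * ((x + t) ^+ k - x ^+ k - k%:R * t * x ^+ k.-1) + k%:R * t ^+ 2 * x ^+ k.-1.
  case: k {IHk} => [|k] /=; first by rewrite !expr0 !mul0r !expr1; ring.
  rewrite (exprS (x + t) k.+1) (exprS x k.+1) (exprS x k) -[k.+2%:R]natr1.
  by move: (k.+1%:R : K) ((x + t) ^+ k.+1) (x ^+ k) => a b c; ring.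
rewrite (le_trans (ler_wpM2l (exprn_ge0 2 s0) (ler_normD _ _))) // mulrDr !normrM !normrX normr_nat.
have -> : `|t| ^+ 2 * (k.+1%:R ^+ 2 * s ^+ k.+1) =
    s * (`|t| ^+ 2 * (k%:R ^+ 2 * s ^+ k)) + `|t| ^+ 2 * ((k%:R *+ 2 + 1) * s ^+ k.+1).
  by rewrite -[k.+1%:R]natr1 [s ^+ k.+1]exprS; ring.
apply: lerD.
  rewrite mulrCA; apply: le_trans (ler_wpM2l s0 IHk).
  apply: ler_wpM2r; first by rewrite mulr_ge0 ?exprn_ge0.
  exact: le_trans (ler_normD _ _) xts.
have -> : s ^+ 2 * (k%:R * `|t| ^+ 2 * `|x| ^+ k.-1) = `|t| ^+ 2 * (k%:R * (`|x| ^+ k.-1 * s ^+ 2)).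
  by ring.
rewrite ler_wpM2l ?exprn_ge0 //; case: k {IHk} => [|k] /=.
  by rewrite mul0r mulr_ge0 // ?addr_ge0 ?exprn_ge0 // mul0rn.
apply: (@le_trans _ _ (k.+1%:R * s ^+ k.+2)).
  rewrite ler_wpM2l // -[k.+2]addn2 exprD ler_wpM2r ?exprn_ge0 //.
  by rewrite lerXn2r ?nnegrE.
by rewrite ler_wpM2r ?exprn_ge0 // mulr2n -addrA lerDl addr_ge0.
Qed.

End PowerBounds.

(** * Term-by-term differentiation *)

Section PowerSeries.
Variables (K : numFieldType) (n : nat).
Local Notation mi := {ffun 'I_n -> nat}.
Implicit Types (c : mi -> K) (v p : 'rV[K]_n) (f : scalar_fun K n) (r : K) (a : mi).

Definition ps_term c v a : K := c a * \prod_i v 0 i ^+ a i.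

Definition has_ps c r p f : Prop := forall v : 'rV[K]_n, (forall i, `|v 0 i| < r) ->
  (exists M : K, forall m, bsum (fun a => `|ps_term c v a|) m <= M) /\
  bsum (ps_term c v) @ \oo --> f (p + v).

Lemma pseries_bsum c v m : \sum_alpha @pseries_term K n c v m alpha = bsum (ps_term c v) m.
Proof.
rewrite /bsum /box_seq /image_mem big_map big_enum; apply: eq_bigr => al _.
by rewrite /ps_term; congr (_ * _); apply: eq_bigr => i _; rewrite ffunE.
Qed.

Lemma pseries_bsum_norm c v m :
  \sum_alpha `|@pseries_term K n c v m alpha| = bsum (fun a => `|ps_term c v a|) m.
Proof.
rewrite /bsum /box_seq /image_mem big_map big_enum; apply: eq_bigr => al _.
by rewrite /ps_term; congr (`|_ * _|); apply: eq_bigr => i _; rewrite ffunE.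
Qed.

Lemma analytic_atE p f : analytic_at p f <-> exists c, exists2 r, 0 < r & has_ps c r p f.
Proof.
split=> [[c [r r0 H]]|[c [r r0 H]]]; exists c, r => // v /H[[M HM] cv]; split.
- by exists M => m; rewrite -pseries_bsum_norm.
- by move: cv; under eq_fun do rewrite pseries_bsum.
- by exists M => m; rewrite pseries_bsum_norm.
- by under eq_fun do rewrite pseries_bsum.
Qed.

Lemma has_psW c r r' p f : r' <= r -> has_ps c r p f -> has_ps c r' p f.
Proof. by move=> rr H v vr; apply: H => i; apply: lt_le_trans (vr i) rr. Qed.

Definition setc v i (x : K) : 'rV[K]_n := \row_j (if j == i then x else v 0 j).

Definition offprod v i a : K := \prod_(j | j != i) v 0 j ^+ a j.

Lemma ps_term_setc c v i x a : ps_term c (setc v i x) a = c a * (x ^+ a i * offprod v i a).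
Proof.
rewrite /ps_term (bigD1 i) //= !mxE eqxx; congr (_ * (_ * _)).
by apply: eq_bigr => j /negPf ji; rewrite mxE ji.
Qed.

Lemma setc_id v i : setc v i (v 0 i) = v.
Proof. by apply/rowP => j; rewrite mxE; case: eqP => [->|]. Qed.

Lemma setcD v i t : setc v i (v 0 i + t) = v + t *: delta_mx 0 i.
Proof.
apply/rowP => j; rewrite !mxE eqxx /=; case: eqP => [->|_]; first by rewrite mulr1.
by rewrite mulr0 addr0.
Qed.

Lemma ps_termE c v i a : ps_term c v a = c a * (v 0 i ^+ a i * offprod v i a).
Proof. by rewrite -{1}(setc_id v i) ps_term_setc. Qed.

Lemma offprod_mshift v i a : offprod v i (mshift i a) = offprod v i a.
Proof. by apply: eq_bigr => j /negPf ji; rewrite ffunE ji. Qed.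

Definition dcoef i c a := (a i).+1%:R * c (mshift i a).

Lemma dcoef_comm i j c : dcoef i (dcoef j c) = dcoef j (dcoef i c).
Proof.
apply/funext => a; rewrite /dcoef mshift_comm !ffunE [i == j]eq_sym.
by case: eqP => [->|_] //; ring.
Qed.

(** The derivative of a term, still indexed by the exponents before differentiation, as the
    comparison with difference quotients requires; [dcoef] uses the exponents after it. *)
Definition dterm i c v a := c a * ((a i)%:R * v 0 i ^+ (a i).-1 * offprod v i a).

Lemma dterm_mshift i c v a : dterm i c v (mshift i a) = ps_term (dcoef i c) v a.
Proof.
by rewrite /dterm offprod_mshift (ps_termE _ _ i) ffunE eqxx /dcoef /=; ring.
Qed.

Lemma dterm0 i c v a : a i = 0%N -> dterm i c v a = 0.
Proof. by move=> ai; rewrite /dterm ai !mul0r mulr0. Qed.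

Lemma norm_cvg_le (x : nat -> K) (l B : K) : x @ \oo --> l -> (forall m, `|x m| <= B) -> `|l| <= B.
Proof.
move=> /cvgrPdist_lt xl xB.
have B0 : 0 <= B by apply: le_trans (xB 0%N).
have [//|Bl] := real_leP (normr_real l) (ger0_real B0).
have e0 : 0 < `|l| - B by rewrite subr_gt0.
have [m /= H] : exists m, `|l - x m| < `|l| - B.
  by have [m _ H] := xl _ e0; exists m; apply: H => /=.
have : `|l| < `|l|.
  rewrite -{1}[l](subrK (x m)) (le_lt_trans (ler_normD _ _)) //.
  by rewrite -[ltRHS](subrK B) ltr_leD.
by rewrite ltxx.
Qed.

Hypothesis KC : bv_complete K.

(** Difference quotients are compared with the differentiated series term by term. The remainders
    are dominated by the series at a point with a larger coordinate [i], so the total error is at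
    most a constant times [|t| ^+ 2]. *)
Lemma has_ps_deriv c r p f i : has_ps c r p f ->
  has_ps (dcoef i c) r p (partial i f) /\
  forall v, (forall i, `|v 0 i| < r) -> derivable f (p + v) (delta_mx 0 i).
Proof.
move=> H; suff main v : (forall i, `|v 0 i| < r) ->
    (exists M : K, forall m, bsum (fun a => `|ps_term (dcoef i c) v a|) m <= M) /\
    exists2 G : K, bsum (ps_term (dcoef i c) v) @ \oo --> G &
      (fun h => h^-1 *: ((f \o shift (p + v)) (h *: delta_mx 0 i) - f (p + v))) @ 0^' --> G.
  split=> v /main[Mv [G cG dG]].
    split=> //; suff -> : partial i f (p + v) = G by [].
    exact: (cvg_lim (@norm_hausdorff _ _) dG).
  by apply/cvg_ex; exists G.
(* Three equal gaps [|v 0 i| < s < rho < r]: the first makes room for the increment [t], the second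
   absorbs the factor [k%:R ^+ 2], the third keeps the majorizing point [w] inside the polydisc. *)
move=> vr; pose d := (r - `|v 0 i|) / 3%:R.
have d0 : 0 < d by rewrite divr_gt0 ?subr_gt0 ?vr // ltr0n.
pose s := `|v 0 i| + d; pose rho := s + d.
have s0 : 0 < s by rewrite ltr_wpDl.
have srho : s < rho by rewrite ltrDl.
have rhor : rho < r.
  have -> : r = rho + d by rewrite /rho /s /d; field.
  by rewrite ltrDl.
have [C C0 HC] := natmul2_exp_bound s0 srho.
pose w := setc v i rho.
have wr j : `|w 0 j| < r.
  by rewrite mxE; case: eqP => // _; rewrite gtr0_norm // (lt_trans s0).
have [[M HM] _] := H w wr.
have rho0 : 0 < rho by apply: lt_trans srho.
have wE a : `|ps_term c w a| = `|c a| * (rho ^+ a i * `|offprod v i a|).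
  by rewrite ps_term_setc !normrM normrX (gtr0_norm rho0).
have dbound a : `|ps_term (dcoef i c) v a| <= C / s * `|ps_term c w (mshift i a)|.
  rewrite wE offprod_mshift ffunE eqxx (ps_termE _ _ i) /dcoef !normrM normr_nat normrX.
  have -> : (a i).+1%:R * `|c (mshift i a)| * (`|v 0 i| ^+ a i * `|offprod v i a|) =
     `|c (mshift i a)| * `|offprod v i a| * ((a i).+1%:R * `|v 0 i| ^+ a i) by ring.
  have -> : C / s * (`|c (mshift i a)| * (rho ^+ (a i).+1 * `|offprod v i a|)) =
     `|c (mshift i a)| * `|offprod v i a| * (C * rho ^+ (a i).+1 / s).
    by field; rewrite gt_eqF.
  rewrite ler_wpM2l ?mulr_ge0 // ler_pdivlMr // (le_trans _ (HC _)) //.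
  rewrite -mulrA (@le_trans _ _ ((a i).+1%:R * s ^+ (a i).+1)) //.
    rewrite ler_wpM2l // exprSr ler_wpM2r ?(ltW s0) // lerXn2r ?nnegrE ?(ltW s0) //.
    by rewrite lerDl ltW.
  by rewrite ler_wpM2r ?exprn_ge0 ?(ltW s0) // expr2 ler_peMl // ler1n.
have bd : forall m, bsum (fun a => `|ps_term (dcoef i c) v a|) m <= C / s * M.
  move=> m; apply: (@le_trans _ _ (C / s * bsum (fun a => `|ps_term c w (mshift i a)|) m)).
    by rewrite /bsum mulr_sumr ler_sum.
  rewrite ler_wpM2l ?divr_ge0 ?(ltW s0) //.
  by apply: (bsum_mshift_le (u := fun a => `|ps_term c w a|)) => // a.
split; first by exists (C / s * M).
have [G cG] := bsum_cvg KC bd; exists G => //.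
have cdG : bsum (dterm i c v) @ \oo --> G.
  rewrite -cvg_shiftS; have -> : (fun m => bsum (dterm i c v) m.+1) = (fun m =>
      bsum (ps_term (dcoef i c) v) m.+1 - \sum_(a <- box_seq n m.+1 | ~~ below i m a) ps_term (dcoef i c) v a).
    apply/funext => m; rewrite (bsum_mshift m (@dterm0 i c v)) /bsum.
    by congr (_ - _); apply: eq_bigr => a _; rewrite dterm_mshift.
  rewrite -[G]subr0; apply: cvgB; last exact: bsum_face0 bd.
  by move: cG; rewrite -cvg_shiftS.
have rem (t : K) : `|t| <= d ->
    `|f (p + v + t *: delta_mx 0 i) - f (p + v) - t * G| <= `|t| ^+ 2 * (C / s ^+ 2 * M).
  move=> td; pose v' := setc v i (v 0 i + t).
  have xts : `|v 0 i| + `|t| <= s by rewrite lerD2l.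
  have v'r j : `|v' 0 j| < r.
    rewrite mxE; case: eqP => // _; apply: le_lt_trans (ler_normD _ _) _.
    by apply: le_lt_trans xts _; apply: lt_trans srho rhor.
  have [_ cv'] := H v' v'r; have [_ cv] := H v vr.
  have ct : (fun m => t * bsum (dterm i c v) m) @ \oo --> t * G by apply: cvgMl_tmp.
  rewrite (_ : p + v' = p + v + t *: delta_mx 0 i) in cv'; last by rewrite /v' setcD addrA.
  apply: (norm_cvg_le (x := fun m => bsum (ps_term c v') m - bsum (ps_term c v) m - t * bsum (dterm i c v) m)).
    by apply: cvgB ct; apply: cvgB cv' cv.
  move=> m.
  apply: (@le_trans _ _ (`|t| ^+ 2 * (C / s ^+ 2 * bsum (fun a => `|ps_term c w a|) m))); last first.
    by rewrite ler_wpM2l ?exprn_ge0 // ler_wpM2l // divr_ge0 ?exprn_ge0 ?(ltW s0).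
  rewrite /bsum mulr_sumr -!sumrB mulrA mulr_sumr.
  apply: le_trans (ler_norm_sum _ _ _) _; apply: ler_sum => a _.
  have -> : ps_term c v' a - ps_term c v a - t * dterm i c v a =
      c a * offprod v i a * ((v 0 i + t) ^+ a i - v 0 i ^+ a i - (a i)%:R * t * v 0 i ^+ (a i).-1).
    by rewrite ps_term_setc (ps_termE _ _ i) /dterm; ring.
  have -> : `|t| ^+ 2 * (C / s ^+ 2) * `|ps_term c w a| =
      `|c a * offprod v i a| * (`|t| ^+ 2 * (C * rho ^+ a i) / s ^+ 2).
    by rewrite wE normrM; field; rewrite gt_eqF.
  rewrite normrM ler_wpM2l // ler_pdivlMr ?exprn_gt0 // mulrC.
  apply: le_trans (exp_remainder _ xts) _.
  by rewrite ler_wpM2l ?exprn_ge0.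
have M0 : 0 <= M by apply: le_trans (HM 0%N); apply: bsum_ge0 => a.
(* Adding 1 makes the bound strictly positive, so that [e / B] is usable. *)
pose B := C / s ^+ 2 * M + 1.
have B0 : 0 < B.
  by rewrite ltr_wpDl // mulr_ge0 // divr_ge0 // exprn_ge0 // ltW.
apply/cvgrPdist_lt => e e0; near=> h.
have h0 : h != 0 by near: h; apply: nbhs_dnbhs_neq.
have hd : `|h| < d by near: h; apply: dnbhs0_lt.
have he : `|h| < e / B by near: h; apply: dnbhs0_lt; rewrite divr_gt0.
have := rem h (ltW hd); rewrite /= [h *: _ + _]addrC.
set q := f _ - f _ => qG.
have -> : G - h^-1 *: q = - (h^-1 * (q - h * G)) by rewrite /GRing.scale /=; field.
rewrite normrN normrM normfV ltr_pdivrMl ?normr_gt0 //.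
apply: le_lt_trans qG _; rewrite expr2 -mulrA ltr_pM2l ?normr_gt0 //.
apply: (@lt_trans _ _ (`|h| * B)); first by rewrite ltr_pM2l ?normr_gt0 // ltrDl.
by rewrite -ltr_pdivlMr.
Unshelve. all: by end_near.
Qed.

End PowerSeries.

Section AnalyticClosure.
Variables (K : numFieldType) (n : nat).
Hypothesis KC : bv_complete K.
Local Notation mi := {ffun 'I_n -> nat}.
Implicit Types (c : mi -> K) (v p : 'rV[K]_n) (f g : scalar_fun K n) (r x : K) (a : mi).

Lemma analytic_derivable p f i : analytic_at p f -> derivable f p (delta_mx 0 i).
Proof.
move=> /analytic_atE[c [r r0 H]]; have [_ /(_ 0)] := has_ps_deriv KC i H.
by rewrite addr0; apply=> j; rewrite mxE normr0.
Qed.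

Lemma analytic_partial p f i : analytic_at p f -> analytic_at p (partial i f).
Proof.
move=> /analytic_atE[c [r r0 H]]; have [H' _] := has_ps_deriv KC i H.
by apply/analytic_atE; exists (dcoef i c), r.
Qed.

(** Both sides are values at 0 of power series with the same coefficients, by [dcoef_comm]. *)
Lemma partial_comm p f i j : analytic_at p f ->
  partial i (partial j f) p = partial j (partial i f) p.
Proof.
move=> /analytic_atE[c [r r0 H]].
have [/(has_ps_deriv KC i)[Hij _] _] := has_ps_deriv KC j H.
have [/(has_ps_deriv KC j)[Hji _] _] := has_ps_deriv KC i H.
have v0 k : `|(0 : 'rV[K]_n) 0 k| < r by rewrite mxE normr0.
have [_ cij] := Hij 0 v0; have [_ cji] := Hji 0 v0.
rewrite dcoef_comm addr0 in cij; rewrite addr0 in cji.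
exact: (cvg_unique (@norm_hausdorff _ _) cij cji).
Qed.

Lemma analytic_add p f g : analytic_at p f -> analytic_at p g ->
  analytic_at p (fun z => f z + g z).
Proof.
move=> /analytic_atE[c [r r0 H]] /analytic_atE[c' [r' r'0 H']].
have [t [t0 tr tr']] : exists t, [/\ 0 < t, t <= r & t <= r'].
  have [rr|/ltW rr] := real_leP (gtr0_real r0) (gtr0_real r'0); [by exists r|by exists r'].
apply/analytic_atE; exists (fun a => c a + c' a), t => // v vt.
have [[M HM] cv] := has_psW tr H vt; have [[M' HM'] cv'] := has_psW tr' H' vt.
have eT a : ps_term (fun a => c a + c' a) v a = ps_term c v a + ps_term c' v a.
  by rewrite /ps_term mulrDl.
split.
  exists (M + M') => m; apply: le_trans (lerD (HM m) (HM' m)).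
  by rewrite /bsum -big_split; apply: ler_sum => a _; rewrite eT ler_normD.
have -> : bsum (ps_term (fun a => c a + c' a) v) = bsum (ps_term c v) + bsum (ps_term c' v).
  by apply/funext => m; rewrite fctE /bsum -big_split; apply: eq_bigr.
exact: cvgD.
Qed.

Lemma analytic_scale p f x : analytic_at p f -> analytic_at p (fun z => x * f z).
Proof.
move=> /analytic_atE[c [r r0 H]]; apply/analytic_atE.
exists (fun a => x * c a), r => // v /H[[M HM] cv].
have eT a : ps_term (fun a => x * c a) v a = x * ps_term c v a by rewrite /ps_term mulrA.
split.
  exists (`|x| * M) => m; apply: le_trans (ler_wpM2l (normr_ge0 x) (HM m)).
  by rewrite /bsum mulr_sumr; apply: ler_sum => a _; rewrite eT normrM.
have -> : bsum (ps_term (fun a => x * c a) v) = (fun m => x * bsum (ps_term c v) m).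
  by apply/funext => m; rewrite /bsum mulr_sumr; apply: eq_bigr.
exact: cvgMl_tmp.
Qed.

Lemma analytic_cst p x : analytic_at p (fun=> x).
Proof.
apply/analytic_atE; pose a0 : mi := [ffun=> 0%N].
exists (fun a => if a == a0 then x else 0), 1 => // v _.
(* The box of size 0 need not contain the zero multi-index, hence [m.+1]. *)
have eS (h : K -> K) m : h 0 = 0 ->
    \sum_(a <- box_seq n m.+1) h (ps_term (fun a => if a == a0 then x else 0) v a) = h x.
  move=> h0; rewrite (bigD1_seq a0) ?box_seq_uniq //=; last first.
    by rewrite mem_box_seq; apply/forallP => i; rewrite ffunE.
  rewrite /ps_term eqxx big1 => [|i _]; last by rewrite ffunE expr0.
  by rewrite mulr1 big1 ?addr0 // => a /negPf ->; rewrite mul0r.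
split.
  exists `|x| => m; apply: le_trans (bsum_mono _ _) _ => [a|]; first exact: normr_ge0.
  by rewrite /bsum (eS Num.norm) ?normr0.
rewrite -cvg_shiftS; have -> : (fun m => bsum (ps_term (fun a => if a == a0 then x else 0) v) m.+1) = cst x.
  by apply/funext => m; rewrite /bsum (eS id).
exact: cvg_cst.
Qed.

Definition scoef i c a : K := if (0 < a i)%N then c [ffun j => if j == i then (a j).-1 else a j] else 0.

Lemma scoef_mshift i c a : scoef i c (mshift i a) = c a.
Proof.
rewrite /scoef ffunE eqxx /=; congr c; apply/ffunP => j; rewrite !ffunE.
by case: eqP.
Qed.

(** The power series at [p] is multiplied by a variable, so its coefficients are shifted; the
    partial sums agree up to a face of the box. *)
Lemma analytic_shifted_coord p f i : analytic_at p f ->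
  analytic_at p (fun z : 'rV[K]_n => (z 0 i - p 0 i) * f z).
Proof.
move=> /analytic_atE[c [r r0 H]]; apply/analytic_atE.
exists (scoef i c), r => // v /H[[M HM] cv].
have eT a : ps_term (scoef i c) v (mshift i a) = v 0 i * ps_term c v a.
  rewrite !(ps_termE _ _ i) offprod_mshift scoef_mshift ffunE eqxx exprS; ring.
have T0 a : a i = 0%N -> ps_term (scoef i c) v a = 0.
  by move=> ai; rewrite /ps_term /scoef ai mul0r.
have HM' m : bsum (fun a => `|v 0 i * ps_term c v a|) m <= `|v 0 i| * M.
  apply: le_trans (ler_wpM2l (normr_ge0 _) (HM m)).
  by rewrite /bsum mulr_sumr; apply: ler_sum => a _; rewrite normrM.
split.
  exists (`|v 0 i| * M) => m; apply: le_trans (bsum_mono _ _) _ => [a|]; first exact: normr_ge0.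
  rewrite (@bsum_mshift _ _ (fun a => `|ps_term (scoef i c) v a|) i) => [|a /T0 ->]; last by rewrite normr0.
  apply: le_trans (HM' m.+1); rewrite lerBlDr.
  have -> : bsum (fun a => `|ps_term (scoef i c) v (mshift i a)|) m.+1 = bsum (fun a => `|v 0 i * ps_term c v a|) m.+1.
    by apply: eq_bigr => a _; rewrite eT.
  by rewrite lerDl sumr_ge0.
rewrite -cvg_shiftS; have -> : (fun m => bsum (ps_term (scoef i c) v) m.+1) = (fun m =>
    v 0 i * bsum (ps_term c v) m.+1 - \sum_(a <- box_seq n m.+1 | ~~ below i m a) v 0 i * ps_term c v a).
  apply/funext => m; rewrite (bsum_mshift m T0) /bsum mulr_sumr.
  by congr (_ - _); apply: eq_bigr => a _; rewrite eT.
have -> : ((p + v) 0 i - p 0 i) * f (p + v) = v 0 i * f (p + v) - 0.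
  by rewrite mxE subr0 addrAC subrr add0r.
apply: cvgB; last exact: (bsum_face0 KC (u := fun a => v 0 i * ps_term c v a) i HM').
by apply: cvgMl_tmp; move: cv; rewrite -cvg_shiftS.
Qed.

Lemma analytic_coord p f i : analytic_at p f -> analytic_at p (fun z : 'rV[K]_n => z 0 i * f z).
Proof.
move=> af; have -> : (fun z : 'rV[K]_n => z 0 i * f z) = (fun z => (z 0 i - p 0 i) * f z + p 0 i * f z).
  by apply/funext => z; ring.
by apply: analytic_add; [apply: analytic_shifted_coord|apply: analytic_scale].
Qed.

(** Multiplying by one coordinate at a time avoids Cauchy products; polynomial factors are all that
    the operators of the flow contain. *)
Lemma analytic_poly_mul (P : mpoly n K) p f : analytic_at p f ->
  analytic_at p (fun z : 'rV[K]_n => meval (z 0) P * f z).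
Proof.
move=> af; elim/mpolyind: P => [|x m P _ _ IHP].
  have -> : (fun z : 'rV[K]_n => meval (z 0) 0 * f z) = (fun=> 0).
    by apply/funext => z; rewrite meval0 mul0r.
  exact: analytic_cst.
have -> : (fun z : 'rV[K]_n => meval (z 0) (x *: mpolyX K m + P) * f z) =
    (fun z => x * (meval (z 0) (mpolyX K m) * f z) + meval (z 0) P * f z).
  by apply/funext => z; rewrite mevalD mevalZ; ring.
apply: analytic_add IHP; apply: analytic_scale.
have -> : (fun z : 'rV[K]_n => meval (z 0) (mpolyX K m) * f z) =
    (fun z => (\prod_(i <- index_enum 'I_n) z 0 i ^+ m i) * f z).
  by apply/funext => z; rewrite mevalX.
elim: (index_enum _) => [|i s IHs].
  by under eq_fun do rewrite big_nil mul1r.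
under eq_fun do rewrite big_cons -mulrA.
elim: (m i) => [|k IHk]; first by under eq_fun do rewrite expr0 mul1r.
by under eq_fun do rewrite exprS -mulrA; apply: analytic_coord.
Qed.

Lemma analytic_poly (P : mpoly n K) p : analytic_at p (fun z : 'rV[K]_n => meval (z 0) P).
Proof.
have := analytic_poly_mul P (analytic_cst p 1).
by under eq_fun do rewrite mulr1.
Qed.

Lemma partial_cst x i p : partial i (fun=> x) p = 0 :> K.
Proof. exact: derive_cst. Qed.

Lemma partialD p f g i : analytic_at p f -> analytic_at p g ->
  partial i (fun z => f z + g z) p = partial i f p + partial i g p.
Proof. by move=> /(analytic_derivable (i := i)) df /(analytic_derivable (i := i)) dg; apply: deriveD. Qed.

Lemma partialM p f g i : analytic_at p f -> analytic_at p g ->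
  partial i (fun z => f z * g z) p = partial i f p * g p + f p * partial i g p.
Proof.
move=> /(analytic_derivable (i := i)) df /(analytic_derivable (i := i)) dg.
by have := deriveM df dg; rewrite addrC [g p *: _]mulrC; apply.
Qed.

Lemma partialZ p f x i : analytic_at p f -> partial i (fun z => x * f z) p = x * partial i f p.
Proof. by move=> af; rewrite (partialM _ (analytic_cst _ _) af) partial_cst mul0r add0r. Qed.

Lemma partial_coord p i j : partial i (fun z : 'rV[K]_n => z 0 j) p = (i == j)%:R.
Proof.
apply: (cvg_lim (@norm_hausdorff _ _)); apply/cvgrPdist_lt => e e0; near=> h.
have h0 : h != 0 by near: h; apply: nbhs_dnbhs_neq.
rewrite /= !mxE eqxx /= addrK eq_sym /GRing.scale /= mulrA mulVf // mul1r subrr normr0 //.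
Unshelve. all: by end_near.
Qed.

Lemma partial_poly (P : mpoly n K) p i : partial i (fun z : 'rV[K]_n => meval (z 0) P) p = meval (p 0) (mderiv i P).
Proof.
pose good P := forall p i, partial i (fun z : 'rV[K]_n => meval (z 0) P) p = meval (p 0) (mderiv i P).
have goodC x : good (mpolyC n x).
  move=> q j; under eq_fun do rewrite mevalC.
  by rewrite partial_cst mderivC meval0.
have goodM P1 P2 : good P1 -> good P2 -> good (P1 * P2).
  move=> g1 g2 q j; under eq_fun do rewrite mevalM.
  by rewrite (partialM _ (analytic_poly _ _) (analytic_poly _ _)) g1 g2 mderivM mevalD !mevalM.
have goodD P1 P2 : good P1 -> good P2 -> good (P1 + P2).
  move=> g1 g2 q j; under eq_fun do rewrite mevalD.
  by rewrite (partialD _ (analytic_poly _ _) (analytic_poly _ _)) g1 g2 mderivD mevalD.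
have goodX k : good (mpolyX K (mnm1 k)).
  move=> q j; under eq_fun do rewrite mevalXU.
  by rewrite partial_coord mderivXi -mpolyC_nat mevalC.
suff : good P by apply.
elim/mpolyind: P => [|x m P _ _ IHP]; first by rewrite -mpolyC0.
rewrite -mul_mpolyC; apply: (goodD _ _ _ IHP); apply: (goodM _ _ (goodC x)).
rewrite mpolyXE_id; apply: (big_ind good) => [||k _]; first by rewrite -mpolyC1.
  by move=> P1 P2; apply: (goodM P1 P2).
elim: (m k) => [|l IHl]; first by rewrite expr0 -mpolyC1.
by rewrite exprS; apply: (goodM _ _ (goodX k) IHl).
Qed.

End AnalyticClosure.

(** * Magri-Lenard chains *)

Section PolynomialFields.
Variables (K : numFieldType) (N : nat).
Hypothesis KC : bv_complete K.
Local Notation A := (mpoly N K).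
Local Notation Xv i := (mpolyX K (mnm1 i) : A).
Implicit Types (Z : 'I_N -> A) (P Q : 'I_N -> 'I_N -> A) (p : 'rV[K]_N) (f g : scalar_fun K N).

Definition vf_of Z : vector_field K N := fun p => \row_i meval (p 0) (Z i).
Definition bf_of P : bivector_field K N := fun p => \matrix_(i, j) meval (p 0) (P i j).

Lemma meval_sum (I : finType) (F : I -> A) (v : 'I_N -> K) :
  meval v (\sum_i F i) = \sum_i meval v (F i).
Proof. exact: raddf_sum. Qed.

Lemma schouten_vb_of Z P : schouten_vb (vf_of Z) (bf_of P) = bf_of (plie Z P).
Proof.
apply/funext => p; apply/matrixP => i j; rewrite !mxE /plie !mevalB pbrXl pbrXr /der !meval_sum.
rewrite -!sumrB; apply: eq_bigr => l _ /=; rewrite !mevalM.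
rewrite -!(partial_poly KC) !mxE; congr (_ * _ - _ * _ - _ * _).
- by congr partial; apply/funext => z; rewrite mxE.
- by congr partial; apply/funext => z; rewrite mxE.
- by congr partial; apply/funext => z; rewrite mxE.
Qed.

Lemma schouten_bb_of P Q p i j k :
  schouten_bb (bf_of P) (bf_of Q) p i j k = meval (p 0) (pjac P Q (Xv i) (Xv j) (Xv k)).
Proof.
have E P' Q' x y z : \sum_l bf_of P' p x l * partial l (fun z0 => bf_of Q' z0 y z) p =
    meval (p 0) (pbr P' (Xv x) (pbr Q' (Xv y) (Xv z))).
  rewrite pbrX pbrXl meval_sum; apply: eq_bigr => l _; rewrite mevalM -(partial_poly KC) mxE.
  by congr (_ * partial _ _ _); apply/funext => t; rewrite mxE.
have T x y z : \sum_l (bf_of P p x l * partial l (fun t => bf_of Q t y z) p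
      + bf_of Q p x l * partial l (fun t => bf_of P t y z) p) =
    meval (p 0) (jac_term (pbr P) (pbr Q) (Xv x) (Xv y) (Xv z)).
  by rewrite mevalD -(E P Q) -(E Q P) -big_split.
rewrite /jac 2!mevalD.
exact: (f_equal2 +%R (f_equal2 +%R (T i j k) (T j k i)) (T k i j)).
Qed.

Lemma schouten_bf_of P (F : A) p i :
  schouten_bf (bf_of P) (fun z => meval (z 0) F) p 0 i = meval (p 0) (pbr P (Xv i) F).
Proof.
rewrite mxE pbrXl meval_sum; apply: eq_bigr => l _.
by rewrite mevalM -(partial_poly KC) mxE.
Qed.

Lemma schouten_vf_of Z (F : A) p :
  schouten_vf (vf_of Z) (fun z => meval (z 0) F) p = meval (p 0) (der Z F).
Proof.
rewrite /schouten_vf /der meval_sum; apply: eq_bigr => l _.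
by rewrite mevalM -(partial_poly KC) mxE.
Qed.

(** Turns the pointwise Poisson condition on pi2 into a polynomial identity. By induction on the
    degree all partial derivatives of [F] are 0, so [F] is constant in characteristic 0. *)
Lemma meval_eq0 (F : A) : (forall p : 'rV[K]_N, meval (p 0) F = 0) -> F = 0.
Proof.
have [m] := ubnP (msize F); elim: m F => // m IHm F sF F0.
have d0 i : mderiv i F = 0.
  have [->|Fn0] := eqVneq F 0; first by rewrite raddf0.
  apply: IHm => [|p].
    apply: leq_ltn_trans (msize_mderiv i F) _.
    by rewrite -ltnS prednK // lt0n msize_poly_eq0.
  rewrite -(partial_poly KC); have -> : (fun z : 'rV[K]_N => meval (z 0) F) = (fun=> 0) by apply/funext.
  exact: partial_cst.
have Fc : F = mpolyC N (mcoeff mnm0 F).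
  apply/mpolyP => k; rewrite mcoeffC; case: eqVneq => [->|k0]; first by rewrite mulr1.
  rewrite mulr0; have [i ki] : exists i, (0 < k i)%N.
    apply/existsP; apply: contraNT k0; rewrite negb_exists => /forallP k0.
    by apply/eqP/mnmP => i; rewrite mnm0E; apply/eqP; have := k0 i; rewrite -eqn0Ngt.
  have := congr1 (mcoeff (mnm_sub k (mnm1 i))) (d0 i); rewrite mcoeff_deriv mcoeff0.
  have -> : mnm_add (mnm_sub k (mnm1 i)) (mnm1 i) = k.
    apply/mnmP => l; rewrite mnmDE mnmBE mnm1E; case: eqP => [<-|_]; first by rewrite subnK.
    by rewrite subn0 addn0.
  by move/eqP; rewrite mulrn_eq0 /= => /eqP.
by have := F0 0; rewrite Fc mevalC => ->; rewrite mpolyC0.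
Qed.

(** Openness of [U] is what allows the equations that hold on [U] to be differentiated. *)
Lemma partial_near0 (U : set 'rV[K]_N) f i p : open U -> U p -> (forall z, U z -> f z = 0) ->
  partial i f p = 0.
Proof.
move=> oU Up f0; rewrite -(partial_cst 0 i p).
apply: near_eq_derive; have : \forall z \near p, U z by apply: open_nbhs_nbhs.
by apply: filterS => z /f0.
Qed.
End PolynomialFields.

(** Strong recursion: each Taylor coefficient of the flow depends on all the preceding ones. *)
Lemma course_of_values (T : Type) (x0 : T) (step : seq T -> T) :
  exists F : nat -> T, forall m, F m = step (mkseq F m).
Proof.
pose G m := iter m (fun s => rcons s (step s)) [::].
exists (fun m => step (G m)) => m; congr step.
by elim: m => //= m IHm; rewrite mkseqS -IHm.
Qed.

Section Chain.
Variables (K : numFieldType) (N : nat).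
Hypothesis KC : bv_complete K.
Local Notation A := (mpoly N K).
Implicit Types (Z : 'I_N -> A) (P Q : 'I_N -> 'I_N -> A) (p : 'rV[K]_N) (f g : scalar_fun K N).

Definition vapp Z f : scalar_fun K N := fun p => \sum_l meval (p 0) (Z l) * partial l f p.
Definition bapp P f (i : 'I_N) : scalar_fun K N :=
  fun p => \sum_j meval (p 0) (P i j) * partial j f p.

Lemma schouten_vfE Z f : schouten_vf (vf_of Z) f = vapp Z f.
Proof. by apply/funext => p; apply: eq_bigr => l _; rewrite mxE. Qed.

Lemma schouten_bfE P f p i : schouten_bf (bf_of P) f p 0 i = bapp P f i p.
Proof. by rewrite mxE; apply: eq_bigr => l _; rewrite mxE. Qed.

Lemma analytic_sum (I : Type) (r : seq I) (f : I -> scalar_fun K N) p :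
  (forall i, analytic_at p (f i)) -> analytic_at p (fun z => \sum_(i <- r) f i z).
Proof.
move=> af; elim: r => [|i r IHr].
  by under eq_fun do rewrite big_nil; apply: analytic_cst.
by under eq_fun do rewrite big_cons; apply: analytic_add.
Qed.

Lemma partial_sum (I : Type) (r : seq I) (f : I -> scalar_fun K N) p l :
  (forall i, analytic_at p (f i)) ->
  partial l (fun z => \sum_(i <- r) f i z) p = \sum_(i <- r) partial l (f i) p.
Proof.
move=> af; elim: r => [|i r IHr].
  by under eq_fun do rewrite big_nil; rewrite big_nil partial_cst.
under eq_fun do rewrite big_cons.
by rewrite big_cons (partialD KC l (af i) (analytic_sum _ af)) IHr.
Qed.

Lemma analytic_mul_partial (F : A) f l p : analytic_at p f ->
  analytic_at p (fun z => meval (z 0) F * partial l f z).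
Proof. by move=> af; apply/(analytic_poly_mul KC)/(analytic_partial KC). Qed.

Lemma analytic_vapp Z f p : analytic_at p f -> analytic_at p (vapp Z f).
Proof. by move=> af; apply: analytic_sum => l; apply: analytic_mul_partial. Qed.

Lemma analytic_bapp P f i p : analytic_at p f -> analytic_at p (bapp P f i).
Proof. by move=> af; apply: analytic_sum => l; apply: analytic_mul_partial. Qed.

Lemma vappD Z f g p : analytic_at p f -> analytic_at p g ->
  vapp Z (fun z => f z + g z) p = vapp Z f p + vapp Z g p.
Proof.
move=> af ag; rewrite /vapp -big_split; apply: eq_bigr => l _ /=.
by rewrite (partialD KC l af ag) mulrDr.
Qed.

Lemma bapp_sum (I : Type) (r : seq I) (f : I -> scalar_fun K N) P i p :
  (forall k, analytic_at p (f k)) ->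
  bapp P (fun z => \sum_(k <- r) f k z) i p = \sum_(k <- r) bapp P (f k) i p.
Proof.
move=> af; rewrite /bapp exchange_big; apply: eq_bigr => l _ /=.
by rewrite (partial_sum r l af) mulr_sumr.
Qed.

Lemma bappZ P x f i p : analytic_at p f -> bapp P (fun z => x * f z) i p = x * bapp P f i p.
Proof.
move=> af; rewrite /bapp mulr_sumr; apply: eq_bigr => l _.
by rewrite (partialZ KC x l af) mulrCA.
Qed.

Lemma bapp0 P i p : bapp P (fun=> 0) i p = 0.
Proof. by apply: big1 => l _; rewrite partial_cst mulr0. Qed.

Lemma partial_mul_partial (F : A) f l j p : analytic_at p f ->
  partial l (fun z => meval (z 0) F * partial j f z) p =
  meval (p 0) (mderiv l F) * partial j f p + meval (p 0) F * partial l (partial j f) p.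
Proof.
move=> af; rewrite (partialM KC l (analytic_poly KC F p) (analytic_partial KC j af)).
by rewrite (partial_poly KC).
Qed.

(* [Z, P(f)] = [Z, P](f) + P(Z f), in components. *)
Lemma lie_bapp Z P f i p : analytic_at p f ->
  vapp Z (bapp P f i) p - \sum_l bapp P f l p * meval (p 0) (mderiv l (Z i)) =
  bapp (plie Z P) f i p + bapp P (vapp Z f) i p.
Proof.
move=> af; have am F j : analytic_at p (fun z => meval (z 0) F * partial j f z).
  exact: analytic_mul_partial.
have eV : vapp Z (bapp P f i) p = \sum_l \sum_j (meval (p 0) (Z l) *
    (meval (p 0) (mderiv l (P i j)) * partial j f p + meval (p 0) (P i j) * partial l (partial j f) p)).
  apply: eq_bigr => l _; rewrite -mulr_sumr; congr (_ * _).
  rewrite (partial_sum _ l (fun j => am (P i j) j)).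
  by apply: eq_bigr => j _; rewrite partial_mul_partial.
have eB : bapp P (vapp Z f) i p = \sum_j \sum_l (meval (p 0) (P i j) *
    (meval (p 0) (mderiv j (Z l)) * partial l f p + meval (p 0) (Z l) * partial j (partial l f) p)).
  apply: eq_bigr => j _; rewrite -mulr_sumr; congr (_ * _).
  rewrite (partial_sum _ j (fun l => am (Z l) l)).
  by apply: eq_bigr => l _; rewrite partial_mul_partial.
have eL : bapp (plie Z P) f i p = \sum_j \sum_l ((meval (p 0) (Z l) * meval (p 0) (mderiv l (P i j))
    - meval (p 0) (P l j) * meval (p 0) (mderiv l (Z i))
    - meval (p 0) (P i l) * meval (p 0) (mderiv l (Z j))) * partial j f p).
  apply: eq_bigr => j _; rewrite -mulr_suml; congr (_ * _).
  rewrite /plie !mevalB pbrXl pbrXr /der !meval_sum -!sumrB; apply: eq_bigr => l _.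
  by rewrite !mevalM.
have eS : \sum_l bapp P f l p * meval (p 0) (mderiv l (Z i)) =
    \sum_j \sum_l meval (p 0) (P l j) * partial j f p * meval (p 0) (mderiv l (Z i)).
  by rewrite exchange_big; apply: eq_bigr => l _; rewrite mulr_suml.
rewrite eV eB eL eS exchange_big -sumrB /=.
have -> : \sum_j \sum_l (meval (p 0) (P i j) *
    (meval (p 0) (mderiv j (Z l)) * partial l f p + meval (p 0) (Z l) * partial j (partial l f) p)) =
  \sum_j \sum_l (meval (p 0) (P i l) * (meval (p 0) (mderiv l (Z j)) * partial j f p)) +
  \sum_j \sum_l (meval (p 0) (P i j) * (meval (p 0) (Z l) * partial j (partial l f) p)).
  rewrite [X in _ = X + _]exchange_big -big_split; apply: eq_bigr => j _.
  by rewrite -big_split; apply: eq_bigr => l _; rewrite mulrDr.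
rewrite addrA -!big_split; apply: eq_bigr => j _ /=; rewrite -sumrB -!big_split.
by apply: eq_bigr => l _ /=; rewrite (partial_comm KC l j af); ring.
Qed.

Variables (P1 P2 : 'I_N -> 'I_N -> A) (Z : nat -> 'I_N -> A).
Hypothesis Z0P : plie (Z 0) P1 = P2.
Hypothesis ZSP : forall k i j, plie (Z k.+1) P1 i j + plie (Z k) P2 i j = 0.

(** The recursion is the coefficient of [t ^ m] in [d/dt f_t = Z_t f_t], divided by the [m.+1] that
    comes from the derivative. *)
Lemma flow_exists f : exists F : nat -> scalar_fun K N, F 0%N = f /\
  forall m p, F m.+1 p = m.+1%:R^-1 * \sum_(k < m.+1) vapp (Z k) (F (m - k)%N) p.
Proof.
pose step (s : seq (scalar_fun K N)) : scalar_fun K N := if s is [::] then f else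
  fun p => (size s)%:R^-1 * \sum_(k < size s) vapp (Z k) (nth f s ((size s).-1 - k)) p.
have [F FP] := course_of_values f step; exists F; split=> [|m p]; first by rewrite FP.
rewrite FP; have : step (mkseq F m.+1) = fun p => m.+1%:R^-1 *
    \sum_(k < m.+1) vapp (Z k) (nth f (mkseq F m.+1) (m - k)) p.
  have : size (mkseq F m.+1) = m.+1 by rewrite size_mkseq.
  by rewrite /step; case: (mkseq F m.+1) => // g s ->.
move=> ->; congr (_ * _); apply: eq_bigr => k _; rewrite nth_mkseq //.
by rewrite ltnS leq_subr.
Qed.

(** Strong induction on the power of [t]: [m.+1] times the coefficient of [t ^ m.+1] in [pi_t(f_t)]
    is the coefficient of [t ^ m] in the Lie derivative of [pi_t(f_t)] along [Z_t], which involves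
    only lower coefficients. *)
Lemma flow_chain U F : open U -> (forall p, U p -> analytic_at p (F 0%N)) ->
    (forall m p, F m.+1 p = m.+1%:R^-1 * \sum_(k < m.+1) vapp (Z k) (F (m - k)%N) p) ->
    (forall p i, U p -> bapp P1 (F 0%N) i p = 0) ->
  (forall m p, U p -> analytic_at p (F m)) /\
  forall m p i, U p -> bapp P1 (F m.+1) i p + bapp P2 (F m) i p = 0.
Proof.
move=> oU aF0 Frec casF.
have FE m : F m.+1 = fun p => m.+1%:R^-1 * \sum_(k < m.+1) vapp (Z k) (F (m - k)%N) p.
  by apply/funext => p; apply: Frec.
have aF m p : U p -> analytic_at p (F m).
  move=> Up; elim/ltn_ind: m => -[|m] IHm; first exact: aF0.
  rewrite FE; apply: (analytic_scale (f := fun p => \sum_(k < m.+1) vapp (Z k) (F (m - k)%N) p)).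
  by apply: analytic_sum => k; apply/analytic_vapp/IHm; rewrite ltnS leq_subr.
split=> //.
(* The sequence shifted by one, with 0 in front, so that [bapp P1 (F m) i p + bapp P2 (F' m) i p] is
   the coefficient of [t ^ m] for every [m], including 0. *)
pose F' m : scalar_fun K N := if m is m'.+1 then F m' else fun=> 0.
have aF' m p : U p -> analytic_at p (F' m).
  by case: m => [|m] Up; [apply: analytic_cst|apply: aF].
suff H : forall m p i, U p -> bapp P1 (F m) i p + bapp P2 (F' m) i p = 0 by move=> m p i /(H m.+1).
have vapp0 Z' p : vapp Z' (fun=> 0) p = 0.
  by apply: big1 => l _; rewrite partial_cst mulr0.
move=> m; elim/ltn_ind: m => -[|m] IHm p i Up; first by rewrite casF // bapp0 addr0.
have eF : (fun z => m.+1%:R * F m.+1 z) = (fun z => \sum_(k < m.+1) vapp (Z k) (F (m - k)%N) z).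
  by apply/funext => z; rewrite Frec mulrA divff ?mul1r // pnatr_eq0.
have eF' : (fun z => m%:R * F m z) = (fun z => \sum_(k < m.+1) vapp (Z k) (F' (m - k)%N) z).
  apply/funext => z; rewrite big_ord_recr /= subnn [F' 0%N]/= vapp0 addr0.
  case: m {IHm eF} => [|m]; first by rewrite big_ord0 mul0r.
  rewrite Frec mulrA divff ?mul1r ?pnatr_eq0 //; apply: eq_bigr => k _.
  by rewrite subSn // -ltnS.
(* Both sides vanish by induction, since they only involve the coefficient of [t ^ (m - k)]. *)
have lieH k : vapp (Z k) (bapp P1 (F (m - k)%N) i) p + vapp (Z k) (bapp P2 (F' (m - k)%N) i) p =
   \sum_l (bapp P1 (F (m - k)%N) l p + bapp P2 (F' (m - k)%N) l p) * meval (p 0) (mderiv l (Z k i)).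
  rewrite -vappD; [|exact/analytic_bapp/aF|exact/analytic_bapp/aF'].
  have mk : (m - k < m.+1)%N by rewrite ltnS leq_subr.
  rewrite [LHS]big1 => [|l _].
    by rewrite big1 // => l _; rewrite IHm // mul0r.
  rewrite (partial_near0 l oU Up) ?mulr0 // => z Uz; exact: IHm.
have sum0 : \sum_(k < m.+1) (bapp (plie (Z k) P1) (F (m - k)%N) i p
      + bapp P1 (vapp (Z k) (F (m - k)%N)) i p
      + (bapp (plie (Z k) P2) (F' (m - k)%N) i p + bapp P2 (vapp (Z k) (F' (m - k)%N)) i p)) = 0.
  apply: big1 => k _; rewrite -!lie_bapp; [|exact: aF'|exact: aF].
  rewrite addrACA lieH -opprD -big_split /=; apply/eqP; rewrite subr_eq0; apply/eqP.
  by apply: eq_bigr => l _; rewrite mulrDl.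
have aVF k : analytic_at p (vapp (Z k) (F (m - k)%N)) by apply/analytic_vapp/aF.
have aVF' k : analytic_at p (vapp (Z k) (F' (m - k)%N)) by apply/analytic_vapp/aF'.
(* This is [[Z_t, pi_t] = pi2]: [[Z (k+1), P1]] and [[Z k, P2]] are applied to the same function and
   cancel, which leaves [[Z 0, P1] = P2] applied to [F m]. *)
have cancel : \sum_(k < m.+1) bapp (plie (Z k) P1) (F (m - k)%N) i p +
    \sum_(k < m.+1) bapp (plie (Z k) P2) (F' (m - k)%N) i p = bapp P2 (F m) i p.
  rewrite big_ord_recl [X in _ + X]big_ord_recr /= subnn subn0 Z0P bapp0 addr0.
  rewrite -[RHS]addr0 -addrA -big_split /=; congr (_ + _); apply: big1 => k _.
  rewrite /bump /= add1n subnS /F'; have : (0 < m - k)%N by rewrite subn_gt0.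
  case: (m - k)%N => // j _ /=; rewrite /bapp -big_split big1 //= => l _.
  by rewrite -mulrDl -mevalD ZSP meval0 mul0r.
have e1 : \sum_(k < m.+1) bapp P1 (vapp (Z k) (F (m - k)%N)) i p = m.+1%:R * bapp P1 (F m.+1) i p.
  rewrite -bappZ ?eF; last exact: aF.
  by apply/esym; apply: bapp_sum => k; apply: aVF.
have e2 : \sum_(k < m.+1) bapp P2 (vapp (Z k) (F' (m - k)%N)) i p = m%:R * bapp P2 (F m) i p.
  rewrite -bappZ ?eF'; last exact: aF.
  by apply/esym; apply: bapp_sum => k; apply: aVF'.
(* Of the [m.+1] copies of [bapp P2 (F m) i p], [m] come from [e2] and one from [cancel]. *)
have : m.+1%:R * (bapp P1 (F m.+1) i p + bapp P2 (F m) i p) = 0.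
  have split4 (x1 x2 x3 x4 : 'I_m.+1 -> K) : \sum_k (x1 k + x2 k + (x3 k + x4 k)) =
      (\sum_k x1 k + \sum_k x3 k) + (\sum_k x2 k + \sum_k x4 k).
    by rewrite !big_split /= addrACA.
  have := etrans (esym (f_equal2 +%R cancel (f_equal2 +%R e1 e2))) (etrans (esym (split4 _ _ _ _)) sum0).
  by move: (bapp _ _ _ _) (bapp _ _ _ _) => u v <-; rewrite -natr1; ring.
by move/eqP; rewrite mulf_eq0 pnatr_eq0 /= => /eqP.
Qed.

End Chain.

Section LiftedPolynomials.
Variables (K : numFieldType) (n : nat).
Local Notation A := (mpoly (1 + n) K).
Local Notation Xv i := (mpolyX K (mnm1 i) : A).
Local Notation i0 := (lshift n ord0 : 'I_(1 + n)).
Local Notation rs := (@rshift 1 n).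

Definition lift_poly (F : mpoly n K) : A := comp_mpoly [tuple Xv (rs i) | i < n] F.

Lemma meval_lift_poly (F : mpoly n K) (p : 'rV[K]_(1 + n)) :
  meval (p 0) (lift_poly F) = meval (rsubmx p 0) F.
Proof.
rewrite comp_mpoly_meval; apply: meval_eq => i.
by rewrite tnth_map tnth_ord_tuple mevalXU mxE.
Qed.

End LiftedPolynomials.

Section CentralTerms.
Variables (K : numFieldType) (s : vectType K) (br : s -> s -> s).
Hypotheses (hbr : is_lie_bracket br).
Variables (n : nat) (b : n.-tuple s).
Hypothesis hb : basis_of fullv b.
Local Notation A := (mpoly (1 + n) K).
Local Notation Xv i := (mpolyX K (mnm1 i) : A).
Local Notation i0 := (lshift n ord0 : 'I_(1 + n)).
Local Notation rs := (@rshift 1 n).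
Local Notation p1 := (lie_poly br b).

Lemma plieD (Z W : 'I_(1 + n) -> A) P i j :
  plie (fun k => Z k + W k) P i j = plie Z P i j + plie W P i j.
Proof.
have derD f : der (fun k => Z k + W k) f = der Z f + der W f.
  by rewrite /der -big_split; apply: eq_bigr => k _; rewrite mulrDl.
rewrite /plie derD (is_derD (pbr_derl P _)) (is_derD (pbr_derr P _)) !opprD.
by rewrite -[LHS]addrA [X in _ + X = _]addrACA [LHS]addrACA !addrA.
Qed.

(* The contribution of q d/dx_0 - x_0 E to the bracket with the Lie-Poisson
   bivector. *)
Lemma plie_central_terms (Q : A) (a : 'I_(1 + n) -> K) (be : K) i j :
    (forall l, a (rs l) = 0) ->
  plie (on_blocks (a i0 *: Q) (fun l => - (be *: (Xv i0 * Xv (rs l))))) p1 i j =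
  a i *: pbr p1 (Xv j) Q - a j *: pbr p1 (Xv i) Q + be *: (Xv i0 * p1 i j).
Proof.
move=> ar; set W := on_blocks _ _.
have a1 := lie_poly_antisym hbr hb; have aW := plie_antisym W a1.
have p0l l : pbr p1 (Xv i0) (Xv l) = 0 by apply: pbr_p1_0l.
have case0r l : plie W p1 i0 (rs l) =
    a i0 *: pbr p1 (Xv (rs l)) Q - a (rs l) *: pbr p1 (Xv i0) Q + be *: (Xv i0 * p1 i0 (rs l)).
  rewrite /plie (lie_poly0l hbr hb) (is_der0 (der_is_der W)) (pbr_p1_0l hbr hb) ar.
  rewrite scale0r mulr0 scaler0 addr0 !subr0 sub0r /W on_blocks0.
  by rewrite (is_derZ _ _ (pbr_derl _ _)) (pbrC a1 Q) scalerN opprK.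
case: (split_ordP i) => i' ->; case: (split_ordP j) => j' ->; rewrite ?(ord1 i') ?(ord1 j') //.
- rewrite (lie_poly0l hbr hb) mulr0 scaler0 addr0 subrr; apply: addrr_eq0.
  by rewrite {1}aW addNr.
- rewrite aW case0r [p1 (rs i') i0]a1 mulrN scalerN opprD; congr (_ - _).
  by rewrite opprB.
rewrite !ar !scale0r subrr add0r /plie lie_polyr // der_hat /W !on_blocksr.
have -> : \sum_l coord b l (br (tnth b i') (tnth b j')) *: on_blocks (a i0 *: Q)
    (fun l => - (be *: (Xv i0 * Xv (rs l)))) (rs l) = - (be *: (Xv i0 * p1 (rs i') (rs j'))).
  rewrite lie_polyr // /hat mulr_sumr scaler_sumr -sumrN; apply: eq_bigr => l _.
  by rewrite on_blocksr scalerN -scalerAr !scalerA mulrC.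
rewrite (is_derN (pbr_derl _ _)) (is_derN (pbr_derr _ _)) !opprK.
rewrite (is_derZ _ _ (pbr_derl _ _)) (is_derZ _ _ (pbr_derr _ _)).
have [_ ml] := pbr_derl p1 (Xv (rs j')); have [_ mr] := pbr_derr p1 (Xv (rs i')).
rewrite ml mr p0l mul0r add0r (pbr_p1_0r hbr hb) mul0r add0r pbrX.
by rewrite addNr add0r lie_polyr.
Qed.

End CentralTerms.

Theorem theorem3p4 (R : realType) (K : numFieldType)
    (hK : K = R \/ K = R[i])
    (s : vectType K) (br : s -> s -> s)
    (hbr : is_lie_bracket br) (hss : is_semisimple br)
    (n : nat) (b : n.-tuple s) (hb : basis_of fullv b)
    (pi2 : bivector_field K (1 + n))
    (hquad : quadratic_bf pi2) (hpoisson : is_poisson pi2)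
    (a : 'rV[K]_(1 + n)) (ha : cl_vector (lie_poisson_g br b) pi2 a)
    (X : vector_field K n) (hX : quadratic_vf X)
    (q : scalar_fun K n) (hq : homog_poly_fun 2 q)
    (hform : forall p,
       pi2 p = schouten_vb (tilde_vf a X q) (lie_poisson_g br b) p) :
  let pi1 := lie_poisson_g br b in
  let pi := schouten_vb (lift_vf X) pi1 in
  let qg := lift_fun q in
  [/\ is_poisson_pencil pi1 pi2,
      forall p, pi2 p =
        pi p - wedge (schouten_bf pi1 qg) (const_vf a) p + x0 a p *: pi1 p,
      forall p, schouten_vf (tilde_vf a X q) (x0 a) p = qg p &
      forall U : set 'rV[K]_(1 + n), open U ->
        [/\ forall f : scalar_fun K (1 + n), is_casimir U pi1 f ->
              exists F : nat -> scalar_fun K (1 + n),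
                magri_lenard_chain U pi1 pi2 F /\ F 0%N = f,
            exists F : nat -> scalar_fun K (1 + n),
              [/\ magri_lenard_chain U pi1 pi2 F, F 0%N = x0 a & F 1%N = qg] &
            canonical_family U pi1 pi2 qg]].
Proof.
(* Completeness and the embedding [iota] into C are the two properties of [R] and [R[i]] on which
   the proof rests. *)
have KC : bv_complete K.
  by case: hK => eK; clear -eK; subst K; [apply: bv_complete_real|apply: bv_complete_complex].
have [iota _] : exists iota : {rmorphism K -> R[i]}, True.
  by case: hK => eK; clear -eK; subst K; [exists (real_complex R)|exists idfun].
move=> pi1 pi qg.
pose i0 : 'I_(1 + n) := lshift n ord0; pose rs := @rshift 1 n.
pose xv i : mpoly (1 + n) K := mpolyX K (mnm1 i).
case: ha => a_s a_n0 _ _.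
(* The coordinate x_0 is [al^-1] times the standard one and d/dx_0 is [al] times the standard
   derivation, whence the factors in [W] below. *)
pose al := a 0 i0.
have ar j : a 0 (rs j) = 0 by have /rowP/(_ j) := a_s; rewrite !mxE.
have al0 : al != 0.
  apply: contra a_n0 => /eqP a0; apply/eqP/rowP => i; rewrite mxE.
  by case: (split_ordP i) => j -> //; rewrite (ord1 j).
have x0E p : x0 a p = meval (p 0) (al^-1 *: xv i0).
  by rewrite mevalZ mevalXU /x0 !mxE mulrC.
have x0f : x0 a = (fun p => meval (p 0) (al^-1 *: xv i0)) by apply/funext.
have /choice[XF XE] (i : 'I_n) : exists F : mpoly n K, forall p, X p 0 i = meval (p 0) F.
  by have [F _ FE] := hX i; exists F.
have [QF _ QE] := hq.
pose LQ := lift_poly QF.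
have qgE p : qg p = meval (p 0) LQ by rewrite meval_lift_poly -QE.
have qgf : qg = (fun p => meval (p 0) LQ) by apply/funext.
pose XZ := on_blocks 0 (fun j => lift_poly (XF j)).
pose W := on_blocks (al *: LQ) (fun j => - (al^-1 *: (xv i0 * xv (rs j)))).
pose Z0 i := XZ i + W i.
pose p1 := lie_poly br b.
have pi1E : pi1 = bf_of p1.
  apply/funext => p; apply/matrixP => i j; rewrite !mxE meval_sum; apply: eq_bigr => k _.
  by rewrite mevalZ mevalXU.
have liftE : lift_vf X = vf_of XZ.
  apply/funext => p; apply/rowP => i; rewrite [RHS]mxE.
  case: (split_ordP i) => j ->; rewrite /XZ.
    by rewrite (ord1 j) on_blocks0 meval0 row_mxEl mxE.
  by rewrite on_blocksr meval_lift_poly row_mxEr XE.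
have tildeE : tilde_vf a X q = vf_of Z0.
  have combE (u v w : 'rV[K]_(1 + n)) x y i : (u + x *: v - y *: w) 0 i = u 0 i + x * v 0 i - y * w 0 i.
    by rewrite !mxE.
  apply/funext => p; apply/rowP => i; rewrite [RHS]mxE mevalD /tilde_vf liftE combE [vf_of _ _ _ _]mxE /const_vf.
  rewrite -addrA; congr (_ + _); rewrite x0E /W.
  case: (split_ordP i) => j ->.
    by rewrite (ord1 j) on_blocks0 /euler_vf /lift_vf row_mxEl mxE mulr0 subr0 mevalZ -qgE mulrC.
  by rewrite on_blocksr ar mulr0 sub0r /euler_vf /lift_vf row_mxEr mevalN !mevalZ mevalM !mevalXU mxE mulrA.
pose p2 := plie Z0 p1.
have pi2E : pi2 = bf_of p2.
  by apply/funext => p; rewrite hform tildeE -/pi1 pi1E schouten_vb_of.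
have a1 : antisym p1 := lie_poly_antisym hbr hb.
have a2 : antisym p2 := plie_antisym Z0 a1.
have J22 f g h : pjac p2 p2 f g h = 0.
  apply: pjac_eq0 => // i j k; apply: (meval_eq0 KC) => p.
  by rewrite -(schouten_bb_of KC) -pi2E; case: hpoisson => _; apply.
have [J12 [Z [Z0E ZSP]]] := lie_sequence iota hbr hss hb a2 (erefl : plie Z0 p1 = p2) J22.
have J11 := pjac_lie_poly hbr hb.
have tilde_x0 p : schouten_vf (tilde_vf a X q) (x0 a) p = qg p.
  rewrite tildeE x0f (schouten_vf_of KC) qgE.
  rewrite (is_derZ _ _ (der_is_der Z0)) derX /Z0 /XZ /W !on_blocks0 add0r scalerA.
  by rewrite mulVf // scale1r.
split=> //.
- split => //.
    split; first by move=> p; rewrite pi1E; apply/matrixP => i j; rewrite !mxE a1 mevalN.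
    by move=> p i j k; rewrite pi1E (schouten_bb_of KC) J11 meval0.
  by move=> p i j k; rewrite pi1E pi2E (schouten_bb_of KC) J12 meval0.
- move=> p; rewrite pi2E /pi liftE pi1E (schouten_vb_of KC) qgf; apply/matrixP => i j.
  have combE (B B' B'' : 'M[K]_(1 + n)) x : (B - B' + x *: B'') i j = B i j - B' i j + x * B'' i j.
    by rewrite !mxE.
  rewrite combE [wedge _ _ _ _ _]mxE !(schouten_bf_of KC) x0E ![bf_of _ _ _ _]mxE /const_vf.
  rewrite /p2 plieD mevalD -addrA; congr (_ + _).
  rewrite (plie_central_terms hbr hb LQ _ i j ar) mevalD mevalB !mevalZ mevalM; ring.
move=> U oU.
(* The second member is recorded as well: for x_0 it is X~ x_0, which is q. *)
have chain f : is_casimir U pi1 f -> exists F : nat -> scalar_fun K (1 + n),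
    [/\ magri_lenard_chain U pi1 pi2 F, F 0%N = f & F 1%N = vapp Z0 f].
  move=> [af cf]; have [F [F0 Frec]] := flow_exists Z f.
  have [||||aF FP] := @flow_chain K (1 + n) KC p1 p2 Z _ ZSP U F oU.
  - by rewrite Z0E.
  - by move=> p Up; rewrite F0; apply: af.
  - exact: Frec.
  - by move=> p i Up; rewrite F0 -schouten_bfE -pi1E cf // mxE.
  exists F; split => //; last first.
    apply/funext => p; rewrite Frec invr1 mul1r big_ord1 subnn F0 Z0E //.
  split=> [i p Up||i p Up]; first exact: aF.
    by rewrite F0; split.
  by apply/rowP => j; rewrite [RHS]mxE [LHS]mxE pi1E pi2E !schouten_bfE FP.
have [F [Fc F0 F1]] : exists F : nat -> scalar_fun K (1 + n),
    [/\ magri_lenard_chain U pi1 pi2 F, F 0%N = x0 a & F 1%N = qg].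
  have [|F [Fc F0 F1]] := chain (x0 a).
    split=> [p _|p _]; first by rewrite x0f; apply: analytic_poly.
    apply/rowP => i; rewrite pi1E x0f (schouten_bf_of KC) mxE.
    by rewrite (is_derZ _ _ (pbr_derr _ _)) (pbr_p1_0r hbr hb) scaler0 meval0.
  exists F; split => //; rewrite F1 -schouten_vfE -tildeE; apply/funext => p; exact: tilde_x0.
split.
- by move=> f /chain[G [Gc G0 _]]; exists G.
- by exists F.
(* q is itself a member of a chain, so the identity of the line generates it. *)
exists 1%N, (fun=> qg), setT, (fun v => v 0 0); split=> //.
- by move=> _; exists F, 1%N.
- exact: openT.
- move=> v _; have := analytic_poly KC (mpolyX K (mnm1 (0 : 'I_1))) v.
  by under eq_fun do rewrite mevalXU.
- by move=> p _; rewrite mxE.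
Qed.
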